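(* Testing whether sort$(U,V)$, sort$(U,V,P)$ or keysorting$(U,V,Keys,P)$ has a support is NP-complete, even in the case where the variables in $U$ have pairwise disjoint domains.
   Context: Constraints are over variables with finite integer domains; a support of a constraint is an assignment of values from the domains to its variables satisfying it. The constraint sort$(U,V)$, with $U=\{u_1,\ldots,u_n\}$, $V=\{v_1,\ldots,v_n\}$, is satisfied iff the values of $v_1,\ldots,v_n$ are the sorted list of the values of $u_1,\ldots,u_n$. The constraint sort$(U,V,P)$ adds $n$ variables $P$ with domains included in $\{1,\ldots,n\}$, requiring in addition that the values of $P$ be all distinct and define the permutation associating $U$ to $V$. The constraint keysorting$(U,V,Keys,P)$ (with $Keys$ a positive integer) lets each variable be an $h$-tuple sorted lexicographically on its first $Keys$ components, and requires the sorting to be stable (variables with equal keys keep in $V$ their relative order in $U$); with $Keys=1$ it is sort$(U,V,P)$ plus stability. *)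

(* Defs.v *)
From HB Require Import structures.
From mathcomp Require Import all_boot all_order all_algebra.

Set Implicit Arguments.
Unset Strict Implicit.
Unset Printing Implicit Defensive.

Import Order.TTheory GRing.Theory Num.Theory.

Local Open Scope ring_scope.

(* A tape is two-way infinite: the first component lists the cells to the left
   of the head, nearest first; the second starts with the scanned cell.  All
   cells not listed are blank ([None]). *)
Definition tape (X : Type) : Type := (seq (option X) * seq (option X))%type.

Inductive move := MoveL | MoveR | Stay.

Definition scan (X : Type) (t : tape X) : option X := head None t.2.

Definition act (X : Type) (t : tape X) (w : option X * move) : tape X :=
  let r := w.1 :: behead t.2 in
  match w.2 with
  | MoveL => (behead t.1, head None t.1 :: r)
  | MoveR => (w.1 :: t.1, behead r)
  | Stay => (t.1, r)
  end.

(* A machine for functions from words over [A] to words over [B].  Its tape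
   alphabet is the disjoint union of [A], [B] and a finite set of auxiliary
   letters, plus the blank.  It has [extra.+1] tapes.  It halts when the
   transition table yields [None]. *)
Record machine (A B : finType) := Machine {
  extra : nat;
  aux : finType;
  state : finType;
  start : state;
  trans : state -> {ffun 'I_extra.+1 -> option (A + B + aux)} ->
          option (state * ('I_extra.+1 -> option (A + B + aux) * move))
}.

Section Run.
Variables (A B : finType) (M : machine A B).

Definition tape_letter : Type := (A + B + aux M)%type.

Definition config : Type := (state M * ('I_(extra M).+1 -> tape tape_letter))%type.

Definition table (c : config) := trans c.1 [ffun i => scan (c.2 i)].

Definition halted (c : config) : bool := ~~ isSome (table c).

(* Halted configurations are fixpoints of [step]. *)
Definition step (c : config) : config :=
  if table c is Some (q, w) then (q, fun i => act (c.2 i) (w i)) else c.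

(* The input is written on tape 0, with the head on its first letter. *)
Definition init (x : seq A) : config :=
  (start M, fun i => ([::],
     if i == ord0 then [seq Some (inl (inl a)) | a <- x] else [::])).

Fixpoint output_word (s : seq (option tape_letter)) : seq B :=
  if s is Some (inl (inr b)) :: s' then b :: output_word s' else [::].

(* The output is the longest word over [B] on tape 0 that starts under the
   head. *)
Definition output (c : config) : seq B := output_word (c.2 ord0).2.

End Run.

Definition polytime (A B : finType) (f : seq A -> seq B) : Prop :=
  exists (M : machine A B) (p : {poly nat}), forall x : seq A,
    let c := iter p.[size x] (@step A B M) (init M x) in
    halted c /\ output c = f x.

Definition language (A : finType) : Type := seq A -> Prop.

Definition in_P (A : finType) (L : language A) : Prop :=
  exists2 f : seq A -> bool,
    polytime (fun x => [:: f x]) & forall x, L x <-> f x.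

(* The pair of a word [x] over [A] and a certificate [y] over [B] is presented
   to the verifier as the concatenation of [x] and [y] over [A + B]. *)
Definition in_NP (A : finType) (L : language A) : Prop :=
  exists (B : finType) (V : language (A + B)%type) (p : {poly nat}),
    in_P V /\
    forall x : seq A, L x <->
      exists y : seq B, (size y <= p.[size x])%N /\ V (map inl x ++ map inr y).

Definition poly_reducible (A B : finType) (L : language A) (K : language B) :=
  exists2 f : seq A -> seq B, polytime f & forall x, L x <-> K (f x).

Definition NP_hard (B : finType) (K : language B) : Prop :=
  forall (A : finType) (L : language A), in_NP L -> poly_reducible L K.

Definition NP_complete (B : finType) (K : language B) : Prop :=
  in_NP K /\ NP_hard K.

Inductive symbol := LBracket | RBracket | Plus | Minus | Bit of bool.

Definition symbol_code (s : symbol) : 'I_4 + bool :=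
  match s with
  | LBracket => inl (inord 0)
  | RBracket => inl (inord 1)
  | Plus => inl (inord 2)
  | Minus => inl (inord 3)
  | Bit b => inr b
  end.

Definition symbol_decode (c : 'I_4 + bool) : symbol :=
  match c with
  | inl i => nth LBracket [:: LBracket; RBracket; Plus; Minus] i
  | inr b => Bit b
  end.

Lemma symbol_codeK : cancel symbol_code symbol_decode.
Proof. by case=> //=; rewrite inordK. Qed.

HB.instance Definition _ := Finite.copy symbol (can_type symbol_codeK).

(* Binary notation, least significant bit first, without superfluous zeros; in
   particular 0 has no bits. *)
Definition nat_bits (n : nat) : seq symbol :=
  [seq Bit (odd (n %/ 2 ^ k)) | k <- iota 0 (up_log 2 n.+1)].

Definition enc_int (z : int) : seq symbol :=
  (if 0 <= z then Plus else Minus) :: nat_bits `|z|%N.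

Definition enc_seq (T : Type) (enc : T -> seq symbol) (s : seq T) : seq symbol :=
  LBracket :: flatten (map enc s) ++ [:: RBracket].

(* The finite domain of an integer variable, given by listing its elements. *)
Definition domain : Type := seq int.

Definition enc_domain : domain -> seq symbol := enc_seq enc_int.

(* A domain included in {1,...,n} is represented as a list of elements of
   ['I_n], in which [j] stands for [j.+1]. *)
Definition enc_pdomain (n : nat) (D : seq 'I_n) : seq symbol :=
  enc_domain [seq (j.+1)%:Z | j : 'I_n <- D].

(* The language of the words that encode a yes-instance. *)
Definition problem (I : Type) (enc : I -> seq symbol) (yes : I -> Prop) :
    language symbol :=
  fun w => exists2 x : I, w = enc x & yes x.

(* [sort2] stands for sort(U,V) and [sort3] for sort(U,V,P). *)
Definition sort2_holds (n : nat) (u v : n.-tuple int) : Prop :=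
  v = sort <=%R u :> seq int.

Record sort2_inst := Sort2Inst {
  s2_n : nat;
  s2_U : s2_n.-tuple domain;
  s2_V : s2_n.-tuple domain
}.

Definition sort2_enc (I : sort2_inst) : seq symbol :=
  enc_seq enc_domain (s2_U I) ++ enc_seq enc_domain (s2_V I).

Definition sort2_has_support (I : sort2_inst) : Prop :=
  exists u v : (s2_n I).-tuple int,
    [/\ forall i, tnth u i \in tnth (s2_U I) i,
        forall i, tnth v i \in tnth (s2_V I) i
      & sort2_holds u v].

Definition disjoint_domains (n : nat) (U : n.-tuple domain) : Prop :=
  forall i j : 'I_n, i != j ->
    forall x : int, ~ (x \in tnth U i /\ x \in tnth U j).

(* [P] sends (the index of) each variable of [U] to its position in [V]. *)
Definition sort3_holds (n : nat) (u v : n.-tuple int) (p : n.-tuple 'I_n) : Prop :=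
  [/\ sort2_holds u v, uniq p & forall i, tnth u i = tnth v (tnth p i)].

Record sort3_inst := Sort3Inst {
  s3_n : nat;
  s3_U : s3_n.-tuple domain;
  s3_V : s3_n.-tuple domain;
  s3_P : s3_n.-tuple (seq 'I_s3_n)
}.

Definition sort3_enc (I : sort3_inst) : seq symbol :=
  enc_seq enc_domain (s3_U I) ++ enc_seq enc_domain (s3_V I) ++
  enc_seq (@enc_pdomain _) (s3_P I).

Definition sort3_has_support (I : sort3_inst) : Prop :=
  exists (u v : (s3_n I).-tuple int) (p : (s3_n I).-tuple 'I_(s3_n I)),
    [/\ forall i, tnth u i \in tnth (s3_U I) i,
        forall i, tnth v i \in tnth (s3_V I) i,
        forall i, tnth p i \in tnth (s3_P I) i
      & sort3_holds u v p].

Definition key (h : nat) (keys : nat) (x : h.-tuple int) : seqlexi int :=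
  take keys x.

Definition keysorting_holds (n h keys : nat) (u v : n.-tuple (h.-tuple int))
    (p : n.-tuple 'I_n) : Prop :=
  [/\ sorted (relpre (key keys) <=%O) v,
      uniq p,
      forall i, tnth u i = tnth v (tnth p i)
    & forall i j : 'I_n, (i < j)%N ->
        key keys (tnth u i) = key keys (tnth u j) ->
        (tnth p i < tnth p j)%N].

(* Each component of an [h]-tuple is an integer variable with its own domain;
   the domain of the tuple is the product of these. *)
Definition in_tuple_domain (h : nat) (x : h.-tuple int) (D : h.-tuple domain) :
    Prop :=
  forall k, tnth x k \in tnth D k.

Record keysorting_inst := KeysortingInst {
  ks_n : nat;
  ks_h : nat;
  ks_keys : nat;
  ks_keysP : (0 < ks_keys <= ks_h)%N;
  ks_U : ks_n.-tuple (ks_h.-tuple domain);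
  ks_V : ks_n.-tuple (ks_h.-tuple domain);
  ks_P : ks_n.-tuple (seq 'I_ks_n)
}.

Definition enc_tuple_domain (h : nat) (D : h.-tuple domain) : seq symbol :=
  enc_seq enc_domain D.

Definition keysorting_enc (I : keysorting_inst) : seq symbol :=
  enc_int (ks_h I)%:Z ++ enc_int (ks_keys I)%:Z ++
  enc_seq (@enc_tuple_domain _) (ks_U I) ++
  enc_seq (@enc_tuple_domain _) (ks_V I) ++
  enc_seq (@enc_pdomain _) (ks_P I).

Definition keysorting_has_support (I : keysorting_inst) : Prop :=
  exists (u v : (ks_n I).-tuple ((ks_h I).-tuple int))
         (p : (ks_n I).-tuple 'I_(ks_n I)),
    [/\ forall i, in_tuple_domain (tnth u i) (tnth (ks_U I) i),
        forall i, in_tuple_domain (tnth v i) (tnth (ks_V I) i),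
        forall i, tnth p i \in tnth (ks_P I) i
      & keysorting_holds (ks_keys I) u v p].

Definition disjoint_tuple_domains (n h : nat) (U : n.-tuple (h.-tuple domain)) :
    Prop :=
  forall i j : 'I_n, i != j ->
    forall x : h.-tuple int,
      ~ (in_tuple_domain x (tnth U i) /\ in_tuple_domain x (tnth U j)).

(* Main.v *)
(* Every problem in NP is reduced to sorting by way of a constraint satisfaction
   problem given by nogoods. The tapes of a machine are aligned at their heads, so
   that column j of a configuration at time t+1 is a function of the columns 0,
   j-1, j and j+1 at time t, and a run is an assignment that violates none of a
   polynomial number of nogoods of at most five atoms. A nogood chooses one of its
   atoms to be false, an assignment chooses one value per variable, and both
   choices are values of variables of U with disjoint domains. The domains of V
   constrain the rank of each value, and rank constraints can forbid that an atom
   is both claimed to hold and claimed to fail.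

   A support together with the permutation is a certificate of polynomial size.

   Machines are obtained from polynomial time functions on data types that are
   encoded as trees, and trees are stored on the stacks of structured programs. *)

Require Import Defs.
From mathcomp Require Import all_boot all_order all_algebra.
From mathcomp Require Import perm zify.

Set Implicit Arguments.
Unset Strict Implicit.
Unset Printing Implicit Defensive.

Import Order.TTheory GRing.Theory Num.Theory.

(** * Stack programs and their compilation to machines *)

(** One reduction serves the three constraints. The domains of [U] that it produces are disjoint, so
    no two values are equal: the permutation is determined, stability is void, and the general and
    the disjoint version become hard at once. Ranks can act as constraints only if they do not
    depend on the solution; this is the purpose of the fillers, which top up every zone to the same
    number of values and so fix its ranks in advance.

    For membership in NP no parser is written: a certificate also contains the decoded instance, and
    the verifier encodes it again and compares the result with the input.

    Numbers that are polynomial in the input are kept in unary, where arithmetic becomes list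
    processing. The integers of an instance can be exponential in its length and are kept in
    binary. *)

Section StackPrograms.
Variable L : finType.

(** Stack 0 holds the data, stacks 1 and 3 hold reversed words while these are moved, and stack 2
    counts the subtrees still to be read. *)
Inductive cmd :=
| Skip
| Push of 'I_4 & L
| Pop of 'I_4
| Seq of cmd & cmd
| Case of 'I_4 & (option L -> cmd)
| While of 'I_4 & pred (option L) & cmd.

Definition store := seq (seq L).
Definition stack (s : store) (i : 'I_4) : seq L := nth [::] s i.
Definition upd (s : store) (i : 'I_4) (u : seq L) : store := set_nth [::] s i u.
Definition top (s : store) (i : 'I_4) : option L := ohead (stack s i).

(** The costs bound the steps of the compiled machine: [Push] takes two, since the head first moves
    left and then writes, a test takes one, and [Skip] has no state at all. *)
Inductive exec : cmd -> store -> nat -> store -> Prop :=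
| exec_skip s : exec Skip s 0 s
| exec_push i a s : exec (Push i a) s 2 (upd s i (a :: stack s i))
| exec_pop i s : exec (Pop i) s 1 (upd s i (behead (stack s i)))
| exec_seq a b s n s' m s'' :
    exec a s n s' -> exec b s' m s'' -> exec (Seq a b) s (n + m) s''
| exec_case i f s n s' : exec (f (top s i)) s n s' -> exec (Case i f) s n.+1 s'
| exec_loop i (p : pred (option L)) c s n s' m s'' : p (top s i) -> exec c s n s' ->
    exec (While i p c) s' m s'' -> exec (While i p c) s (n + m).+1 s''
| exec_stop i (p : pred (option L)) c s : ~~ p (top s i) -> exec (While i p c) s 1 s.

Fixpoint st (c : cmd) : finType :=
  match c with
  | Skip => void
  | Push _ _ => bool
  | Pop _ => unit
  | Seq a b => (st a + st b)%type
  | Case _ f => option {o : option L & st (f o)}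
  | While _ _ a => option (st a)
  end.

(* [phi] embeds the states of a component; leaving it leads to [E]. *)
Definition lift S S' (phi : S -> S') (E : option S') : option S -> option S' :=
  oapp (Some \o phi) E.

(** An entry [None] means that the command is over before its first step, as for [Skip]; the same
    value marks the exit in [dlt]. *)
Fixpoint ent (c : cmd) : option (st c) :=
  match c with
  | Skip => None
  | Push _ _ => Some true
  | Pop _ => Some tt
  | Seq a b => lift inl (omap inr (ent b)) (ent a)
  | Case _ f => Some None
  | While _ _ _ => Some None
  end.

Definition reads := {ffun 'I_4 -> option L}.
Definition acts := 'I_4 -> option L * move.
Definition idle (r : reads) : acts := fun j => (r j, Stay).

Fixpoint dlt (c : cmd) : st c -> reads -> option (st c) * acts :=
  match c return st c -> reads -> option (st c) * acts with
  | Skip => fun q r => (None, idle r)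
  | Push i a => fun q r =>
      if q then (Some false, fun j => (r j, if j == i then MoveL else Stay))
      else (None, fun j => (if j == i then Some a else r j, Stay))
  | Pop i => fun q r => (None, fun j => (r j, if j == i then MoveR else Stay))
  | Seq a b => fun q r =>
      match q with
      | inl q => (lift inl (omap inr (ent b)) (dlt q r).1, (dlt q r).2)
      | inr q => (lift inr None (dlt q r).1, (dlt q r).2)
      end
  | Case i f => fun q r =>
      match q with
      | None => (lift (fun q => Some (Tagged (fun o => st (f o)) q)) None
                      (ent (f (r i))), idle r)
      | Some (existT o q) =>
          (lift (fun q => Some (Tagged (fun o => st (f o)) q)) None (dlt q r).1,
           (dlt q r).2)
      end
  | While i p a => fun q r =>
      match q with
      | None => (if p (r i) then lift Some (Some None) (ent a) else None, idle r)
      | Some q => (lift Some (Some None) (dlt q r).1, (dlt q r).2)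
      end
  end.

Definition tapes := 'I_4 -> tape L.

Definition cstep (c : cmd) (x : option (st c) * tapes) : option (st c) * tapes :=
  if x.1 is Some q then
    let d := dlt q [ffun i => scan (x.2 i)] in (d.1, fun i => act (x.2 i) (d.2 i))
  else x.

Lemma cstep_halt c n (T : tapes) : iter n (@cstep c) (None, T) = (None, T).
Proof. by elim: n => // n IHn; rewrite iterSr. Qed.

(** A component idles once it has halted, but the enclosing command goes on from [E]. To chain runs,
    the moment of the exit is needed, which [n] merely bounds. *)
Lemma cstep_lift a c (phi : st a -> st c) (E : option (st c)) :
  (forall q r, dlt (phi q) r = (lift phi E (dlt q r).1, (dlt q r).2)) ->
  forall n o (T T' : tapes), iter n (@cstep a) (o, T) = (None, T') ->
  exists2 m, m <= n & iter m (@cstep c) (lift phi E o, T) = (E, T').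
Proof.
move=> phiP; elim=> [|n IHn] o T T'; first by case=> -> ->; exists 0.
case: o => [q|]; last by rewrite cstep_halt => -[->]; exists 0.
rewrite iterSr {2}/cstep /= => /IHn[m le_mn Em].
by exists m.+1; rewrite // iterSr /cstep /= phiP.
Qed.

(** The cells to the left of the head are arbitrary: [Push] overwrites the cell that it moves onto,
    so the letters left behind by [Pop] do no harm. The blanks come from visits to the bottom of the
    stack. *)
Definition holds (u : seq L) (t : tape L) := exists k, t.2 = map Some u ++ nseq k None.

Definition rep (s : store) (T : tapes) := forall i, holds (stack s i) (T i).

Lemma holds_scan u t : holds u t -> scan t = ohead u.
Proof. by case=> k; rewrite /scan => ->; case: u => //; case: k. Qed.

Lemma holds_stay u t : holds u t -> holds u (act t (scan t, Stay)).
Proof.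
case=> k; rewrite /holds /scan /= => ->.
by case: u => [|a u]; [case: k => [|k]; [exists 1|exists k.+1] | exists k].
Qed.

Lemma holds_push a u t : holds u t ->
  holds (a :: u) (act (act t (scan t, MoveL)) (Some a, Stay)).
Proof. by move=> /holds_stay[k] /= Ek; exists k; rewrite /= Ek. Qed.

Lemma holds_pop u t : holds u t -> holds (behead u) (act t (scan t, MoveR)).
Proof.
case=> k; rewrite /holds /scan /= => ->.
by case: u => [|a u]; [case: k => [|k]; [exists 0|exists k] | exists k].
Qed.

Lemma stack_upd s i u j : stack (upd s i u) j = if j == i then u else stack s j.
Proof. by rewrite /stack /upd nth_set_nth. Qed.

Lemma rep_idle s T : rep s T -> rep s (fun i => act (T i) (idle [ffun j => scan (T j)] i)).
Proof. by move=> sT i; rewrite /idle ffunE; apply: holds_stay. Qed.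

Lemma rep_top s T i : rep s T -> [ffun j => scan (T j)] i = top s i.
Proof. by move=> sT; rewrite ffunE; apply: holds_scan. Qed.

Lemma exec_compile c s n s' : exec c s n s' -> forall T, rep s T ->
  exists m T', [/\ m <= n, iter m (@cstep c) (ent c, T) = (None, T') & rep s' T'].
Proof.
elim=> {c s n s'}.
- by move=> s T sT; exists 0, T.
- move=> i a s T sT; exists 2; eexists; split=> //.
  move=> j; rewrite /= !ffunE stack_upd; case: eqP => [->|_]; first exact: holds_push.
  exact/holds_stay/holds_stay.
- move=> i s T sT; exists 1; eexists; split=> //.
  move=> j; rewrite /= ffunE stack_upd; case: eqP => [->|_]; first exact: holds_pop.
  exact/holds_stay.
- move=> a b s n s1 m s2 _ IHa _ IHb T /IHa[k [T1 [le_kn Ea sT1]]].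
  have [l [T2 [le_lm Eb sT2]]] := IHb _ sT1.
  have [k' le_k'k Ea'] := cstep_lift (c := Seq a b) (phi := inl) (E := omap inr (ent b)) (fun _ _ => erefl) Ea.
  have [l' le_l'l Eb'] := cstep_lift (c := Seq a b) (phi := inr) (E := None) (fun _ _ => erefl) Eb.
  exists (l' + k'), T2; split=> //; first by lia.
  by rewrite iterD Ea'.
- move=> i f s n s' _ IH T sT; have [k [T' [le_kn E sT']]] := IH _ (rep_idle sT).
  pose phi (q : st (f (top s i))) : st (Case i f) := Some (Tagged (fun o => st (f o)) q).
  have [k' le_k'k E'] := cstep_lift (c := Case i f) (phi := phi) (E := None) (fun _ _ => erefl) E.
  exists k'.+1, T'; split=> //; first by rewrite ltnS (leq_trans le_k'k).
  by rewrite iterSr {2}/cstep /= (rep_top i sT).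
- move=> i p a s n s' m s'' ps _ IHa _ IHb T sT.
  have [k [T1 [le_kn Ea sT1]]] := IHa _ (rep_idle sT).
  have [l [T2 [le_lm Eb sT2]]] := IHb _ sT1.
  have [k' le_k'k Ea'] :=
    cstep_lift (c := While i p a) (phi := Some) (E := Some None) (fun _ _ => erefl) Ea.
  exists (l + k'.+1), T2; split=> //; first by lia.
  by rewrite iterD iterSr {3}/cstep /= (rep_top i sT) ps Ea'.
- move=> i p a s nps T sT; exists 1, (fun j => act (T j) (idle [ffun j => scan (T j)] j)).
  split=> //; last exact: rep_idle.
  by rewrite /= /cstep /= (rep_top i sT) (negPf nps).
Qed.

End StackPrograms.

Section Machines.
Variables (A B : finType).

(** The auxiliary letters are the bits in which trees are written. The exit [None] has no
    transition, so leaving the program means halting. *)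
Definition prog_machine (c : cmd (A + B + bool)%type) : machine A B :=
  @Machine A B 3 bool (option (st c)) (ent c)
    (fun q r => if q is Some q then Some (dlt q r) else None).

Lemma prog_machine_run (c : cmd (A + B + bool)%type) x y n s s' N :
  s = [:: [seq inl (inl a) | a <- x]; [::]; [::]; [::]] -> exec c s n s' ->
  nth [::] s' 0 = [seq inl (inr b) | b <- y] -> n <= N ->
  let r := iter N (@step A B (prog_machine c)) (init (prog_machine c) x) in
  halted r /\ output r = y.
Proof.
move=> -> /exec_compile/(_ (init (prog_machine c) x).2) run Ey le_nN.
case: run => [i|m [T [le_mn E sT]]].
  exists 0; rewrite /= cats0 /stack; case: i => [[|[|[|[|i]]]] lti] //=.
  by rewrite -map_comp.
set r := iter _ _ _.
have Er : r = (None, T).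
  have stepE : @step A B (prog_machine c) =1 @cstep _ c.
    by case=> [[q|] T'] //; rewrite /cstep /step /table /=; case: dlt.
  rewrite /r (eq_iter stepE) -(subnK (leq_trans le_mn le_nN)) iterD.
  by rewrite -[init _ x]/(ent c, (init (prog_machine c) x).2) E cstep_halt.
rewrite Er; split=> //.
rewrite /output /=; have [k ->] := sT ord0; rewrite /stack Ey /=.
by elim: (y) => [|b y' /= -> //]; case: k.
Qed.

End Machines.

(** * Trees on a stack *)

Inductive tree := Leaf | Node of tree & tree.

(* Polish notation: the end of the word of a tree can be found on a stack by
   counting, so that values of any shape can be stored one above the other. *)
Fixpoint word (t : tree) : seq bool :=
  if t is Node l r then true :: word l ++ word r else [:: false].

(** The number of rounds of a loop controlled by the tree: the length of an encoded list, or the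
    value of a unary number. *)
Fixpoint spine (t : tree) : nat := if t is Node _ r then (spine r).+1 else 0.

Section TreePrograms.
Variables (A B : finType).
Notation L := (A + B + bool)%type.
Notation cmd := (cmd L).
Notation store := (store L).

Definition bit (b : bool) : L := inr b.
Notation i0 := (@Ordinal 4 0 isT).
Notation i1 := (@Ordinal 4 1 isT).
Notation i2 := (@Ordinal 4 2 isT).
Notation i3 := (@Ordinal 4 3 isT).

Definition run (c : cmd) (s : store) (n : nat) (s' : store) : Prop :=
  exists2 m, m <= n & exec c s m s'.

Lemma run_skip s : run (Skip _) s 0 s.
Proof. by exists 0 => //; constructor. Qed.

Lemma run_le c s n m s' : run c s n s' -> n <= m -> run c s m s'.
Proof. by case=> k le_kn Ec /(leq_trans le_kn); exists k. Qed.

Lemma run_push i a s : run (Push i a) s 2 (upd s i (a :: stack s i)).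
Proof. by exists 2 => //; constructor. Qed.

Lemma run_pop i s : run (Pop _ i) s 1 (upd s i (behead (stack s i))).
Proof. by exists 1 => //; constructor. Qed.

Lemma run_seq a b s n s' m s'' N :
  run a s n s' -> run b s' m s'' -> n + m <= N -> run (Seq a b) s N s''.
Proof.
move=> [k le_kn Ea] [l le_lm Eb] le_N; exists (k + l); first by lia.
exact: exec_seq Ea Eb.
Qed.

Lemma run_case i f s n s' : run (f (top s i)) s n s' -> run (Case i f) s n.+1 s'.
Proof. by case=> k le_kn Ef; exists k.+1 => //; constructor. Qed.

Lemma run_loop i (p : pred (option L)) c s n s' m s'' N :
  p (top s i) -> run c s n s' -> run (While i p c) s' m s'' -> n + m < N ->
  run (While i p c) s N s''.
Proof.
move=> ps [k le_kn Ea] [l le_lm Eb] le_N; exists (k + l).+1; first by lia.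
exact: exec_loop Ea Eb.
Qed.

Lemma run_stop i (p : pred (option L)) c s : ~~ p (top s i) -> run (While i p c) s 1 s.
Proof. by exists 1 => //; apply: exec_stop. Qed.

(** Every letter pushed is paid for, so that a time bound also bounds the size of the result;
    [ptime_sz] rests on this. *)
Lemma run_size c s n s' i : run c s n s' -> size (stack s' i) <= size (stack s i) + n.
Proof.
case=> m /[swap] Ec le_mn; apply: leq_trans (_ : size (stack s i) + m <= _); last by lia.
elim: Ec i {le_mn} => {c s s' m n} /=.
- by move=> s i; lia.
- by move=> i a s j; rewrite stack_upd; case: eqP => [->|_] /=; lia.
- by move=> i s j; rewrite stack_upd; case: eqP => [->|_]; rewrite ?size_behead; lia.
- by move=> a b s n s' m s'' _ IHa _ IHb i; have:= IHa i; have:= IHb i; lia.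
- by move=> j f s n s' _ IH i; have:= IH i; lia.
- by move=> j p c s n s' m s'' _ _ IHa _ IHb i; have:= IHa i; have:= IHb i; lia.
- by move=> j p c s _ i; lia.
Qed.

Definition sto (a b c d : seq bool) : store :=
  [:: map bit a; map bit b; map bit c; map bit d].
Definition main (a : seq bool) : store := sto a [::] [::] [::].

Definition bit1 (o : option L) : bool := if o is Some (inr b) then b else false.
Definition If i (p : pred (option L)) (a b : cmd) : cmd :=
  Case i (fun o => if p o then a else b).

Definition push_if (d : bool) i b : cmd := if d then Push i (bit b) else Skip _.

(* The tree on top of stack 0 is removed, and its word is pushed in reverse on
   stack 1 if [d1] and on stack 3 if [d3]. Stack 2 counts the subtrees that
   still have to be read. *)
Definition take_loop (d1 d3 : bool) : cmd :=
  While i2 isSome (If i0 bit1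
    (Seq (Pop _ i0) (Seq (push_if d1 i1 true) (Seq (push_if d3 i3 true) (Push i2 (bit true)))))
    (Seq (Pop _ i0) (Seq (push_if d1 i1 false) (Seq (push_if d3 i3 false) (Pop _ i2))))).

Definition take_tree d1 d3 : cmd := Seq (Push i2 (bit true)) (take_loop d1 d3).

Definition flush (d : bool) : cmd :=
  let j := if d then i3 else i1 in
  While j isSome (If j bit1 (Seq (Pop _ j) (Push i0 (bit true)))
                           (Seq (Pop _ j) (Push i0 (bit false)))).

Lemma run_seq0 a b s n s' m s'' :
  run a s n s' -> run b s' m s'' -> run (Seq a b) s (n + m) s''.
Proof. by move=> Ea Eb; apply: run_seq Ea Eb _. Qed.

Ltac xrun := cbn; first
  [ eapply run_skip | eapply run_push | eapply run_pop
  | eapply run_seq0; [xrun | xrun]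
  | eapply run_case; xrun ].
Ltac xstep := eapply run_le; [xrun | by []].

Lemma take_step d1 d3 b r cnt s1 s3 n s' :
  run (take_loop d1 d3) (sto r (if d1 then b :: s1 else s1)
     (if b then [:: true, true & cnt] else cnt) (if d3 then b :: s3 else s3)) n s' ->
  run (take_loop d1 d3) (sto (b :: r) s1 (true :: cnt) s3) (n + 9) s'.
Proof.
(* The body takes at most 8 steps: one test, one [Pop] and up to three [Push] of cost 2. The test of
   the loop is the ninth. *)
move=> H; rewrite /take_loop; eapply (run_loop (n := 8)); [by [] | | exact: H | ].
  by case: b {H}; case: d1; case: d3; xstep.
by lia.
Qed.

(** The rest of the run is a hypothesis, so that the induction can pass from the right subtree to
    the left one without cutting the loop in two. *)
Lemma take_loopP d1 d3 t r cnt s1 s3 n s' :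
  run (take_loop d1 d3) (sto r (if d1 then rev (word t) ++ s1 else s1) cnt
    (if d3 then rev (word t) ++ s3 else s3)) n s' ->
  run (take_loop d1 d3) (sto (word t ++ r) s1 (true :: cnt) s3)
      (n + 9 * size (word t)) s'.
Proof.
elim: t r cnt s1 s3 n => [|tl IHl tr IHr] r cnt s1 s3 n H /=.
  by rewrite muln1; apply: take_step.
rewrite size_cat mulnS mulnDr addnAC addnA -addnA addnC addnA addnAC.
rewrite (_ : _ + _ = n + 9 * size (word tr) + 9 * size (word tl) + 9); last by lia.
apply: take_step; rewrite -catA; apply: IHl; apply: IHr.
move: H; rewrite /= !rev_cons !rev_cat !cat_rcons -!catA.
by case: (d1); case: (d3).
Qed.

Lemma take_treeP d1 d3 t r s1 s3 :
  run (take_tree d1 d3) (sto (word t ++ r) s1 [::] s3) (9 * size (word t) + 3)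
    (sto r (if d1 then rev (word t) ++ s1 else s1) [::]
           (if d3 then rev (word t) ++ s3 else s3)).
Proof.
apply: run_seq; [exact: run_push | | ].
  apply: (@take_loopP d1 d3 t r [::] s1 s3 1); exact: run_stop.
by lia.
Qed.

Lemma flushP d u r v :
  run (flush d) (if d then sto r v [::] u else sto r u [::] v) (5 * size u + 1)
    (if d then sto (rev u ++ r) v [::] [::] else sto (rev u ++ r) [::] [::] v).
Proof.
elim: u r => [|b u IHu] r /=; first by case: d; apply: run_stop.
have {IHu} := IHu (b :: r); rewrite rev_cons cat_rcons.
rewrite /flush; case: d => H; (eapply (run_loop (n := 4)); [by [] | | exact: H | ]);
  try (by case: b {H}; xstep); lia.
Qed.

(** Both words wait in reverse and are set right by [flush]. Stack 1 is flushed first, so its tree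
    ends up below the one from stack 3. *)
Definition swap_trees : cmd :=
  Seq (take_tree true false) (Seq (take_tree false true) (Seq (flush false) (flush true))).
Definition dup_tree : cmd := Seq (take_tree true true) (Seq (flush false) (flush true)).
Definition drop_tree : cmd := take_tree false false.

Lemma swapP t1 t2 r : run swap_trees (main (word t1 ++ word t2 ++ r))
  (20 * (size (word t1) + size (word t2))) (main (word t2 ++ word t1 ++ r)).
Proof.
have szw t : 0 < size (word t) by case: t.
apply: run_le; last first.
  apply: (_ : 9 * size (word t1) + 3 + (9 * size (word t2) + 3 +
    (5 * size (word t1) + 1 + (5 * size (word t2) + 1))) <= _).
  by have:= szw t1; have:= szw t2; lia.
apply: run_seq0; first exact: (take_treeP true false).
apply: run_seq0; first exact: (take_treeP false true).
rewrite !cats0; apply: run_seq0.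
  by have:= flushP false (rev (word t1)) r (rev (word t2)); rewrite revK size_rev; apply.
by have:= flushP true (rev (word t2)) (word t1 ++ r) [::]; rewrite revK size_rev; apply.
Qed.

Lemma dupP t r :
  run dup_tree (main (word t ++ r)) (24 * size (word t)) (main (word t ++ word t ++ r)).
Proof.
have szw : 0 < size (word t) by case: t.
apply: run_le; last first.
  apply: (_ : 9 * size (word t) + 3 + (5 * size (word t) + 1 + (5 * size (word t) + 1)) <= _).
  by lia.
apply: run_seq0; first exact: (take_treeP true true).
rewrite !cats0; apply: run_seq0.
  by have:= flushP false (rev (word t)) r (rev (word t)); rewrite revK size_rev; apply.
by have:= flushP true (rev (word t)) (word t ++ r) [::]; rewrite revK size_rev; apply.
Qed.

Lemma dropP t r : run drop_tree (main (word t ++ r)) (12 * size (word t)) (main r).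
Proof.
apply: run_le (take_treeP false false _ _ _ _) _.
by case: t => *; rewrite /=; lia.
Qed.

Definition pop1 : cmd := Pop _ i0.

Lemma pop1P b r : run pop1 (main (b :: r)) 1 (main r).
Proof. exact: run_pop. Qed.

Fixpoint push_word (u : seq bool) : cmd :=
  if u is b :: u' then Seq (push_word u') (Push i0 (bit b)) else Skip _.

Lemma push_wordP u r : run (push_word u) (main r) (2 * size u) (main (u ++ r)).
Proof.
elim: u => [|b u IHu]; first exact: run_skip.
rewrite (_ : 2 * _ = 2 * size u + 2); last by rewrite /=; lia.
by apply: run_seq0 IHu _; apply: run_push.
Qed.

Lemma run_if b r f g n s' : run (if b then f else g) (main (b :: r)) n s' ->
  run (If i0 bit1 f g) (main (b :: r)) n.+1 s'.
Proof. by move=> H; apply: run_case; case: b H. Qed.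

(** The control tree lies above the accumulator. Each round strips its root and left subtree, swaps
    the remainder below the accumulator, runs [c], and swaps back; the leaf at the end of the spine
    stops the loop. *)
Lemma iter_loopP (t : tree) c (X : nat -> seq bool) r n :
  (forall i r', i < spine t -> run c (main (X i ++ r')) n (main (X i.+1 ++ r'))) ->
  (forall i, i <= spine t -> exists t', X i = word t' /\ size (X i) <= n) ->
  run (While i0 bit1 (Seq pop1 (Seq drop_tree (Seq swap_trees (Seq c swap_trees)))))
    (main (word t ++ X 0 ++ r)) (spine t * (60 * (n + size (word t))) + 1)
    (main (false :: X (spine t) ++ r)).
Proof.
elim: t X => [|tl _ tr IHr] X Xc Xn; first exact: run_stop.
have [t0 [Et0 le_n0]] := Xn 0 isT; have [t1 [Et1 le_n1]] := Xn 1 isT.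
have szw t : 0 < size (word t) by case: t.
rewrite [word _]/= cat_cons -catA; eapply run_loop; first by [].
- apply: run_seq0; first exact: pop1P.
  apply: run_seq0; first exact: dropP.
  rewrite Et0; apply: run_seq0; first exact: swapP.
  rewrite -Et0; apply: run_seq0; first exact: Xc.
  rewrite Et1; exact: swapP.
- rewrite -Et1; apply: (IHr (fun i => X i.+1)) => [i r' lti | i lei]; [exact: Xc | exact: Xn].
rewrite /= -Et0 -Et1 size_cat.
have := szw tr; have := szw tl.
set a := size (word tr); set b := size (word tl); set s := spine tr => *.
have: s * (60 * (n + a)) <= s * (60 * (n + (b + a).+1)) by rewrite leq_mul2l; lia.
lia.
Qed.

End TreePrograms.

(** * Polynomial time functions on encoded data *)

Class enc (T : Type) := tr : T -> tree.

Definition wd T {eT : enc T} (x : T) : seq bool := word (tr x).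
Definition sz T {eT : enc T} (x : T) : nat := size (wd x).

Lemma sz_gt0 T {eT : enc T} (x : T) : 0 < sz x.
Proof. by rewrite /sz /wd; case: (tr x). Qed.

Section Polyb.
Context {X : Type} {eX : enc X}.

(** Since the base exceeds 1, constants, sums and compositions are all absorbed by raising the
    single exponent. *)
Definition polyb (g : X -> nat) := exists k, forall x, g x <= (sz x + 2) ^ k.

Lemma polyb_le g h : (forall x, g x <= h x) -> polyb h -> polyb g.
Proof. by move=> le_gh [k hk]; exists k => x; apply: leq_trans (hk x). Qed.

Lemma polyb_add g h : polyb g -> polyb h -> polyb (fun x => g x + h x).
Proof.
move=> [k gk] [l hl]; exists (maxn k l).+1 => x.
rewrite expnS mulnDl mul2n -addnn; apply: leq_trans (leq_addl _ _).
by apply: leq_add; [apply: leq_trans (gk x) _ | apply: leq_trans (hl x) _];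
  rewrite leq_pexp2l ?leq_maxl ?leq_maxr // addn2.
Qed.

Lemma polyb_mul g h : polyb g -> polyb h -> polyb (fun x => g x * h x).
Proof. by move=> [k gk] [l hl]; exists (k + l) => x; rewrite expnD leq_mul. Qed.

Lemma polyb_const n : polyb (fun=> n).
Proof.
exists n => x; apply: leq_trans (_ : 2 ^ n <= _); first exact/ltnW/ltn_expl.
by case: n => // n; rewrite leq_exp2r // leq_addl.
Qed.

Lemma polyb_sz : polyb (fun x => sz x).
Proof. by exists 1 => x; rewrite expn1 leq_addr. Qed.

Lemma polyb_comp Y (eY : enc Y) (f : X -> Y) (g : Y -> nat) (k : nat) :
  polyb (fun x => sz (f x)) -> (forall y, g y <= (sz y + 2) ^ k) -> polyb (fun x => g (f x)).
Proof.
(* Taking [l.+1] in place of [l] makes room for the [+ 2] in the bound of [g]. *)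
move=> [l fl] gk; exists (l.+1 * k) => x; apply: leq_trans (gk _) _.
rewrite expnM; case: k {gk} => // k; rewrite leq_exp2r // expnS.
have: 0 < (sz x + 2) ^ l by rewrite expn_gt0 addn2.
have: (sz x + 2) ^ l <= sz x * (sz x + 2) ^ l by rewrite leq_pmull ?sz_gt0.
by have := fl x; rewrite mulnDl; lia.
Qed.

End Polyb.

Section Closure.
Context {X Y Z : Type} {eX : enc X} {eY : enc Y} {eZ : enc Z}.

(* The rest [r] of the stack below the argument is kept, so that programs can be
   nested without a supply of fresh stacks. *)
Definition ptime (f : X -> Y) := forall A B : finType, exists c g, polyb g /\
  forall x r, @run A B c (main _ _ (wd x ++ r)) (g x) (main _ _ (wd (f x) ++ r)).

End Closure.

Lemma ptime_sz X Y (eX : enc X) (eY : enc Y) (f : X -> Y) :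
  ptime f -> polyb (fun x => sz (f x)).
Proof.
move=> /(_ bool bool)[c [g [gP cP]]].
apply: polyb_le (_ : polyb (fun x => sz x + g x)); last exact/polyb_add/gP/polyb_sz.
move=> x; have := run_size ord0 (cP x [::]).
by rewrite /stack /= !cats0 !size_map.
Qed.

Lemma polyb_ptime X Y (eX : enc X) (eY : enc Y) (f : X -> Y) (g : Y -> nat) :
  ptime f -> polyb g -> polyb (fun x => g (f x)).
Proof. by move=> /ptime_sz fP [k gk]; apply: polyb_comp fP gk. Qed.

Ltac polyb := repeat first
  [ assumption | apply: polyb_add | apply: polyb_mul | apply: polyb_const
  | apply: polyb_sz | apply: ptime_sz; assumption | apply: polyb_ptime; assumption ].

#[global] Instance enc_pair (T U : Type) (eT : enc T) (eU : enc U) : enc (T * U) :=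
  fun p => Node (tr p.1) (tr p.2).

Lemma ptime_eq X Y {eX : enc X} {eY : enc Y} (f g : X -> Y) : f =1 g -> ptime f -> ptime g.
Proof.
move=> fg fP A B; have [c [h [hP cP]]] := fP A B.
by exists c, h; split=> // x r; rewrite -fg.
Qed.

(** Values with equal trees are converted for free, such as a pair into a list with head and tail,
    or a list of units into its length. *)
Lemma ptime_same X Y {eX : enc X} {eY : enc Y} (f : X -> Y) :
  (forall x, tr (f x) = tr x) -> ptime f.
Proof.
move=> fP A B; exists (Skip _), (fun=> 0); split; first exact: polyb_const.
by move=> x r; rewrite /wd fP; apply: run_skip.
Qed.

Lemma ptime_id X {eX : enc X} : ptime (fun x : X => x).
Proof. exact: ptime_same. Qed.

Lemma ptime_comp X Y Z {eX : enc X} {eY : enc Y} {eZ : enc Z} (g : Y -> Z) (f : X -> Y) :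
  ptime g -> ptime f -> ptime (fun x => g (f x)).
Proof.
move=> gP fP A B; have [cg [hg [hgP cgP]]] := gP A B; have [cf [hf [hfP cfP]]] := fP A B.
exists (Seq cf cg), (fun x => hf x + hg (f x)); split; first by polyb.
by move=> x r; apply: run_seq0.
Qed.

(** The result of [g] waits below while [f] runs on the second copy of the argument; the letter
    pushed last is the node of the pair. *)
Lemma ptime_pair X Y Z {eX : enc X} {eY : enc Y} {eZ : enc Z} (f : X -> Y) (g : X -> Z) :
  ptime f -> ptime g -> ptime (fun x => (f x, g x)).
Proof.
move=> fP gP A B; have [cf [hf [hfP cfP]]] := fP A B; have [cg [hg [hgP cgP]]] := gP A B.
exists (Seq (dup_tree _ _) (Seq cg (Seq (swap_trees _ _) (Seq cf (push_word _ _ [:: true]))))).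
exists (fun x => 24 * sz x + (hg x + (20 * (sz (g x) + sz x) + (hf x + 2)))).
split; first by polyb.
move=> x r; apply: run_seq0; first exact: dupP.
apply: run_seq0; first exact: cgP.
apply: run_seq0; first exact: swapP.
apply: run_seq0; first exact: cfP.
rewrite (_ : wd (f x, g x) = true :: wd (f x) ++ wd (g x)) // cat_cons -catA.
exact: (push_wordP _ _ [:: true]).
Qed.

Lemma ptime_fst X Y Z {eX : enc X} {eY : enc Y} {eZ : enc Z} (f : X -> Y * Z) :
  ptime f -> ptime (fun x => (f x).1).
Proof.
apply: ptime_comp => A B.
exists (Seq (pop1 _ _) (Seq (swap_trees _ _) (drop_tree _ _))), (fun p => 1 + (20 * sz p + 12 * sz p)).
split; first by polyb.
case=> y z r; rewrite /wd /= -catA; apply: run_le.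
  apply: run_seq0; first exact: pop1P.
  by apply: run_seq0; [exact: swapP | exact: dropP].
by rewrite /sz /wd /= size_cat; lia.
Qed.

Lemma ptime_snd X Y Z {eX : enc X} {eY : enc Y} {eZ : enc Z} (f : X -> Y * Z) :
  ptime f -> ptime (fun x => (f x).2).
Proof.
apply: ptime_comp => A B.
exists (Seq (pop1 _ _) (drop_tree _ _)), (fun p => 1 + 12 * sz p).
split; first by polyb.
case=> y z r; rewrite /wd /= -catA; apply: run_le; first by apply: run_seq0; [exact: pop1P | exact: dropP].
by rewrite /sz /wd /= size_cat; lia.
Qed.

Lemma ptime_const X Y {eX : enc X} {eY : enc Y} (y : Y) : ptime (fun _ : X => y).
Proof.
move=> A B; exists (Seq (drop_tree _ _) (push_word _ _ (wd y))), (fun x => 12 * sz x + 2 * sz y).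
split; first by polyb.
by move=> x r; apply: run_seq0; [exact: dropP | exact: push_wordP].
Qed.

#[global] Instance enc_bool : enc bool := fun b => if b then Node Leaf Leaf else Leaf.

Lemma ptime_if X Y {eX : enc X} {eY : enc Y} (b : X -> bool) (f g : X -> Y) :
  ptime b -> ptime f -> ptime g -> ptime (fun x => if b x then f x else g x).
Proof.
move=> bP fP gP A B; have [cb [hb [hbP cbP]]] := bP A B.
have [cf [hf [hfP cfP]]] := fP A B; have [cg [hg [hgP cgP]]] := gP A B.
exists (Seq (dup_tree _ _) (Seq cb (If (Ordinal (isT : 0 < 4)) (@bit1 _ _)
  (Seq (drop_tree _ _) cf) (Seq (drop_tree _ _) cg)))).
(* 36 pays for dropping the truth value, whose word has at most three letters. *)
exists (fun x => 24 * sz x + (hb x + (36 + (hf x + hg x)).+1)).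
split; first by apply: polyb_le (_ : polyb (fun x => 24 * sz x + (hb x + (37 + (hf x + hg x))))) => //; polyb.
move=> x r; apply: run_seq0; first exact: dupP.
apply: run_seq0; first exact: cbP.
rewrite {1}/wd {1}/tr /enc_bool; case: (b x).
  apply: run_le.
    apply: (run_if (b := true)); apply: run_seq0; last exact: cfP.
    exact: (dropP _ _ (Node Leaf Leaf)).
  by rewrite /=; lia.
apply: run_le.
  by apply: (run_if (b := false)); apply: run_seq0; [exact: (dropP _ _ Leaf) | exact: cgP].
by rewrite /=; lia.
Qed.

Fixpoint tree_of_seq (T : Type) {eT : enc T} (s : seq T) : tree :=
  if s is x :: s' then Node (tr x) (tree_of_seq s') else Leaf.

#[global] Instance code_seq (T : Type) {eT : enc T} : enc (seq T) := @tree_of_seq T eT.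

(** The argument of [g] lists its parts in the order in which their words lie on the stack after the
    node of [y :: s'] is popped and the two subtrees are swapped; two letters [true] then turn them
    into a triple. *)
Lemma ptime_case X Y Z {eX : enc X} {eY : enc Y} {eZ : enc Z}
  (s : X -> seq Y) (f : X -> Z) (g : seq Y * Y * X -> Z) :
  ptime s -> ptime f -> ptime g ->
  ptime (fun x => if s x is y :: s' then g (s', y, x) else f x).
Proof.
move=> sP fP gP A B; have [cs [hs [hsP csP]]] := sP A B.
have [cf [hf [hfP cfP]]] := fP A B; have [cg [hg [[k hgk] cgP]]] := gP A B.
exists (Seq (dup_tree _ _) (Seq cs (If (Ordinal (isT : 0 < 4)) (@bit1 _ _)
  (Seq (pop1 _ _) (Seq (swap_trees _ _) (Seq (push_word _ _ [:: true; true]) cg)))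
  (Seq (pop1 _ _) cf)))).
exists (fun x => 24 * sz x + (hs x + (26 * sz (s x) + (sz (s x, x) + 2) ^ k + hf x))).
have sxP := ptime_pair sP (ptime_id (eX := eX)).
have sxkP : polyb (fun x => (sz (s x, x) + 2) ^ k) by apply: (polyb_ptime (g := fun p => (sz p + 2) ^ k) sxP); exists k.
split; first by polyb.
move=> x r; apply: run_seq0; first exact: dupP.
apply: run_seq0; first exact: csP.
rewrite /sz /wd; case Es: (s x) => [|y s'].
  rewrite -[word (tr [::])]/[:: false] cat_cons cat0s.
  apply: run_le.
    by apply: (run_if (b := false)); apply: run_seq0; [exact: pop1P | exact: cfP].
  by rewrite /sz /wd /=; lia.
rewrite -[word (tr (y :: s'))]/(true :: word (tr y) ++ word (tr s')) cat_cons -catA.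
apply: run_le.
  apply: (run_if (b := true)); apply: run_seq0; first exact: pop1P.
  apply: run_seq0; first exact: swapP.
  apply: run_seq0; first exact: push_wordP.
  by have := cgP (s', y, x) r; rewrite /wd /= -!catA; apply.
have le_k : hg (s', y, x) <= (size (word (tr (s', y, x))) + 2) ^ k by apply: hgk.
move: le_k; rewrite -[tr (s', y, x)]/(Node (Node (tr s') (tr y)) (tr x)).
rewrite -[tr (y :: s', x)]/(Node (Node (tr y) (tr s')) (tr x)) /=.
by rewrite !size_cat [size (word (tr s')) + size (word (tr y))]addnC; set E := (_ ^ k); lia.
Qed.

(** A polynomial bound on all intermediate results is required because iterating a polynomial time
    function can produce exponential growth. *)
Lemma ptime_iter_spine X Y Z {eX : enc X} {eY : enc Y} {eZ : enc Z} (n : X -> Y) (c : X -> nat) (a : X -> Z) (f : Z -> Z) :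
  (forall x, spine (tr (n x)) = c x) -> ptime n -> ptime a -> ptime f ->
  (exists2 g, polyb g & forall x i, i <= c x -> sz (iter i f (a x)) <= g x) ->
  ptime (fun x => iter (c x) f (a x)).
Proof.
move=> nc nP aP fP [g gP gB] A B; have naP := ptime_pair nP aP.
have [cn [hn [hnP cnP]]] := naP A B; have [cf [hf [[k hfk] cfP]]] := fP A B.
(* [G] bounds both the size of the accumulator and the time of one application of [f]. *)
pose G x := g x + (g x + 2) ^ k.
have GP : polyb G.
  apply: polyb_add => //; have [l gl] := gP; exists (l.+1 * k) => x.
  apply: leq_trans (_ : ((sz x + 2) ^ l + 2) ^ k <= _).
    by case: k {hfk cfP G} => // k; rewrite leq_exp2r // leq_add2r.
  rewrite expnM; case: k {hfk cfP G} => // k; rewrite leq_exp2r // expnS.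
  have: (sz x + 2) ^ l <= sz x * (sz x + 2) ^ l by rewrite leq_pmull ?sz_gt0.
  have: 0 < (sz x + 2) ^ l by rewrite expn_gt0 addn2.
  by rewrite mulnDl; lia.
exists (Seq cn (Seq (pop1 _ _) (Seq (While (Ordinal (isT : 0 < 4)) (@bit1 _ _)
  (Seq (pop1 _ _) (Seq (drop_tree _ _) (Seq (swap_trees _ _) (Seq cf (swap_trees _ _)))))) (pop1 _ _)))).
exists (fun x => hn x + (1 + (sz (n x) * (60 * (G x + sz (n x))) + 1 + 1))); split; first by polyb.
move=> x r; apply: run_seq0; first exact: cnP.
rewrite {1}/wd [tr _]/= [word _]/= cat_cons -catA; apply: run_seq0; first exact: pop1P.
apply: run_seq0; last exact: (pop1P _ _ false).
rewrite -nc; apply: run_le.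
  apply: (@iter_loopP _ _ _ _ (fun i => wd (iter i f (a x))) _ (G x)).
    move=> i r'; rewrite nc => lti; apply: run_le (cfP _ _) _ => /=.
    apply: leq_trans (hfk _) _; rewrite /G; apply: leq_trans (leq_addl _ _).
    by case: (k) => // k'; rewrite leq_exp2r // leq_add2r gB // ltnW.
  by move=> i; rewrite nc => lei; eexists; split; first by []; rewrite (leq_trans (gB _ _ lei)) ?leq_addr.
rewrite leq_add2r leq_mul2r; apply/orP; right.
rewrite /sz /wd; elim: (tr (n x)) => //= tl _ t IHt.
by rewrite size_cat; lia.
Qed.

#[global] Instance code_unit : enc unit := fun=> Leaf.

Fixpoint tree_of_nat (n : nat) : tree := if n is n'.+1 then Node Leaf (tree_of_nat n') else Leaf.
#[global] Instance code_nat : enc nat := tree_of_nat.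
(** The low priority lets the structural encodings of booleans and pairs come first. *)
#[global] Instance code_fin (T : finType) : enc T | 100 := fun x => tr (enum_rank x : nat).

Lemma sz_pair X Y {eX : enc X} {eY : enc Y} (x : X) (y : Y) : sz (x, y) = (sz x + sz y).+1.
Proof. by rewrite /sz /wd /= size_cat. Qed.

Lemma sz_cons X {eX : enc X} (x : X) s : sz (x :: s) = (sz x + sz s).+1.
Proof. by rewrite /sz /wd /= size_cat. Qed.

Lemma sz_nil X {eX : enc X} : sz ([::] : seq X) = 1.
Proof. by []. Qed.

Lemma sz_nat (n : nat) : sz n = n.*2.+1.
Proof. by elim: n => // n; rewrite /sz /wd /= => ->. Qed.

Lemma sz_bool (b : bool) : sz b <= 3.
Proof. by case: b. Qed.

Lemma sz_mem (X : eqType) {eX : enc X} (x : X) s : x \in s -> sz x < sz s.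
Proof.
elim: s => // y s IHs; rewrite in_cons sz_cons => /predU1P[-> | /IHs lt_xs].
  by rewrite ltnS leq_addr.
by apply: leq_trans lt_xs _; rewrite ltnW // ltnS leq_addl.
Qed.

Lemma sz_drop X {eX : enc X} i (s : seq X) : sz (drop i s) <= sz s.
Proof. by elim: s i => // x s IHs [|i] //=; rewrite !sz_cons; have := IHs i; lia. Qed.

Lemma sz_size X {eX : enc X} (s : seq X) : size s < sz s.
Proof. by elim: s => // x s IHs; rewrite sz_cons /=; lia. Qed.

Lemma spine_seq X {eX : enc X} (s : seq X) : spine (tr s) = size s.
Proof. by elim: s => //= x s; rewrite /tr /= => ->. Qed.

(* Decomposes a goal [ptime (fun x => e)] along the syntax of [e]. [ptime_ext]
   and [ptime_more] are redefined as more operations become available. *)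
Ltac ptime_ext := fail.
Ltac ptime_more := fail.
Ltac ptime_step :=
  cbv beta;
  tryif simple apply ptime_const then idtac else
  lazymatch goal with
  | |- ptime (fun x => x) => apply ptime_id
  | |- ptime fst => apply (ptime_fst (f := fun x => x))
  | |- ptime snd => apply (ptime_snd (f := fun x => x))
  | |- ptime (fun x => fst (@?f x)) => apply (ptime_fst (f := f))
  | |- ptime (fun x => snd (@?f x)) => apply (ptime_snd (f := f))
  | |- ptime (fun x => pair (@?f x) (@?g x)) => apply (ptime_pair (f := f) (g := g))
  | |- ptime (fun x => if _ then _ else _) => eapply ptime_if
  | |- ptime _ => first [assumption | ptime_ext | ptime_more]
  end.
Ltac ptime := repeat ptime_step.

Section Lists.
Context {X Y Z : Type} {eX : enc X} {eY : enc Y} {eZ : enc Z}.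

Lemma ptime_cons (f : X -> Y) (g : X -> seq Y) :
  ptime f -> ptime g -> ptime (fun x => f x :: g x).
Proof.
move=> fP gP; apply: (ptime_comp (g := fun p => p.1 :: p.2) _ (ptime_pair fP gP)).
by apply: ptime_same.
Qed.

Lemma ptime_behead (f : X -> seq Y) : ptime f -> ptime (fun x => behead (f x)).
Proof.
move=> fP; pose g (p : seq Y * Y * X) := p.1.1.
have gP : ptime g by rewrite /g; ptime.
apply: ptime_eq (ptime_case fP (ptime_const [::]) gP).
by move=> x; case: (f x).
Qed.

Lemma ptime_head y0 (f : X -> seq Y) : ptime f -> ptime (fun x => head y0 (f x)).
Proof.
move=> fP; pose g (p : seq Y * Y * X) := p.1.2.
have gP : ptime g by rewrite /g; ptime.
apply: ptime_eq (ptime_case fP (ptime_const y0) gP).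
by move=> x; case: (f x).
Qed.

Lemma ptime_nilp (f : X -> seq Y) : ptime f -> ptime (fun x => nilp (f x)).
Proof.
move=> fP; pose g (p : seq Y * Y * X) := false.
have gP : ptime g by rewrite /g; ptime.
apply: ptime_eq (ptime_case fP (ptime_const true) gP).
by move=> x; case: (f x).
Qed.

Lemma ptime_iter_list (l : X -> seq Y) (a : X -> Z) (f : Z -> Z) :
  ptime l -> ptime a -> ptime f ->
  (exists2 g, polyb g & forall x i, i <= size (l x) -> sz (iter i f (a x)) <= g x) ->
  ptime (fun x => iter (size (l x)) f (a x)).
Proof. by apply: ptime_iter_spine => x; rewrite spine_seq. Qed.

End Lists.

Section FoldBound.
Context {X Y Z : Type} {eX : enc X} {eY : enc Y} {eZ : enc Z}.

Lemma ptime_foldl_bound (g : X * Y * Z -> Z) (z : X -> Z) (l : X -> seq Y) :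
  ptime g -> ptime z -> ptime l ->
  (exists2 h, polyb h &
     forall x i, sz (foldl (fun c y => g (x, y, c)) (z x) (take i (l x))) <= h x) ->
  ptime (fun x => foldl (fun c y => g (x, y, c)) (z x) (l x)).
Proof.
move=> gP zP lP [h hP gh].
(* The body of a loop has one argument only, so the input and the unread part of the list travel
   with the accumulator. *)
pose f (p : X * seq Y * Z) := if p.1.2 is y :: s then (p.1.1, s, g (p.1.1, y, p.2)) else p.
have fP : ptime f.
  pose f' (q : seq Y * Y * (X * seq Y * Z)) := (q.2.1.1, q.1.1, g (q.2.1.1, q.1.2, q.2.2)).
  apply: (ptime_case (s := fun p => p.1.2) (f := id) (g := f')); ptime.
  rewrite /f'; ptime; apply: (ptime_comp gP); ptime.
have fE x i : i <= size (l x) -> iter i f (x, l x, z x) =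
    (x, drop i (l x), foldl (fun c y => g (x, y, c)) (z x) (take i (l x))).
  elim: i => [|i IHi] lti; first by rewrite take0 drop0.
  rewrite /= IHi ?(ltnW lti) //; case E: (drop i (l x)) => [|y s].
    by move: lti; rewrite -subn_gt0 -size_drop E.
  have -> : take i.+1 (l x) = take i (l x) ++ [:: y] by rewrite -addn1 takeD E /= take0.
  by rewrite -[drop i.+1 _](drop_drop _ 1 i) E /f /= drop0 foldl_cat.
apply: (ptime_eq (f := fun x => (iter (size (l x)) f (x, l x, z x)).2)).
  by move=> x; rewrite fE // take_size.
apply: (ptime_snd (f := fun x => iter (size (l x)) f (x, l x, z x))).
apply: (ptime_iter_list (a := fun x => (x, l x, z x))) => //; first by ptime.
exists (fun x => sz x + sz (l x) + h x + 2); first by polyb.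
move=> x i lei; rewrite fE // !sz_pair; have := sz_drop (eX := eY) i (l x); have := gh x i; lia.
Qed.

End FoldBound.

Section Folds.
Context {X Y Z : Type} {eX : enc X} {eY : enc Y} {eZ : enc Z}.

(** An increment of size that does not depend on the accumulator adds up to a polynomial over the
    list, unlike growth by a factor. *)
Lemma ptime_foldl (g : X * Y * Z -> Z) (z : X -> Z) (l : X -> seq Y) :
  ptime g -> ptime z -> ptime l ->
  (exists2 h : X * Y -> nat, polyb h & forall x y c, sz (g (x, y, c)) <= sz c + h (x, y)) ->
  ptime (fun x => foldl (fun c y => g (x, y, c)) (z x) (l x)).
Proof.
move=> gP zP lP [h [k hk] gh]; apply: ptime_foldl_bound => //.
exists (fun x => sz (z x) + sz (l x) * (sz (x, l x) + 2) ^ k).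
  have xlP : ptime (fun x => (x, l x)) by ptime.
  have : polyb (fun x => (sz (x, l x) + 2) ^ k).
    by apply: (polyb_ptime (g := fun p => (sz p + 2) ^ k) xlP); exists k.
  by move=> ?; polyb.
move=> x i; elim: i (l x) (z x) => [|i IHi] [|y s] c; try by rewrite /= leq_addr.
rewrite /=; apply: leq_trans (IHi _ _) _.
have le_s : (sz (x, s) + 2) ^ k <= (sz (x, y :: s) + 2) ^ k.
  by case: (k) => // k'; rewrite leq_exp2r // !sz_pair !sz_cons; lia.
have le_y : sz (g (x, y, c)) <= sz c + (sz (x, y :: s) + 2) ^ k.
  apply: leq_trans (gh _ _ _) _; rewrite leq_add2l; apply: leq_trans (hk _) _.
  by case: (k) => // k'; rewrite leq_exp2r // !sz_pair !sz_cons; lia.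
move: le_y le_s; rewrite sz_cons; move: (_ ^ k) (_ ^ k) => E E' le_y le_E.
rewrite mulSn mulnDl.
have: sz s * E <= sz s * E' by rewrite leq_mul2l le_E orbT.
have : 0 <= sz y * E' by []; lia.
Qed.

End Folds.

(** * Lists and numbers *)

Section Reversal.
Context {X Y Z : Type} {eX : enc X} {eY : enc Y} {eZ : enc Z}.

Lemma foldl_consE (s : seq Y) : foldl (fun c y => y :: c) [::] s = rev s.
Proof.
rewrite -[s in LHS]revK foldl_rev.
by elim: (rev s) => //= y s' ->.
Qed.

Lemma ptime_rev (f : X -> seq Y) : ptime f -> ptime (fun x => rev (f x)).
Proof.
move=> fP; apply: ptime_eq (fun x => foldl_consE (f x)) _.
apply: (ptime_foldl (g := fun p => p.1.2 :: p.2) (z := fun=> [::])); ptime.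
  by apply: ptime_cons; ptime.
exists (fun p => sz p.2 + 1); last by move=> x y c; rewrite sz_cons /=; lia.
apply: polyb_add (polyb_const _); apply: ptime_sz; ptime.
Qed.

End Reversal.

Section Foldr.
Context {X Y Z : Type} {eX : enc X} {eY : enc Y} {eZ : enc Z}.

Lemma ptime_foldr (g : X * Y * Z -> Z) (z : X -> Z) (l : X -> seq Y) :
  ptime g -> ptime z -> ptime l ->
  (exists2 h : X * Y -> nat, polyb h & forall x y c, sz (g (x, y, c)) <= sz c + h (x, y)) ->
  ptime (fun x => foldr (fun y c => g (x, y, c)) (z x) (l x)).
Proof.
move=> gP zP lP hP.
apply: (ptime_eq (f := fun x => foldl (fun c y => g (x, y, c)) (z x) (rev (l x)))).
  by move=> x; rewrite foldl_rev.
by apply: ptime_foldl => //; apply: ptime_rev.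
Qed.

End Foldr.

Lemma ptime_foldr_small X Y Z {eX : enc X} {eY : enc Y} {eZ : enc Z} n
  (g : X * Y * Z -> Z) (z : X -> Z) (l : X -> seq Y) :
  (forall c : Z, sz c <= n) -> ptime g -> ptime z -> ptime l ->
  ptime (fun x => foldr (fun y c => g (x, y, c)) (z x) (l x)).
Proof.
move=> Zn gP zP lP; apply: ptime_foldr => //.
by exists (fun=> n); [exact: polyb_const | move=> *; rewrite (leq_trans (Zn _)) ?leq_addl].
Qed.

Section MapAndBooleans.
Context {X Y Z : Type} {eX : enc X} {eY : enc Y} {eZ : enc Z}.

Lemma sz_cat (s t : seq Y) : (sz (s ++ t)).+1 = sz s + sz t.
Proof. by elim: s => // y s IHs; rewrite /= !sz_cons; lia. Qed.

Lemma ptime_cat (f g : X -> seq Y) : ptime f -> ptime g -> ptime (fun x => f x ++ g x).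
Proof.
move=> fP gP; apply: (ptime_eq (f := fun x => foldr (fun y c => y :: c) (g x) (f x))).
  by move=> x; elim: (f x) => //= y s ->.
apply: (ptime_foldr (g := fun p => p.1.2 :: p.2)) => //.
  by apply: ptime_cons; ptime.
exists (fun p => sz p.2 + 1); last by move=> x y c; rewrite sz_cons /=; lia.
apply: polyb_add (polyb_const _); apply: ptime_sz; ptime.
Qed.

Lemma ptime_map (f : X * Y -> Z) (l : X -> seq Y) :
  ptime f -> ptime l -> ptime (fun x => map (fun y => f (x, y)) (l x)).
Proof.
move=> fP lP; apply: (ptime_foldr (g := fun p => f p.1 :: p.2)); ptime.
  by apply: ptime_cons; ptime; apply: (ptime_comp fP); ptime.
exists (fun p => sz (f p) + 1); last by move=> x y c; rewrite sz_cons /=; lia.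
by apply: polyb_add (polyb_const _); apply: ptime_sz; ptime.
Qed.

Lemma ptime_filter (p : X * Y -> bool) (l : X -> seq Y) :
  ptime p -> ptime l -> ptime (fun x => filter (fun y => p (x, y)) (l x)).
Proof.
move=> pP lP.
apply: (ptime_foldr (g := fun q => if p q.1 then q.1.2 :: q.2 else q.2)); ptime.
- by apply: (ptime_comp pP); ptime.
- by apply: ptime_cons; ptime.
exists (fun p => sz p.2 + 1); last by move=> x y c /=; case: ifP; rewrite ?sz_cons /=; lia.
by apply: polyb_add (polyb_const _); apply: ptime_sz; ptime.
Qed.

Lemma ptime_and (a b : X -> bool) : ptime a -> ptime b -> ptime (fun x => a x && b x).
Proof. by move=> aP bP; apply: ptime_if; ptime. Qed.

Lemma ptime_or (a b : X -> bool) : ptime a -> ptime b -> ptime (fun x => a x || b x).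
Proof. by move=> aP bP; apply: ptime_if; ptime. Qed.

Lemma ptime_neg (a : X -> bool) : ptime a -> ptime (fun x => ~~ a x).
Proof. by move=> aP; apply: ptime_if; ptime. Qed.

Lemma ptime_imply (a b : X -> bool) : ptime a -> ptime b -> ptime (fun x => a x ==> b x).
Proof. by move=> aP bP; apply: ptime_if; ptime. Qed.

Lemma ptime_eqb (a b : X -> bool) : ptime a -> ptime b -> ptime (fun x => a x == b x).
Proof.
move=> aP bP; apply: (ptime_eq (f := fun x => if a x then b x else ~~ b x)).
  by move=> x; case: (a x); case: (b x).
by ptime; apply: ptime_neg.
Qed.

End MapAndBooleans.

Section SizesAndQuantifiers.
Context {X Y Z : Type} {eX : enc X} {eY : enc Y} {eZ : enc Z}.

Lemma ptime_all (p : X * Y -> bool) (l : X -> seq Y) :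
  ptime p -> ptime l -> ptime (fun x => all (fun y => p (x, y)) (l x)).
Proof.
move=> pP lP; apply: (ptime_foldr_small (n := 3) (g := fun q => p q.1 && q.2)); ptime.
  exact: sz_bool.
by apply: ptime_and; ptime; apply: (ptime_comp pP); ptime.
Qed.

Lemma ptime_has (p : X * Y -> bool) (l : X -> seq Y) :
  ptime p -> ptime l -> ptime (fun x => has (fun y => p (x, y)) (l x)).
Proof.
move=> pP lP; apply: (ptime_foldr_small (n := 3) (g := fun q => p q.1 || q.2)); ptime.
  exact: sz_bool.
by apply: ptime_or; ptime; apply: (ptime_comp pP); ptime.
Qed.

Lemma ptime_flatten (f : X -> seq (seq Y)) : ptime f -> ptime (fun x => flatten (f x)).
Proof.
move=> fP; apply: (ptime_foldr (g := fun p => p.1.2 ++ p.2)); ptime.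
  by apply: ptime_cat; ptime.
exists (fun p => sz p.2); first by apply: ptime_sz; ptime.
by move=> x y c /=; have := sz_cat (eY := eY) y c; lia.
Qed.

(** The tree of [n.+1] is that of [(tt, n)], and the tree of [n] is that of [n] units; unary
    arithmetic is carried out on such lists. *)
Lemma ptime_succn (f : X -> nat) : ptime f -> ptime (fun x => (f x).+1).
Proof.
move=> fP; apply: (ptime_comp (g := fun p => p.2.+1) _ (ptime_pair (ptime_const tt) fP)).
exact: ptime_same.
Qed.

Lemma ptime_nseqtt (f : X -> nat) : ptime f -> ptime (fun x => nseq (f x) tt).
Proof.
move=> fP; apply: (ptime_comp _ fP); apply: ptime_same.
by elim=> //= n; rewrite /tr /= => ->.
Qed.

Lemma ptime_sizett (f : X -> seq unit) : ptime f -> ptime (fun x => size (f x)).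
Proof.
move=> fP; apply: (ptime_comp _ fP); apply: ptime_same.
by elim=> //= -[] s; rewrite /tr /= => ->.
Qed.

Lemma ptime_predn (f : X -> nat) : ptime f -> ptime (fun x => (f x).-1).
Proof.
move=> fP; apply: (ptime_eq (f := fun x => size (behead (nseq (f x) tt)))).
  by move=> x; rewrite size_behead size_nseq.
by apply/ptime_sizett/ptime_behead/ptime_nseqtt.
Qed.

Lemma ptime_eq0 (f : X -> nat) : ptime f -> ptime (fun x => f x == 0).
Proof.
move=> fP; apply: (ptime_eq (f := fun x => nilp (nseq (f x) tt))).
  by move=> x; rewrite /nilp size_nseq.
by apply/ptime_nilp/ptime_nseqtt.
Qed.

Lemma ptime_size (f : X -> seq Y) : ptime f -> ptime (fun x => size (f x)).
Proof.
move=> fP; apply: (ptime_eq (f := fun x => size (map (fun=> tt) (f x)))).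
  by move=> x; rewrite size_map.
by apply: ptime_sizett; apply: (ptime_map (f := fun=> tt)); ptime.
Qed.

Lemma ptime_addn (f g : X -> nat) : ptime f -> ptime g -> ptime (fun x => f x + g x).
Proof.
move=> fP gP; apply: (ptime_eq (f := fun x => size (nseq (f x) tt ++ nseq (g x) tt))).
  by move=> x; rewrite size_cat !size_nseq.
by apply: ptime_sizett; apply: ptime_cat; apply: ptime_nseqtt.
Qed.

Lemma ptime_drop (f : X -> nat) (g : X -> seq Y) :
  ptime f -> ptime g -> ptime (fun x => drop (f x) (g x)).
Proof.
move=> fP gP.
apply: (ptime_eq (f := fun x => iter (size (nseq (f x) tt)) behead (g x))).
  move=> x; rewrite size_nseq; move: (f x) (g x); elim=> [|n IHn] s /=; first by rewrite drop0.
  by rewrite IHn -drop1 drop_drop add1n.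
apply: ptime_iter_list => //; first exact: ptime_nseqtt.
  by apply: ptime_behead; ptime.
exists (fun x => sz (g x)); first exact: ptime_sz.
move=> x i _; elim: i => //= i IHi; apply: leq_trans IHi.
by rewrite -drop1 sz_drop.
Qed.

End SizesAndQuantifiers.

Section Arithmetic.
Context {X Y Z : Type} {eX : enc X} {eY : enc Y} {eZ : enc Z}.

Lemma ptime_subn (f g : X -> nat) : ptime f -> ptime g -> ptime (fun x => f x - g x).
Proof.
move=> fP gP; apply: (ptime_eq (f := fun x => size (drop (g x) (nseq (f x) tt)))).
  by move=> x; rewrite size_drop size_nseq.
by apply: ptime_sizett; apply: ptime_drop => //; apply: ptime_nseqtt.
Qed.

Lemma ptime_leq (f g : X -> nat) : ptime f -> ptime g -> ptime (fun x => f x <= g x).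
Proof. by move=> fP gP; apply/ptime_eq0/ptime_subn. Qed.

Lemma ptime_eqn (f g : X -> nat) : ptime f -> ptime g -> ptime (fun x => f x == g x).
Proof.
move=> fP gP; apply: (ptime_eq (f := fun x => (f x <= g x) && (g x <= f x))).
  by move=> x; rewrite eqn_leq.
by apply: ptime_and; apply: ptime_leq.
Qed.

Lemma ptime_muln (f g : X -> nat) : ptime f -> ptime g -> ptime (fun x => f x * g x).
Proof.
move=> fP gP.
apply: (ptime_eq (f := fun x => size (flatten (map (fun=> nseq (g x) tt) (nseq (f x) tt))))).
  move=> x; elim: (f x) => //= n IHn.
  by rewrite size_cat IHn size_nseq mulSn.
apply/ptime_sizett/ptime_flatten; apply: (ptime_map (f := fun p => nseq (g p.1) tt)).
  by apply/ptime_nseqtt/(ptime_comp gP); ptime.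
exact: ptime_nseqtt.
Qed.

Lemma ptime_nseq (f : X -> nat) (g : X -> Y) :
  ptime f -> ptime g -> ptime (fun x => nseq (f x) (g x)).
Proof.
move=> fP gP; apply: (ptime_eq (f := fun x => map (fun=> g x) (nseq (f x) tt))).
  by move=> x; rewrite map_nseq.
apply: (ptime_map (f := fun p => g p.1)); last exact: ptime_nseqtt.
by apply: (ptime_comp gP); ptime.
Qed.

Lemma ptime_nth y0 (f : X -> seq Y) (i : X -> nat) :
  ptime f -> ptime i -> ptime (fun x => nth y0 (f x) (i x)).
Proof.
move=> fP iP; apply: (ptime_eq (f := fun x => head y0 (drop (i x) (f x)))).
  by move=> x; rewrite -nth0 nth_drop addn0.
by apply/ptime_head/ptime_drop.
Qed.

Lemma sz_iota n : sz (iota 0 n) <= n.+1 * n.+1.*2.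
Proof.
elim: n => // n IHn; rewrite (_ : iota 0 n.+1 = iota 0 n ++ [:: n]); last first.
  by rewrite -addn1 iotaD.
rewrite -ltnS sz_cat sz_cons sz_nat; apply: leq_trans (leq_add IHn (leqnn _)) _.
by rewrite (_ : sz [::] = 1) // -!mul2n; nia.
Qed.

Lemma ptime_iota (f : X -> nat) : ptime f -> ptime (fun x => iota 0 (f x)).
Proof.
move=> fP.
(* The length of the list built so far is the next number, which spares a counter. *)
pose g (p : X * unit * seq nat) := p.2 ++ [:: size p.2].
have gE x n : foldl (fun c y => g (x, y, c)) [::] (nseq n tt) = iota 0 n.
  elim: n => // n IHn.
  by rewrite -[n.+1]addn1 nseqD foldl_cat IHn /g /= iotaD size_iota.
apply: (ptime_eq (f := fun x => foldl (fun c y => g (x, y, c)) [::] (nseq (f x) tt))) => //.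
apply: ptime_foldl_bound; [rewrite /g | ptime | exact: ptime_nseqtt | ].
  by apply: ptime_cat; ptime; apply: ptime_cons; ptime; apply: ptime_size; ptime.
exists (fun x => (sz (f x) + 2) * (sz (f x) + 2)).
  by have fP' := ptime_sz fP; polyb.
move=> x i; have [m [-> le_m]] : exists m, take i (nseq (f x) tt) = nseq m tt /\ m <= f x.
  by exists (minn i (f x)); split; [elim: i (f x) => [|i IHi] [|n] //=; rewrite IHi minnSS | exact: geq_minr].
rewrite gE sz_nat; apply: leq_trans (sz_iota m) _.
by apply: leq_mul; lia.
Qed.

End Arithmetic.

(** * From encoded data to machines *)

Notation i0 := (@Ordinal 4 0 isT).
Notation i1 := (@Ordinal 4 1 isT).

Section Transfer.
Variables A B : finType.
Notation L := (A + B + bool)%type.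

Definition move_letters (d : bool) : cmd L :=
  let src := if d then i1 else i0 in let dst := if d then i0 else i1 in
  While src isSome (Case src (fun o =>
    if o is Some l then Seq (Pop _ src) (Push dst l) else Skip _)).

Lemma move_lettersP d u v :
  @run A B (move_letters d) (if d then [:: v; u; [::]; [::]] else [:: u; v; [::]; [::]])
    (5 * size u + 1)
    (if d then [:: rev u ++ v; [::]; [::]; [::]] else [:: [::]; rev u ++ v; [::]; [::]]).
Proof.
elim: u v => [|l u IHu] v /=; first by case: d; apply: run_stop.
have {IHu} := IHu (l :: v); rewrite rev_cons cat_rcons /move_letters.
have lt_n: 4 + (5 * size u + 1) < 5 * (size u).+1 + 1 by lia.
by case: d => H; (eapply (run_loop (n := 4)); [by [] | | exact: H | exact: lt_n]);
  apply: run_case; apply: (run_seq0 (n := 1)); [exact: run_pop | exact: run_push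
    | exact: run_pop | exact: run_push].
Qed.

Lemma push_word_letters u s0 s1 :
  @run A B (push_word A B u) [:: s0; s1; [::]; [::]] (2 * size u)
    [:: map (@bit A B) u ++ s0; s1; [::]; [::]].
Proof.
elim: u => [|b u IHu]; first exact: run_skip.
rewrite (_ : 2 * _ = 2 * size u + 2); last by rewrite /=; lia.
by apply: run_seq0 IHu _; apply: run_push.
Qed.

(** The last input letter comes first, as building a list from its end demands: over the word of the
    tail, the word of the letter and then a node are pushed. *)
Definition read_input : cmd L :=
  While i1 isSome (Case i1 (fun o => if o is Some (inl (inl a)) then
    Seq (Pop _ i1) (Seq (push_word A B (wd a)) (Push i0 (bit A B true))) else Skip _)).

Lemma read_inputP (u s : seq A) :
  @run A B read_input [:: map (@bit A B) (wd s); [seq inl (inl a) | a <- u]; [::]; [::]]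
    (4 * size u + 2 * sz u + 1) (main A B (wd (rev u ++ s))).
Proof.
elim: u s => [|a u IHu] s /=; first by apply: run_le; [exact: run_stop | rewrite addn1].
have {IHu} := IHu (a :: s); rewrite rev_cons cat_rcons.
rewrite (_ : map _ (wd (a :: s)) = bit A B true :: map (@bit A B) (wd a) ++ map (@bit A B) (wd s)).
  move=> H.
  eapply run_loop; [by [] | | exact: H | ].
    apply: run_case; apply: run_seq0; first exact: run_pop.
    by apply: run_seq0; [exact: push_word_letters | exact: run_push].
  by rewrite sz_cons /sz; lia.
by rewrite -map_cat.
Qed.

(** A letter of rank [n] is stored as [n] times [true], [false], followed by [false]. Each such pair
    of bits advances by one in the enumeration [bs]. *)
Fixpoint write_letter (bs : seq B) : cmd L :=
  if bs is b :: bs' then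
    If i0 (@bit1 A B) (Seq (Pop _ i0) (Seq (Pop _ i0) (write_letter bs')))
           (Seq (Pop _ i0) (Push i1 (inl (inr b))))
  else Skip _.

Lemma write_letterP b0 bs n s0 s1 : n < size bs ->
  @run A B (write_letter bs)
    [:: map (@bit A B) (word (tree_of_nat n)) ++ s0; s1; [::]; [::]] (4 * n.+1)
    [:: s0; inl (inr (nth b0 bs n)) :: s1; [::]; [::]].
Proof.
elim: bs n => // b bs IHbs [|n] /= ltn; apply: run_le.
- apply: run_case; apply: run_seq0; [exact: run_pop | exact: run_push].
- by [].
- apply: run_case; apply: run_seq0; first exact: run_pop.
  by apply: run_seq0; [exact: run_pop | exact: IHbs].
by lia.
Qed.

Definition write_output : cmd L :=
  While i0 (@bit1 A B) (Seq (Pop _ i0) (write_letter (enum B))).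

Lemma write_outputP (u : seq B) s1 :
  @run A B write_output [:: map (@bit A B) (wd u); s1; [::]; [::]]
    (4 * sz u + 1) [:: [:: bit A B false]; rev [seq inl (inr b) | b <- u] ++ s1; [::]; [::]].
Proof.
elim: u s1 => [|b u IHu] s1; first by apply: run_le; [exact: run_stop | rewrite addn1].
have {IHu} := IHu (inl (inr b) :: s1); rewrite map_cons rev_cons cat_rcons => H.
rewrite (_ : map _ (wd (b :: u)) = bit A B true ::
  map (@bit A B) (word (tree_of_nat (enum_rank b))) ++ map (@bit A B) (wd u)).
  eapply run_loop; [by [] | | exact: H | ].
    apply: run_seq0; first exact: run_pop.
    have := @write_letterP b (enum B) (enum_rank b) (map (@bit A B) (wd u)) s1.
    by rewrite -cardE ltn_ord nth_enum_rank; apply.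
  rewrite sz_cons {2}/sz /wd /tr /code_fin.
  by rewrite -/(wd (enum_rank b : nat)) -/(sz (enum_rank b : nat)) sz_nat; lia.
by rewrite -map_cat.
Qed.

Definition transfer (c : cmd L) : cmd L :=
  Seq (move_letters false) (Seq (Push i0 (bit A B false)) (Seq read_input
  (Seq c (Seq write_output (Seq (Pop _ i0) (move_letters true)))))).

Lemma transferP (c : cmd L) (x : seq A) (y : seq B) n :
  run c (main A B (wd x)) n (main A B (wd y)) ->
  run (transfer c) [:: [seq inl (inl a) | a <- x]; [::]; [::]; [::]]
    (11 * sz x + n + 9 * sz y + 7) [:: [seq inl (inr b) | b <- y]; [::]; [::]; [::]].
Proof.
move=> H; apply: run_le.
  apply: run_seq0; first exact: (move_lettersP false).
  apply: run_seq0; first exact: run_push.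
  rewrite cats0 -map_rev; apply: run_seq0; first exact: (read_inputP _ [::]).
  rewrite cats0 revK; apply: run_seq0; first exact: H.
  apply: run_seq0; first exact: write_outputP.
  rewrite cats0; apply: run_seq0; first exact: run_pop.
  have := move_lettersP true (rev [seq inl (inr b) | b <- y]) [::].
  by rewrite revK cats0; apply.
rewrite !size_rev !size_map.
have szr : sz (rev x) = sz x.
  elim: x {H} => // a x IHx; rewrite rev_cons -cats1.
  by apply: succn_inj; rewrite sz_cat IHx !sz_cons; rewrite (_ : sz [::] = 1) //; lia.
have := sz_size (eX := @code_fin A) x; have := sz_size (eX := @code_fin B) y; rewrite szr; lia.
Qed.

End Transfer.

Lemma sz_seq_fin (A : finType) (x : seq A) : sz x <= size x * (2 * #|A| + 2) + 1.
Proof.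
elim: x => // a x IHx; rewrite sz_cons [size _]/= mulSn.
have -> : sz a = (enum_rank a).*2.+1 by exact: sz_nat.
have := ltn_ord (enum_rank a); move: IHx; set c := size x * _.
by move: (sz x) #|A| (nat_of_ord _) => m n i; lia.
Qed.

Lemma polyb_horner (A : finType) (g : seq A -> nat) :
  polyb g -> exists p : {poly nat}, forall x, g x <= p.[size x]%R.
Proof.
(* The inner polynomial is the bound of [sz_seq_fin] on [sz x], increased by the 2 from [polyb]. *)
case=> k gk; exists (('X * (2 * #|A| + 2)%N%:P + 3%N%:P) ^+ k)%R => x.
apply: leq_trans (gk x) _; rewrite horner_exp hornerD hornerM hornerX !hornerC.
have := sz_seq_fin x.
rewrite -[GRing.add _ _]/(size x * (2 * #|A| + 2) + 3) -[GRing.exp _ _]/(_ ^ k).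
by case: (k) => // k'; rewrite leq_exp2r //; lia.
Qed.

Theorem ptime_polytime (A B : finType) (f : seq A -> seq B) : ptime f -> polytime f.
Proof.
move=> fP; have fP' := ptime_sz fP; have [c [g [gP cP]]] := fP A B.
have [p tP] : exists p : {poly nat}, forall x, 11 * sz x + g x + 9 * sz (f x) + 7 <= p.[size x]%R.
  by apply: polyb_horner; polyb.
exists (prog_machine (transfer c)), p => x.
have [m le_m Em] : run (transfer c) [:: [seq inl (inl a) | a <- x]; [::]; [::]; [::]]
    (11 * sz x + g x + 9 * sz (f x) + 7) [:: [seq inl (inr b) | b <- f x]; [::]; [::]; [::]].
  by apply: transferP; have := cP x [::]; rewrite !cats0.
exact: (prog_machine_run erefl Em erefl) (leq_trans le_m (tP x)).
Qed.

(** * Equality tests, binary notation and integers *)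

Class peq (T : eqType) {eT : enc T} := peqP : ptime (fun p : T * T => p.1 == p.2).
Arguments peq T {eT}.

Lemma ptime_eqop X (T : eqType) {eX : enc X} {eT : enc T} {pT : peq T} (f g : X -> T) :
  ptime f -> ptime g -> ptime (fun x => f x == g x).
Proof.
by move=> fP gP; apply: (ptime_comp (g := fun p => p.1 == p.2) peqP (ptime_pair fP gP)).
Qed.

Ltac ptime_ext ::=
  lazymatch goal with
  | |- ptime (fun x => cons (@?f x) (@?g x)) => apply (ptime_cons (f := f) (g := g))
  | |- ptime (fun x => cat (@?f x) (@?g x)) => apply (ptime_cat (f := f) (g := g))
  | |- ptime (fun x => map (@?f x) (@?l x)) =>
      apply (ptime_map (f := fun p => f p.1 p.2) (l := l))
  | |- ptime (fun x => filter (@?f x) (@?l x)) =>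
      apply (ptime_filter (p := fun p => f p.1 p.2) (l := l))
  | |- ptime (fun x => all (@?f x) (@?l x)) =>
      apply (ptime_all (p := fun p => f p.1 p.2) (l := l))
  | |- ptime (fun x => has (@?f x) (@?l x)) =>
      apply (ptime_has (p := fun p => f p.1 p.2) (l := l))
  | |- ptime (fun x => flatten (@?f x)) => apply (ptime_flatten (f := f))
  | |- ptime (fun x => rev (@?f x)) => apply (ptime_rev (f := f))
  | |- ptime (fun x => size (@?f x)) => apply (ptime_size (f := f))
  | |- ptime (fun x => nilp (@?f x)) => apply (ptime_nilp (f := f))
  | |- ptime (fun x => behead (@?f x)) => apply (ptime_behead (f := f))
  | |- ptime (fun x => head ?y (@?f x)) => apply (@ptime_head _ _ _ _ y f)
  | |- ptime (fun x => nth ?y (@?f x) (@?i x)) => apply (@ptime_nth _ _ _ _ y f i)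
  | |- ptime (fun x => drop (@?f x) (@?g x)) => apply (ptime_drop (f := f) (g := g))
  | |- ptime (fun x => nseq (@?f x) (@?g x)) => apply (ptime_nseq (f := f) (g := g))
  | |- ptime (fun x => iota 0 (@?f x)) => apply (ptime_iota (f := f))
  | |- ptime (fun x => S (@?f x)) => apply (ptime_succn (f := f))
  | |- ptime (fun x => predn (@?f x)) => apply (ptime_predn (f := f))
  | |- ptime (fun x => addn (@?f x) (@?g x)) => apply (ptime_addn (f := f) (g := g))
  | |- ptime (fun x => subn (@?f x) (@?g x)) => apply (ptime_subn (f := f) (g := g))
  | |- ptime (fun x => muln (@?f x) (@?g x)) => apply (ptime_muln (f := f) (g := g))
  | |- ptime (fun x => leq (@?f x) (@?g x)) => apply (ptime_leq (f := f) (g := g))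
  | |- ptime (fun x => negb (@?f x)) => apply (ptime_neg (a := f))
  | |- ptime (fun x => andb (@?f x) (@?g x)) => apply (ptime_and (a := f) (b := g))
  | |- ptime (fun x => orb (@?f x) (@?g x)) => apply (ptime_or (a := f) (b := g))
  | |- ptime (fun x => implb (@?f x) (@?g x)) => apply (ptime_imply (a := f) (b := g))
  | |- ptime (fun x => eq_op (@?f x) (@?g x)) => apply (ptime_eqop (f := f) (g := g))
  | H : ptime ?g |- ptime (fun x => ?g (@?h x)) => apply (ptime_comp (g := g) (f := h) H)
  end.

#[global] Instance peq_nat : peq nat.
Proof. by apply: ptime_eqn; ptime. Qed.

#[global] Instance peq_bool : peq bool.
Proof. by apply: ptime_eqb; ptime. Qed.

Lemma peq_inj (T U : eqType) {eT : enc T} {eU : enc U} {pU : peq U} (f : T -> U) :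
  ptime f -> injective f -> peq T.
Proof.
move=> fP f_inj; apply: (ptime_eq (f := fun p => f p.1 == f p.2)) => [p|]; last by ptime.
exact: inj_eq.
Qed.

#[global] Instance peq_seq (T : eqType) {eT : enc T} {pT : peq T} : peq (seq T).
Proof.
(* There may be no element of [T] to serve as a default for [nth], so position [i] is compared
   through the heads of the two suffixes that start there. *)
pose g2 (q : seq T * T * (seq T * T * (seq T * seq T))) := q.1.2 == q.2.1.2.
pose g1 (q : seq T * T * (seq T * seq T)) := if q.2.2 is y :: t then g2 (t, y, q) else false.
pose g0 (p : seq T * seq T) := if p.1 is x :: s then g1 (s, x, p) else nilp p.2.
have g2P : ptime g2 by rewrite /g2; ptime.
have g1P : ptime g1 by apply: (ptime_case (s := fun q => q.2.2) (f := fun=> false)); ptime.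
have g0P : ptime g0 by apply: (ptime_case (s := fun q => q.1) (f := fun q => nilp q.2)); ptime.
pose f (p : seq T * seq T) := (size p.1 == size p.2) &&
  all (fun i => g0 (drop i p.1, drop i p.2)) (iota 0 (size p.1)).
apply: (ptime_eq (f := f)); last by rewrite /f; ptime.
case=> s t; rewrite /f /=; elim: s t => [|x s IHs] [|y t] //=.
rewrite eqSS eqseq_cons -IHs andbCA {1}/g0 /= /g1 /= /g2 /= [y == x]eq_sym; congr (_ && (_ && _)).
by rewrite (iotaDl 1 0) all_map; apply: eq_all.
Qed.

(** Any function on a finite type is a constant table, looked up at the rank of the argument. *)
Lemma ptime_fin X (T : finType) Y {eX : enc X} {eY : enc Y} (f : T -> Y) (g : X -> T) :
  ptime g -> ptime (fun x => f (g x)).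
Proof.
apply: ptime_comp.
have rP : ptime (fun x : T => enum_rank x : nat) by exact: ptime_same.
case: (pickP T) => [x0 _|T0]; last by apply: ptime_same => x; have:= T0 x.
apply: (ptime_eq (f := fun x => nth (f x0) (map f (enum T)) (enum_rank x))); last by ptime.
by move=> x; rewrite (nth_map x0) ?nth_enum_rank // -cardE.
Qed.

#[global] Instance peq_fin (T : finType) : peq T.
Proof.
apply: (peq_inj (f := fun x : T => enum_rank x : nat)); first exact: ptime_same.
by move=> x y /val_inj/enum_rank_inj.
Qed.

(* Least significant bit first, as in [nat_bits]. *)
Definition bits (n : nat) : seq bool := [seq odd (n %/ 2 ^ k) | k <- iota 0 (up_log 2 n.+1)].

Lemma bits0 : bits 0 = [::]. Proof. by rewrite /bits up_log1. Qed.

Lemma nat_bitsE n : nat_bits n = map Bit (bits n).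
Proof. by rewrite /nat_bits /bits -map_comp. Qed.

Lemma bits_rec n : 0 < n -> bits n = odd n :: bits n./2.
Proof.
move=> n_gt0; rewrite /bits up_log2S //= divn1 (iotaDl 1 0) -map_comp; congr (_ :: _).
by apply: eq_map => k /=; rewrite expnD expn1 divnMA divn2.
Qed.

Fixpoint bits_val (s : seq bool) : nat := if s is b :: s' then b + (bits_val s').*2 else 0.

Lemma bitsK n : bits_val (bits n) = n.
Proof.
elim/ltn_ind: n => -[|n] IHn; first by rewrite bits0.
by rewrite bits_rec // /= IHn ?odd_double_half //; lia.
Qed.

Lemma ptime_repr X Y Z {eX : enc X} {eY : enc Y} {eZ : enc Z} (g : X -> Y) (f : X -> Z) :
  ptime g -> (forall x, tr (f x) = tr (g x)) -> ptime f.
Proof.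
move=> gP fE A B; have [c [h [hP cP]]] := gP A B.
by exists c, h; split=> // x r; rewrite /wd fE; apply: cP.
Qed.

Lemma sz_seq1 X {eX : enc X} (x : X) : sz [:: x] = sz x + 2.
Proof. by rewrite sz_cons (_ : sz [::] = 1) // addn1 addn2. Qed.

Lemma ptime_half_odd X {eX : enc X} (f : X -> nat) :
  ptime f -> ptime (fun x => ((f x)./2, odd (f x))).
Proof.
(* Every unit flips the parity, and a carry adds one to the half. *)
move=> fP; pose g (q : X * unit * (nat * bool)) :=
  if q.2.2 then (q.2.1.+1, false) else (q.2.1, true).
apply: (ptime_eq (f := fun x => foldr (fun y c => g (x, y, c)) (0, false) (nseq (f x) tt))).
  by move=> x; elim: (f x) => //= n ->; rewrite /g /= uphalf_half; case: odd.
apply: ptime_foldr; [by rewrite /g; ptime | by ptime | by ptime |].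
exists (fun=> 4) => [|x y [n b]]; first exact: polyb_const.
by rewrite /g /=; case: b; rewrite !sz_pair ?sz_nat /sz /=; lia.
Qed.

Lemma ptime_bits X {eX : enc X} (f : X -> nat) : ptime f -> ptime (fun x => bits (f x)).
Proof.
(* Repeated halving reaches 0 within [f x] rounds, and further rounds change nothing. *)
move=> fP; pose g (q : X * unit * (nat * seq bool)) :=
  if q.2.1 == 0 then q.2 else ((q.2.1)./2, q.2.2 ++ [:: odd q.2.1]).
apply: (ptime_eq (f := fun x => (foldr (fun y c => g (x, y, c)) (f x, [::]) (nseq (f x) tt)).2)).
  move=> x; set h := fun y c => g (x, y, c).
  have hE k m acc : m <= k -> (foldr h (m, acc) (nseq k tt)).2 = acc ++ bits m.
    elim: k m acc => [|k IHk] m acc.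
      by rewrite leqn0 => /eqP->; rewrite bits0 cats0.
    move=> le_mk; rewrite -[k.+1]addn1 nseqD foldr_cat /= {2}/h /g /=.
    case: eqP => [-> | /eqP m_neq0]; first by rewrite IHk.
    by rewrite IHk; [rewrite -catA (@bits_rec m) ?lt0n | lia].
  by rewrite hE.
apply: (ptime_snd (f := fun x => foldr (fun y c => g (x, y, c)) (f x, [::]) (nseq (f x) tt))).
apply: ptime_foldr; [rewrite /g; ptime | by ptime | by ptime |].
  apply: (ptime_eq (f := fun q : X * unit * (nat * seq bool) =>
     ((q.2.1)./2, odd q.2.1).1)) => //; apply: ptime_fst.
  by apply: (ptime_half_odd (f := fun q : X * unit * (nat * seq bool) => q.2.1)); ptime.
  apply: (ptime_eq (f := fun q : X * unit * (nat * seq bool) =>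
     ((q.2.1)./2, odd q.2.1).2)) => //; apply: ptime_snd.
  by apply: (ptime_half_odd (f := fun q : X * unit * (nat * seq bool) => q.2.1)); ptime.
exists (fun=> 4) => [|x y [n s]]; first exact: polyb_const.
rewrite /g /=; case: eqP => _; first by rewrite leq_addr.
rewrite !sz_pair !sz_nat -2!addSn; have := sz_cat (eY := enc_bool) s [:: odd n]; have := sz_bool (odd n).
by rewrite sz_seq1; lia.
Qed.

Definition int_word (z : int) : seq bool := (0 <= z)%R :: bits `|z|.
#[global] Instance code_int : enc int := fun z => tr (int_word z).

Lemma ptime_int_word X {eX : enc X} (f : X -> int) : ptime f -> ptime (fun x => int_word (f x)).
Proof. by apply: ptime_comp; apply: ptime_same. Qed.

Lemma int_word_inj : injective int_word.
Proof.
move=> y z [le0 /(congr1 bits_val)]; rewrite !bitsK => eq_abs.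
by move: le0 eq_abs; case: y => m; case: z => n //= _; [move-> | case=> ->].
Qed.

#[global] Instance peq_int : peq int.
Proof. by apply: peq_inj int_word_inj; apply: ptime_int_word; ptime. Qed.

Lemma ptime_Posz X {eX : enc X} (f : X -> nat) : ptime f -> ptime (fun x => Posz (f x)).
Proof.
move=> fP; apply: (ptime_repr (g := fun x => true :: bits (f x))) => //.
by ptime; apply: ptime_bits.
Qed.

Lemma ptime_enc_int X {eX : enc X} (f : X -> int) : ptime f -> ptime (fun x => enc_int (f x)).
Proof.
move=> /ptime_int_word fP.
apply: (ptime_eq (f := fun x => (if head true (int_word (f x)) then Plus else Minus) ::
   map (fun b : bool => if b then Bit true else Bit false) (behead (int_word (f x))))).
  move=> x; rewrite /enc_int nat_bitsE /=; congr (_ :: _).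
  by apply: eq_map; case.
by ptime.
Qed.

(** Going upwards from the least significant bit, the last position of difference decides, in favour
    of the bit of [t]. Missing bits count as 0. *)
Definition bits_le (s t : seq bool) : bool :=
  foldl (fun c i => if nth false s i == nth false t i then c else nth false t i) true
    (iota 0 (size s + size t)).

Lemma bits_leE s t : bits_le s t = (bits_val s <= bits_val t).
Proof.
have valE u m : bits_val (drop m u) = nth false u m + (bits_val (drop m.+1 u)).*2.
  by elim: u m => [|b u IHu] [|m] //=; rewrite drop0.
suff foldE n m c : size s <= m + n -> size t <= m + n ->
    foldl (fun c i => if nth false s i == nth false t i then c else nth false t i) c (iota m n) =
    if bits_val (drop m s) == bits_val (drop m t) then c
    else bits_val (drop m s) <= bits_val (drop m t).
  rewrite /bits_le foldE ?leq_addr ?leq_addl // !drop0.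
  by case: eqP => // ->; rewrite leqnn.
elim: n m c => [|n IHn] m c; first by rewrite addn0 => le_s le_t; rewrite !drop_oversize.
rewrite addnS -addSn => le_s le_t; rewrite /= IHn // (valE s m) (valE t m).
move: (bits_val _) (bits_val _) => a b.
by case: (a =P b) => [->|ne_ab]; case: (nth false s m); case: (nth false t m);
  rewrite /= ?eqxx //; case: eqP => ?; try case: eqP => ?; lia.
Qed.

Lemma ptime_bits_le X {eX : enc X} (f g : X -> seq bool) :
  ptime f -> ptime g -> ptime (fun x => bits_le (f x) (g x)).
Proof.
move=> fP gP; pose h (q : X * nat * bool) :=
  if nth false (f q.1.1) q.1.2 == nth false (g q.1.1) q.1.2 then q.2
  else nth false (g q.1.1) q.1.2.
have hP : ptime h by rewrite /h; ptime.
apply: (ptime_foldl (g := h)) => //; first by ptime.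
  by ptime.
exists (fun=> 3) => [|x y c]; first exact: polyb_const.
by apply: leq_trans (sz_bool _) (leq_addl _ _).
Qed.

Lemma ptime_lez X {eX : enc X} (f g : X -> int) :
  ptime f -> ptime g -> ptime (fun x => (f x <= g x)%R).
Proof.
move=> /ptime_int_word fP /ptime_int_word gP.
pose a x := behead (int_word (f x)); pose b x := behead (int_word (g x)).
have aP : ptime a by rewrite /a; ptime.
have bP : ptime b by rewrite /b; ptime.
apply: (ptime_eq (f := fun x =>
  if head true (int_word (f x)) then head true (int_word (g x)) && bits_le (a x) (b x)
  else head true (int_word (g x)) || bits_le (b x) (a x))).
  move=> x; rewrite !bits_leE /a /b /= !bitsK.
  by case: (f x) => m; case: (g x) => n //=; lia.
by ptime; apply: ptime_bits_le.
Qed.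

Definition int_of_word (s : seq bool) : int :=
  let n := bits_val (behead s) in if head true s then n%:Z%R else (- n%:Z)%R.

Lemma int_wordK : cancel int_word int_of_word.
Proof. by case=> n; rewrite /int_of_word /= bitsK // NegzE. Qed.

Lemma ptime_int_of_word X {eX : enc X} (f : X -> seq bool) :
  ptime f -> ptime (fun x => int_of_word (f x)).
Proof.
move=> fP; pose g (q : X * bool * seq bool) :=
  if nilp q.2 && ~~ q.1.2 then [::] else q.1.2 :: q.2.
pose t x := foldr (fun b c => g (x, b, c)) [::] (behead (f x)).
have tE x : t x = bits (bits_val (behead (f x))).
  rewrite /t; elim: (behead _) => [|b s IHs]; first by rewrite /= bits0.
  rewrite [foldr _ _ _]/= IHs /g /=; move: (bits_val s) => n.
  case: n => [|n]; first by case: b; rewrite ?bits0 // (@bits_rec 1) // bits0.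
  rewrite (@bits_rec (b + _)); last by case: b.
  rewrite (_ : nilp _ = false); last by rewrite bits_rec.
  by rewrite oddD odd_double addbF oddb half_bit_double.
have tP : ptime t.
  apply: ptime_foldr; [by rewrite /g; ptime | by ptime | by ptime |].
  exists (fun=> 4) => [|x b c]; first exact: polyb_const.
  rewrite /g /=; case: ifP => _; first by rewrite (_ : sz [::] = 1) //; lia.
  by rewrite sz_cons; have := sz_bool b; lia.
apply: (ptime_repr (g := fun x => (head true (f x) || nilp (t x)) :: t x)); first by ptime.
move=> x; suff <- : int_word (int_of_word (f x)) = (head true (f x) || nilp (t x)) :: t x by [].
rewrite tE /int_of_word /int_word; move: (bits_val _) => n; case: n => [|n].
  by rewrite bits0 orbT; case: (head _ _); rewrite ?bits0.
rewrite (_ : nilp _ = false) ?orbF; last by rewrite bits_rec.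
by case: (head _ _); rewrite ?abszN //=; congr (_ :: _); lia.
Qed.

(** * From nogoods to sorting *)

Lemma count_iota_range a b n : b <= n -> count (fun e => a <= e < b) (iota 0 n) = b - a.
Proof.
move=> le_bn; transitivity (minn b n - a); last by lia.
elim: n {le_bn} => [|n IHn]; first by rewrite minn0.
by rewrite -addn1 iotaD count_cat IHn /=; lia.
Qed.

Lemma count_addn (T : Type) (P Q R : pred T) s :
  (forall a, R a = P a + Q a :> nat) -> count R s = count P s + count Q s.
Proof. by move=> RPQ; elim: s => //= a s ->; rewrite RPQ addnACA. Qed.

(** Turns ranks into numbers of smaller values, which can be counted zone by zone without looking at
    the sorted list. *)
Lemma count_lt_sort (s : seq nat) r : uniq s -> r < size s ->
  count (fun b => b < nth 0 (sort leq s) r) s = r.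
Proof.
move=> us ltr; have perm_s : perm_eq (sort leq s) s by rewrite perm_sort.
rewrite -(seq.permP perm_s) -[RHS](@count_lt_nth _ _ 0 (sort leq s)) ?size_sort //.
by rewrite lt_sorted_uniq_le sort_uniq us (sort_sorted leq_total).
Qed.

Section Reduction.
Variables (N m : nat) (G : seq (seq nat)).

(* Variables range over [x < N], values over [a < m], and the atom [x * m + a]
   stands for [x = a]. A nogood is a list of atoms that must not all hold.
   The values to be sorted fall into one zone per atom [z], followed by an end
   zone. In zone [z], the value at offset
   - [c < size G] is chosen if nogood [c] is refuted by the failure of [z],
   - [size G] is chosen if [z] holds,
   - [size G < o] is a filler, which is alternatively put into the end zone.
   The domains of [V] give [n_slots] ranks to every zone and let the value
   at offset [size G] appear at the first of them only, so that no nogood can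
   be refuted by [z] if [z] holds. *)
Definition n_zones := N * m.
Definition n_slots := (size G).+1.
(** [n_slots] offsets for claims about the atom, namely one per nogood and one for the atom itself,
    and as many for fillers. *)
Definition zone_width := 2 * n_slots.
Arguments n_slots : simpl never.
Notation Z := n_zones.
Notation K := (size G).
Notation M := n_slots.
Notation D := zone_width.

Definition slots := flatten [seq [seq (z, j) | j <- iota 0 M] | z <- iota 0 Z].

Definition sort_U : seq (seq nat) :=
  [seq [seq (x * m + a) * D + K | a <- iota 0 m] | x <- iota 0 N] ++
  [seq [seq z * D + c | z <- nth [::] G c] | c <- iota 0 K] ++
  [seq [:: p.1 * D + (M + p.2); Z * D + (p.1 * M + p.2)] | p <- slots].

(** In a support, the [N + K] claims take up slots of the zones, so that the same number of fillers
    is pushed out; the last [N + K] ranks receive them. *)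
Definition sort_V : seq (seq nat) :=
  [seq [seq p.1 * D + c | c <- iota 0 K] ++ [seq p.1 * D + (M + j) | j <- iota 0 M] ++
       (if p.2 == 0 then [:: p.1 * D + K] else [::]) | p <- slots] ++
  nseq (N + K) [seq Z * D + e | e <- iota 0 (Z * M)].

Lemma slotsE : slots = [seq (e %/ M, e %% M) | e <- iota 0 (Z * M)].
Proof.
rewrite /slots; elim: Z => // z IHz.
rewrite -addn1 iotaD map_cat flatten_cat IHz mulnDl iotaD map_cat mul1n add0n.
rewrite -[map _ (iota z 1)]/[:: [seq (z, j) | j <- iota 0 M]] -[flatten [:: _]]/(_ ++ [::]) cats0.
congr (_ ++ _); rewrite add0n -[in RHS](addn0 (z * M)) iotaDl -map_comp.
apply/eq_in_map => j; rewrite mem_iota add0n => /andP[_ ltj] /=.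
by rewrite divnMDl // divn_small // addn0 modnMDl modn_small.
Qed.

Lemma size_slots : size slots = Z * M.
Proof. by rewrite slotsE size_map size_iota. Qed.

Lemma size_U : size sort_U = N + K + Z * M.
Proof. by rewrite !size_cat !size_map !size_iota size_slots addnA. Qed.

Lemma size_V : size sort_V = N + K + Z * M.
Proof. by rewrite size_cat size_map size_slots size_nseq addnC. Qed.

Lemma D_gt0 : 0 < D. Proof. by []. Qed.
Lemma M_gt0 : 0 < M. Proof. by []. Qed.

Definition rank_ok r a :=
  if r < Z * M then (a %/ D == r %/ M) && ((a %% D == K) ==> (r %% M == 0))
  else Z * D <= a < Z * D + Z * M.

Lemma mem_V r a : r < N + K + Z * M -> (a \in nth [::] sort_V r) = rank_ok r a.
Proof.
move=> ltr; rewrite /rank_ok nth_cat size_map size_slots; case: ltnP => ltZ.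
  rewrite slotsE -map_comp (nth_map 0) ?size_iota // nth_iota // add0n /comp; cbn [fst snd].
  have segE z b k : [seq z * D + (b + i) | i <- iota 0 k] = iota (z * D + b) k.
    by rewrite -[z * D + b in RHS]addn0 iotaDl -?map_comp; apply: eq_map => i; rewrite addnA.
  move: (r %/ M) (r %% M) => z j; rewrite !mem_cat segE.
  have -> : [seq z * D + c | c <- iota 0 K] = iota (z * D) K.
    by rewrite -[z * D in RHS]addn0 iotaDl.
  rewrite !mem_iota.
  have := divn_eq a D; have := ltn_pmod a D_gt0.
  move: (a %/ D) (a %% D) => q o lto Ea.
  have -> : (a \in if j == 0 then [:: z * D + K] else [::]) = (j == 0) && (a == z * D + K).
    by case: ifP; rewrite ?inE.
  case: (ltngtP q z) => [ltqz | ltzq | eq_qz].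
  - have : q.+1 * D <= z * D by rewrite leq_mul2r ltqz orbT.
    rewrite mulSn; move: Ea lto; rewrite /D /M; move: (q * _) (z * _); lia.
  - have : z.+1 * D <= q * D by rewrite leq_mul2r ltzq orbT.
    rewrite mulSn; move: Ea lto; rewrite /D /M; move: (q * _) (z * _); lia.
  by move: Ea lto; rewrite eq_qz /D /M; move: (z * _); lia.
rewrite nth_nseq; have -> : r - Z * M < N + K by lia.
have -> : [seq Z * D + e | e <- iota 0 (Z * M)] = iota (Z * D) (Z * M).
  by rewrite -[Z * D in RHS]addn0 iotaDl.
by rewrite mem_iota.
Qed.

(** Recovers from a value the index of the only variable of [U] that can take it, which makes the
    domains disjoint. *)
Definition zone_owner (a : nat) : nat :=
  if a < Z * D then
    let z := a %/ D in let o := a %% D in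
    if o < K then N + o else if o == K then z %/ m else N + K + (z * M + (o - M))
  else N + K + (a - Z * D).

Lemma zone_div z o : o < D -> (z * D + o) %/ D = z.
Proof. by move=> lto; rewrite divnMDl // divn_small // addn0. Qed.

Lemma zone_mod z o : o < D -> (z * D + o) %% D = o.
Proof. by move=> lto; rewrite modnMDl modn_small. Qed.

Lemma zone_lt z o : z < Z -> o < D -> z * D + o < Z * D.
Proof. by move=> ltz lto; apply: leq_trans (_ : z.+1 * D <= _);
  rewrite ?leq_mul2r ?ltz ?orbT // mulSn addnC ltn_add2r. Qed.

Hypothesis G_small : forall g, g \in G -> forall z, z \in g -> z < Z.

Lemma atom_lt x a : x < N -> a < m -> x * m + a < Z.
Proof. by move=> ltx lta; apply: leq_trans (_ : x.+1 * m <= _); rewrite ?leq_mul2r ?ltx ?orbT // mulSn; lia. Qed.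

Lemma zone_ownerP i a : i < size sort_U -> a \in nth [::] sort_U i -> zone_owner a = i.
Proof.
rewrite size_U => lti; rewrite !nth_cat size_map size_iota; case: ltnP => [ltN | leN].
  rewrite (nth_map 0) ?size_iota // nth_iota // add0n => /mapP[b].
  rewrite mem_iota add0n => /andP[_ ltb] ->; have ltK : K < D by rewrite /D /M; lia.
  rewrite /zone_owner zone_lt ?atom_lt // zone_div // zone_mod // ltnn eqxx.
  by rewrite divnMDl ?divn_small ?addn0 //; lia.
rewrite size_map size_iota; case: ltnP => [ltK | leK].
  rewrite (nth_map 0) ?size_iota // nth_iota // add0n => /mapP[z zG ->].
  have ltz : z < Z by apply: G_small zG; apply: mem_nth.
  have ltD : i - N < D by rewrite /D /M; lia.
  by rewrite /zone_owner zone_lt // zone_mod // ltK; lia.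
set e := _ - _; have lte : e < Z * M by rewrite /e; lia.
rewrite slotsE -map_comp (nth_map 0) ?size_iota // nth_iota // add0n /comp; cbn [fst snd].
have lej : e %% M < M by rewrite ltn_pmod.
have ltD : M + e %% M < D by rewrite /D; lia.
rewrite !inE => /orP[] /eqP->.
  have ltz : e %/ M < Z by rewrite ltn_divLR.
  rewrite /zone_owner zone_lt // zone_div // zone_mod //.
  have -> : M + e %% M < K = false by rewrite /M; lia.
  have -> : (M + e %% M == K) = false by rewrite /M; lia.
  by rewrite addKn -divn_eq /e; lia.
by rewrite /zone_owner ltnNge leq_addr /= -divn_eq addKn /e; lia.
Qed.

Lemma sort_U_disjoint i j a : i < size sort_U -> j < size sort_U ->
  a \in nth [::] sort_U i -> a \in nth [::] sort_U j -> i = j.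
Proof. by move=> lti ltj /zone_ownerP<- // /zone_ownerP<-. Qed.

Lemma all2_memP (u : seq nat) (W : seq (seq nat)) :
  reflect (size u = size W /\ forall i, i < size W -> nth 0 u i \in nth [::] W i)
    (all2 (fun a A => a \in A) u W).
Proof.
apply: (iffP idP); elim: u W => [|a u IHu] [|B W] //=.
- by case/andP=> aB /IHu[-> WP]; split=> // -[|i] //; apply: WP.
- by case.
- by case.
- case=> -[szu] WP; rewrite (WP 0) // IHu //; split=> // i lti; exact: (WP i.+1).
Qed.

Lemma sort_U_uniq u : all2 (fun a A => a \in A) u sort_U -> uniq u.
Proof.
case/all2_memP=> szu uU; apply/(uniqP 0) => i j; rewrite !inE szu => lti ltj eq_ij.
by apply: sort_U_disjoint (uU i lti) _; rewrite ?eq_ij ?uU.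
Qed.

Definition csp_solution (A : nat -> nat) :=
  (forall x, x < N -> A x < m) /\
  (forall g, g \in G -> has (fun z => A (z %/ m) != z %% m) g).

Definition sort_support (u v : seq nat) :=
  [/\ all2 (fun a A => a \in A) u sort_U, all2 (fun a A => a \in A) v sort_V
    & v = sort leq u].

Lemma support_solution u v : sort_support u v -> exists A, csp_solution A.
Proof.
case=> /all2_memP[szu uU] /all2_memP[szv vV] Ev.
rewrite size_U in szu uU; rewrite size_V in szv vV.
have vP r : r < N + K + Z * M -> rank_ok r (nth 0 v r) by move=> ltr; rewrite -mem_V // vV.
pose A x := (nth 0 u x %/ D) %% m; exists A.
have ltKD : K < D by rewrite /D /M; lia.
have AP x : x < N -> A x < m /\ nth 0 u x = (x * m + A x) * D + K.
  move=> ltx; have ltx' : x < N + K + Z * M by lia.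
  have := uU x ltx'; rewrite nth_cat size_map size_iota ltx (nth_map 0) ?size_iota //.
  rewrite nth_iota // add0n => /mapP[a]; rewrite mem_iota => /andP[_ lta] E.
  have Ea : A x = a by rewrite /A E zone_div // modnMDl modn_small.
  by rewrite Ea.
split=> [x /AP[]//|g gG]; have ltc : index g G < K by rewrite index_mem.
set c := index g G in ltc.
have ltc' : N + c < N + K + Z * M by lia.
have := uU _ ltc'; rewrite nth_cat size_map size_iota ltnNge leq_addr /=.
rewrite nth_cat size_map size_iota addKn ltc (nth_map 0) ?size_iota //.
rewrite nth_iota // add0n nth_index // => /mapP[z zg Eb].
apply/hasP; exists z => //; apply/eqP => Az.
have ltz : z < Z := G_small gG zg.
have m_gt0 : 0 < m by case: (posnP m) ltz => // m0; rewrite /n_zones m0 muln0.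
have ltzm : z %/ m < N by rewrite ltn_divLR.
have [_] := AP _ ltzm; rewrite Az -divn_eq => Et.
have bv : z * D + c \in v by rewrite Ev mem_sort -Eb mem_nth // szu.
have tv : z * D + K \in v by rewrite Ev mem_sort -Et mem_nth // szu; lia.
have ltr1 : index (z * D + c) v < N + K + Z * M by rewrite -szv index_mem.
have ltr2 : index (z * D + K) v < N + K + Z * M by rewrite -szv index_mem.
have lt12 : index (z * D + c) v < index (z * D + K) v.
  rewrite ltnNge; apply/negP => le21.
  have srtv : sorted leq v by rewrite Ev (sort_sorted leq_total).
  have := sorted_leq_nth leq_trans leqnn 0 srtv.
  move=> /(_ (index (z * D + K) v) (index (z * D + c) v)); rewrite !inE !index_mem.
  move=> /(_ tv bv le21); rewrite !nth_index //.
  by rewrite leq_add2l leqNgt ltc.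
have ltcD : c < D by lia.
have := vP _ ltr1; have := vP _ ltr2; rewrite /rank_ok !nth_index // !zone_div // !zone_mod //.
rewrite eqxx /=; case: ifP => [lt2|_]; last by rewrite leqNgt zone_lt.
rewrite (ltn_trans lt12 lt2) => /andP[/eqP E2 /eqP E2'] /andP[/eqP E1 _].
move: lt12; rewrite (divn_eq (index _ _) M) -E1 (divn_eq (index (_ + K) _) M) -E2 E2'.
by rewrite addn0 ltnNge leq_addr.
Qed.

Section Support.
Variable A : nat -> nat.
Hypothesis A_sol : csp_solution A.

Definition selected z := A (z %/ m) == z %% m.
Definition refuted c := let g := nth [::] G c in nth 0 g (find (fun z => ~~ selected z) g).
(** The number of claims in zone [z]. It is at most [1 + K], the number of slots, so the zone can be
    completed by its first [M - load z] fillers. *)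
Definition load z := selected z + count (fun c => refuted c == z) (iota 0 K).
Definition sol_u : seq nat :=
  [seq (x * m + A x) * D + K | x <- iota 0 N] ++
  [seq refuted c * D + c | c <- iota 0 K] ++
  [seq if p.2 < M - load p.1 then p.1 * D + (M + p.2) else Z * D + (p.1 * M + p.2)
  | p <- slots].

Lemma refutedP c : c < K -> refuted c \in nth [::] G c /\ ~~ selected (refuted c).
Proof.
move=> ltc; have gG : nth [::] G c \in G by rewrite mem_nth.
have hasz := A_sol.2 _ gG; split; last exact: (nth_find 0 hasz).
by rewrite mem_nth // -has_find.
Qed.

Lemma sol_u_U : all2 (fun a A => a \in A) sol_u sort_U.
Proof.
apply/all2_memP; split; first by rewrite size_U !size_cat !size_map !size_iota size_slots addnA.
rewrite size_U => i lti; rewrite !nth_cat !size_map !size_iota.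
case: ltnP => [ltN | leN].
  rewrite !(nth_map 0) ?size_iota // nth_iota // add0n.
  by apply/mapP; exists (A i); rewrite // mem_iota A_sol.1.
case: ltnP => [ltK | leK].
  rewrite !(nth_map 0) ?size_iota // nth_iota // add0n.
  by apply/mapP; exists (refuted (i - N)) => //; have [] := refutedP ltK.
rewrite !(nth_map (0, 0)) ?size_slots; try lia.
by case: ifP => _; rewrite !inE eqxx ?orbT.
Qed.

Lemma load_le z : load z <= M.
Proof.
rewrite /load /M; have := count_size (fun c => refuted c == z) (iota 0 K).
by rewrite size_iota; case: selected; lia.
Qed.

Lemma m_gt0 z : z < Z -> 0 < m.
Proof. by case: (posnP m) => // m0; rewrite /n_zones m0 muln0. Qed.

(** The three blocks of [sol_u] contribute [selected z], the number of nogoods refuted by [z], and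
    [M - load z]. *)
Lemma zone_count z : z < Z -> count (fun a => a %/ D == z) sol_u = M.
Proof.
move=> ltz; rewrite !count_cat !count_map.
have ltKD : K < D by rewrite /D /M; lia.
have m0 := m_gt0 ltz.
rewrite (_ : count _ (iota 0 N) = selected z); last first.
  rewrite (eq_in_count (a2 := fun x => selected z && (x == z %/ m))) => [|x].
    case: selected => /=; last by rewrite count_pred0.
    by rewrite count_uniq_mem ?iota_uniq // mem_iota /= add0n ltn_divLR ?ltz.
  rewrite mem_iota add0n => /andP[_ ltx] /=; rewrite zone_div // /selected.
  apply/eqP/andP => [<- | [/eqP Az /eqP Ex]].
    by rewrite divnMDl // divn_small ?addn0 ?modnMDl ?modn_small ?A_sol.1 ?eqxx.
  by rewrite Ex Az -divn_eq.
rewrite (_ : count _ (iota 0 K) = count (fun c => refuted c == z) (iota 0 K)); last first.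
  apply: eq_in_count => c; rewrite mem_iota add0n => /andP[_ ltc] /=.
  by rewrite zone_div //; rewrite /D /M; lia.
rewrite (_ : count _ slots = M - load z); last first.
  rewrite slotsE count_map.
  rewrite (eq_in_count (a2 := fun e => z * M <= e < z * M + (M - load z))) => [|e].
    rewrite count_iota_range ?addKn //.
    by apply: leq_trans (_ : z.+1 * M <= _); rewrite ?leq_mul2r ?ltz ?orbT // mulSn addnC leq_add2r leq_subr.
  rewrite mem_iota add0n => /andP[_ lte]; rewrite /=.
  have ltj := ltn_pmod e M_gt0; have le_l := load_le z.
  have ltq : e %/ M < Z by rewrite ltn_divLR.
  have -> : (z * M <= e < z * M + (M - load z)) = (e %/ M == z) && (e %% M < M - load z).
    rewrite {1 2}(divn_eq e M); case: (ltngtP (e %/ M) z) => [lt | lt | ->].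
    - have : (e %/ M).+1 * M <= z * M by rewrite leq_mul2r lt orbT.
      by rewrite mulSn; lia.
    - have : z.+1 * M <= e %/ M * M by rewrite leq_mul2r lt orbT.
      by rewrite mulSn; lia.
    by rewrite leq_addr ltn_add2l.
  case: ifP => ltl; first rewrite zone_div; last 2 first.
  - by rewrite /D; lia.
  - case: eqP => [E|_]; last by case: eqP ltl => [-> ->|].
    have : Z <= z by rewrite -E leq_divRL ?leq_addr.
    by rewrite leqNgt ltz.
  by case: eqP ltl => // -> ->.
by rewrite addnA subnKC ?load_le.
Qed.

Lemma zone_below z : z <= Z -> count (fun a => a < z * D) sol_u = z * M.
Proof.
elim: z => [|z IHz] ltz; first by rewrite mul0n (eq_count (a2 := pred0)) ?count_pred0.
rewrite [RHS]mulSn -IHz ?(ltnW ltz) // -[X in X + _](zone_count ltz) addnC; apply: count_addn => a.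
rewrite -!ltn_divLR ?D_gt0 //; lia.
Qed.

(** Zone [z] occupies the [M] ranks from [z * M] on, so only a value at offset [size G] needs care.
    It occurs only if [z] holds; then no nogood is refuted by [z], and the value is the least of its
    zone. *)
Lemma solution_support : sort_support sol_u (sort leq sol_u).
Proof.
split=> //; first exact: sol_u_U.
have szu : size sol_u = N + K + Z * M.
  by rewrite !size_cat !size_map !size_iota size_slots addnA.
apply/all2_memP; rewrite size_sort szu size_V; split=> // r ltr.
rewrite mem_V // -{1}(@count_lt_sort sol_u r) ?szu //; last exact: sort_U_uniq sol_u_U.
have: nth 0 (sort leq sol_u) r \in sol_u by rewrite -(mem_sort leq) mem_nth // size_sort szu.
set a := nth 0 _ r => au; rewrite /rank_ok.
have ltn_count (P Q : pred nat) : (forall b, P b -> Q b) -> ~~ P a -> Q a -> count P sol_u < count Q sol_u.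
  move=> PQ Pa Qa.
  rewrite (@count_addn _ P (fun b => Q b && ~~ P b) Q) => [|b].
    by rewrite -addn1 leq_add2l -has_count; apply/hasP; exists a; rewrite ?Qa.
  by have := PQ b; case: (P b) (Q b) => [] [] // /(_ isT).
case: (ltnP a (Z * D)) => [lta | lea]; last first.
  rewrite ltnNge -{1}(zone_below (leqnn Z)) sub_count /= ?lea; last first.
    by move=> b /=; lia.
  move: au; rewrite !mem_cat => /or3P[] /mapP[].
  - move=> x; rewrite mem_iota => /andP[_ ltx] Ea; move: lea; rewrite Ea leqNgt zone_lt //.
      by rewrite atom_lt // A_sol.1.
    by rewrite /D /M; lia.
  - move=> c; rewrite mem_iota => /andP[_ ltc] Ea; move: lea; rewrite Ea leqNgt zone_lt //.
      have [cG _] := refutedP ltc; apply: G_small cG; exact: mem_nth.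
    by rewrite /D /M; lia.
  rewrite slotsE => p /mapP[e]; rewrite mem_iota => /andP[_ lte] -> /= Ea.
  move: lea; rewrite Ea; case: ifP => _; last by rewrite -divn_eq ltn_add2l.
  by rewrite leqNgt zone_lt //; [rewrite ltn_divLR | have := ltn_pmod e M_gt0; rewrite /D; lia].
set z := a %/ D; have ltz : z < Z by rewrite ltn_divLR.
have [leza ltaz] : z * D <= a /\ a < z.+1 * D.
  by rewrite leq_divM -ltn_divLR.
have lt_cnt : count (fun b => b < a) sol_u < z.+1 * M.
  by rewrite -zone_below //; apply: ltn_count; rewrite ?ltnn // => b; lia.
have le_cnt : z * M <= count (fun b => b < a) sol_u.
  by rewrite -(zone_below (ltnW ltz)); apply: sub_count => b /=; lia.
have Ecnt : count (fun b => b < a) sol_u %/ M = z.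
  by apply/eqP; rewrite eqn_leq -ltnS ltn_divLR // lt_cnt leq_divRL.
rewrite -ltn_divLR // Ecnt ltz eqxx /=; apply/implyP => /eqP aK.
have Ea : a = z * D + K by rewrite -aK -divn_eq.
(* Offset [size G] arises in the first block of [sol_u] only: the second block has smaller offsets,
   and fillers have larger ones or lie in the end zone. *)
have zsel : selected z.
  move: au; rewrite Ea !mem_cat => /or3P[] /mapP[].
  - move=> x; rewrite mem_iota => /andP[_ ltx] /addIn/eqP; rewrite eqn_pmul2r // => /eqP->.
    have := A_sol.1 x ltx => ltA.
    by rewrite /selected divnMDl ?divn_small ?addn0 ?modnMDl ?modn_small //; lia.
  - move=> c; rewrite mem_iota => /andP[_ ltc] /(congr1 (modn^~ D)).
    by rewrite /= !zone_mod; rewrite /D /M; lia.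
  move=> [z' e]; rewrite slotsE => /mapP[e' _ [_ ->]] /=; case: ifP => _ E.
    by have := congr1 (modn^~ D) E; rewrite /= !zone_mod /D /M; have := ltn_pmod e' M_gt0; lia.
  by move: lta; rewrite Ea E; lia.
(* A smaller value of the same zone would claim that [z] fails, against [zsel]. *)
suff bP : {in sol_u, (fun b => b < a) =1 (fun b => b < z * D)}.
  by rewrite (eq_in_count bP) zone_below ?modnMl // ltnW.
move=> b bu; rewrite /=; case: (ltnP b (z * D)) => [|leb]; first by lia.
apply/negbTE/negP => ltb.
have [oK Eb] : b - z * D < K /\ b = z * D + (b - z * D) by lia.
have oD : b - z * D < D by apply: ltn_trans oK _; rewrite /D /M; lia.
move: oK; set o := b - _ in Eb oD * => oK.
have {Eb} [Eq Eo] : b %/ D = z /\ b %% D = o by rewrite Eb zone_div ?zone_mod.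
move: bu Eq Eo; rewrite !mem_cat => /or3P[] /mapP[].
- by move=> x _ ->; rewrite zone_mod /D /M; lia.
- move=> c; rewrite mem_iota => /andP[_ ltc] ->; rewrite zone_div ?zone_mod; try (rewrite /D /M; lia).
  by move=> Ec; have [_] := refutedP ltc; rewrite Ec zsel.
move=> [z' e]; rewrite slotsE => /mapP[e' _ [_ ->]] -> /=; case: ifP => _.
  have ltj := ltn_pmod e' M_gt0; rewrite zone_mod; last by rewrite /D; lia.
  by rewrite /M; lia.
move=> E; have: Z <= z by rewrite -E leq_divRL ?leq_addr.
by rewrite leqNgt ltz.
Qed.

End Support.
End Reduction.

(** * From computations to nogoods *)

Section Columns.
Variables (A B : finType) (M : machine A B).
Notation I := 'I_(extra M).+1.
Notation L := (option (A + B + aux M)).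

(* Column [j] of a configuration consists of the state and of the cells at
   distance [j] on both sides of every head. *)
Definition col : finType := (state M * {ffun I -> L * L})%type.

Definition column (c : config M) (j : nat) : col :=
  (c.1, [ffun i => (nth None (c.2 i).1 j, nth None (c.2 i).2 j)]).

(* Since the tapes are shifted along with the heads, column [j] of the next
   configuration is a function of columns [0], [j-1], [j] and [j+1], which
   depends on [j] only through the tests [j = 0] and [j = 1]. *)
Definition next_col (j : nat) (c0 cl c cr : col) : col :=
  if trans c0.1 [ffun i => (c0.2 i).2] is Some (q, w) then
    (q, [ffun i => match (w i).2 with
      | MoveL => ((cr.2 i).1, match j with 0 => (c0.2 i).1 | 1 => (w i).1 | _ => (cl.2 i).2 end)
      | MoveR => (if j is 0 then (w i).1 else (cl.2 i).1, (cr.2 i).2)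
      | Stay => ((c.2 i).1, if j is 0 then (w i).1 else (c.2 i).2)
      end])
  else c.

Lemma column_step c j : column (step c) j =
  next_col j (column c 0) (column c j.-1) (column c j) (column c j.+1).
Proof.
rewrite /step /next_col /table.
have -> : [ffun i => ((column c 0).2 i).2] = [ffun i => scan (c.2 i)].
  by apply/ffunP => i; rewrite !ffunE /= /scan -nth0.
case: trans => [[q w]|] //; congr (_, _); apply/ffunP => i; rewrite !ffunE /=.
rewrite /act; case: (w i) => a [] /=.
- by case: j => [|[|j]]; rewrite /= ?nth_behead ?nth0 //; case: (c.2 i).1.
- by case: j => [|j]; rewrite /= ?nth_behead ?nth0 //; case: (c.2 i).2.
- by case: j => [|j]; rewrite /= ?nth_behead.
Qed.

End Columns.

Section Tableau.
Variables (A B : finType) (M : machine (A + B)%type bool).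
Variables (x : seq A) (P T : nat).
Notation C := (col M).
Definition n_cols := #|C|.
Notation m := n_cols.
(** The last column has no right neighbour and is not constrained after time 0. This ignorance
    spreads by one column per step, and the margin [T] keeps it away from column 0 until time
    [T]. *)
Definition width := size x + P + T + 1.
Notation W := width.
Definition n_vars := T.+1 * W.

Definition init_col (o : option (A + B)) : C :=
  (start M, [ffun i => (None, if i == ord0 then omap (inl \o inl) o else None)]).
Definition accepting (c : C) : bool := (c.2 ord0).2 == Some (inl (inr true)).
Definition rk (c : C) : nat := enum_rank c.

Definition bad_steps (j : nat) : seq (seq nat) :=
  [seq [:: rk p.1.1.1.1; rk p.1.1.1.2; rk p.1.1.2; rk p.1.2; rk p.2] |
   p <- enum {: C * C * C * C * C} & p.2 != next_col j p.1.1.1.1 p.1.1.1.2 p.1.1.2 p.1.2].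

Definition bad_cols (p : pred C) : seq nat := [seq rk c | c <- enum C & p c].

Definition cert_cols : seq C := [seq init_col (Some (inr b)) | b <- enum B].

Definition bad_init (j : nat) : seq nat :=
  if j < size x then nth [::] [seq bad_cols [pred c | c != init_col (Some (inl a))] | a <- x] j
  else if j < size x + P then bad_cols [pred c | c \notin init_col None :: cert_cols]
  else bad_cols [pred c | c != init_col None].

(** The third group forbids a blank right before a certificate letter, so that the guessed cells
    form a word. The bad steps enter through three lists that depend on the machine only, hence are
    constants for [ptime]. *)
Definition tableau : seq (seq nat) :=
  flatten [seq flatten [seq [seq
     [:: (t * W) * m + nth 0 ks 0; (t * W + j.-1) * m + nth 0 ks 1; (t * W + j) * m + nth 0 ks 2;
         (t * W + j.+1) * m + nth 0 ks 3; (t.+1 * W + j) * m + nth 0 ks 4]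
     | ks <- nth (bad_steps 2) [:: bad_steps 0; bad_steps 1] j] | j <- iota 0 W.-1] | t <- iota 0 T] ++
  (flatten [seq [seq [:: j * m + r] | r <- bad_init j] | j <- iota 0 W] ++
  (flatten [seq [seq [:: j * m + rk (init_col None); j.+1 * m + r] | r <- map rk cert_cols]
           | j <- iota 0 W.-1] ++
  [seq [:: (T * W) * m + r] | r <- bad_cols [pred c | ~~ accepting c]])).

Lemma rk_lt c : rk c < m. Proof. exact: ltn_ord. Qed.

Lemma bad_stepsE j : nth (bad_steps 2) [:: bad_steps 0; bad_steps 1] j = bad_steps j.
Proof. by case: j => [|[|[|j]]]. Qed.

(* The nogoods of [tableau] before pairs of a variable and a value are turned
   into atoms; variable [t * W + j] stands for column [j] at time [t]. *)
Inductive nogood : seq (nat * C) -> Prop :=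
| nogood_step t j c0 cl c cr c' : t < T -> j < W.-1 -> c' != next_col j c0 cl c cr ->
    nogood [:: (t * W, c0); (t * W + j.-1, cl); (t * W + j, c); (t * W + j.+1, cr);
               (t.+1 * W + j, c')]
| nogood_input j a c : ohead (drop j x) = Some a -> j < W -> c != init_col (Some (inl a)) ->
    nogood [:: (j, c)]
| nogood_cert j c : size x <= j < size x + P -> c \notin init_col None :: cert_cols ->
    nogood [:: (j, c)]
| nogood_blank j c : size x + P <= j < W -> c != init_col None -> nogood [:: (j, c)]
| nogood_gap j b : j < W.-1 ->
    nogood [:: (j, init_col None); (j.+1, init_col (Some (inr b)))]
| nogood_accept c : ~~ accepting c -> nogood [:: (T * W, c)].

Definition atoms (s : seq (nat * C)) : seq nat := [seq p.1 * m + rk p.2 | p <- s].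

Lemma mem_bad_cols (p : pred C) r : reflect (exists2 c, p c & r = rk c) (r \in bad_cols p).
Proof.
apply: (iffP mapP) => [[c] | [c pc ->]]; first by rewrite mem_filter => /andP[pc _] ->; exists c.
by exists c; rewrite // mem_filter pc mem_enum.
Qed.

Lemma tableauP g : reflect (exists2 s, nogood s & g = atoms s) (g \in tableau).
Proof.
apply: (iffP idP); rewrite !mem_cat.
  case/or4P.
  - case/flatten_mapP => t; rewrite mem_iota => /andP[_ ltt] /flatten_mapP[j].
    rewrite mem_iota bad_stepsE => /andP[_ ltj] /mapP[ks /mapP[[[[[c0 cl] c] cr] c']]].
    rewrite mem_filter /= => /andP[bad _] -> ->.
    exists [:: (t * W, c0); (t * W + j.-1, cl); (t * W + j, c); (t * W + j.+1, cr);
               (t.+1 * W + j, c')] => //.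
    exact: nogood_step bad.
  - case/flatten_mapP => j; rewrite mem_iota => /andP[_ ltj] /mapP[r].
    rewrite /bad_init; case: (ltnP j (size x)) => [ltx | lex].
      case Ex: x ltx => [|a0 x'] // ltx; rewrite -Ex in ltx *.
      rewrite (nth_map a0) // => /mem_bad_cols[c /= bad ->] ->; exists [:: (j, c)] => //.
      by apply: nogood_input bad => //; rewrite (drop_nth a0).
    case: ltnP => [ltP | leP] /mem_bad_cols[c /= bad ->] ->;
      exists [:: (j, c)] => //.
      by apply: nogood_cert bad; rewrite lex.
    by apply: nogood_blank bad; rewrite leP.
  - case/flatten_mapP => j; rewrite mem_iota => /andP[_ ltj] /mapP[r].
    case/mapP => c /mapP[b _ ->] -> ->.
    exists [:: (j, init_col None); (j.+1, init_col (Some (inr b)))] => //.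
    exact: nogood_gap.
  - case/mapP => r /mem_bad_cols[c bad ->] ->; exists [:: (T * W, c)] => //.
    exact: nogood_accept.
case=> s bad_s ->; case: bad_s => {s}.
- move=> t j c0 cl c cr c' ltt ltj bad; apply/or4P/Or41.
  apply/flatten_mapP; exists t; first by rewrite mem_iota.
  apply/flatten_mapP; exists j; first by rewrite mem_iota.
  rewrite bad_stepsE; apply/mapP; exists [:: rk c0; rk cl; rk c; rk cr; rk c'] => //.
  by apply/mapP; exists (c0, cl, c, cr, c'); rewrite // mem_filter mem_enum bad.
- move=> j a c Ea ltj bad; apply/or4P/Or42/flatten_mapP; exists j; first by rewrite mem_iota.
  apply/mapP; exists (rk c) => //; rewrite /bad_init.
  have ltx : j < size x by case: ltnP Ea => // le; rewrite drop_oversize.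
  rewrite ltx (nth_map a) //; apply/mem_bad_cols; exists c => //=.
  by move: Ea; rewrite (drop_nth a) // => -[->].
- move=> j c /andP[lex ltP] bad; apply/or4P/Or42/flatten_mapP; exists j.
    by rewrite mem_iota /W; lia.
  apply/mapP; exists (rk c) => //; rewrite /bad_init ltnNge lex ltP /=.
  by apply/mem_bad_cols; exists c.
- move=> j c /andP[leP ltW] bad; apply/or4P/Or42/flatten_mapP; exists j.
    by rewrite mem_iota.
  apply/mapP; exists (rk c) => //; rewrite /bad_init !ifN -?leqNgt ?(leq_trans (leq_addr P _) leP) //.
  by apply/mem_bad_cols; exists c.
- move=> j b ltj; apply/or4P/Or43/flatten_mapP; exists j; first by rewrite mem_iota.
  by apply/mapP; exists (rk (init_col (Some (inr b)))) => //; apply/map_f/map_f; rewrite mem_enum.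
- move=> c bad; apply/or4P/Or44/mapP; exists (rk c) => //.
  by apply/mem_bad_cols; exists c.
Qed.

Lemma nogood_var s p : nogood s -> p \in s -> p.1 < n_vars.
Proof.
have ltv t j : t <= T -> j < W -> t * W + j < n_vars.
  move=> let_ ltj; apply: leq_trans (_ : t.+1 * W <= _).
    by rewrite mulSn addnC ltn_add2r.
  by rewrite leq_mul2r ltnS let_ orbT.
have W_gt0 : 0 < W by rewrite /width addn1.
case=> {s}.
- move=> t j c0 cl c cr c' ltt ltj _; rewrite !inE => /or4P[|||/orP[]] /eqP-> /=.
  + by rewrite -(addn0 (t * W)) ltv // ltnW.
  + by rewrite ltv ?(ltnW ltt) //; lia.
  + by rewrite ltv ?(ltnW ltt) //; lia.
  + by rewrite ltv ?(ltnW ltt) //; lia.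
  + by rewrite ltv //; lia.
- by move=> j a c _ ltj _; rewrite inE => /eqP->; apply: (ltv 0).
- by move=> j c ltj _; rewrite inE => /eqP->; apply: (ltv 0) => //; rewrite /W; lia.
- by move=> j c /andP[_ ltj] _; rewrite inE => /eqP->; apply: (ltv 0).
- by move=> j b ltj; rewrite !inE => /orP[] /eqP->; apply: (ltv 0) => //=; lia.
- by move=> c _; rewrite inE => /eqP-> /=; rewrite -(addn0 (T * W)) ltv.
Qed.

Lemma tableau_small g : g \in tableau -> forall z, z \in g -> z < n_vars * m.
Proof.
case/tableauP => s bad_s -> z /mapP[p ps ->]; have ltp := nogood_var bad_s ps.
apply: leq_trans (_ : p.1.+1 * m <= _); last by rewrite leq_mul2r ltp orbT.
by rewrite mulSn addnC ltn_add2r rk_lt.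
Qed.

Definition respects (a : nat -> C) := forall s, nogood s -> has (fun p => a p.1 != p.2) s.

Lemma atom_divmod v c : (v * m + rk c) %/ m = v /\ (v * m + rk c) %% m = rk c.
Proof.
have m0 : 0 < m by apply: leq_ltn_trans (rk_lt c).
by rewrite divnMDl // modnMDl divn_small ?addn0 ?modn_small ?rk_lt.
Qed.

Lemma respects_csp a : respects a -> csp_solution n_vars m tableau (fun v => rk (a v)).
Proof.
move=> resp; split=> [v _|g /tableauP[s /resp/hasP[p ps a_p] ->]]; first exact: rk_lt.
apply/hasP; exists (p.1 * m + rk p.2); first by apply/mapP; exists p.
have [-> ->] := atom_divmod p.1 p.2.
by apply: contra a_p => /eqP/val_inj/enum_rank_inj->.
Qed.

Lemma csp_respects A' : csp_solution n_vars m tableau A' ->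
  respects (fun v => nth (init_col None) (enum C) (A' v)).
Proof.
move=> [A'm A'P] s bad_s.
have /hasP[z /mapP[p ps ->]] : has (fun z => A' (z %/ m) != z %% m) (atoms s).
  by apply: A'P; apply/tableauP; exists s.
have [-> ->] := atom_divmod p.1 p.2 => ne_p.
apply/hasP; exists p => //; apply: contra ne_p => /eqP <-.
have lt_p := A'm _ (nogood_var bad_s ps).
rewrite /rk -[X in nth _ _ X]/(nat_of_ord (Ordinal lt_p)) -enum_val_nth.
by rewrite enum_valK.
Qed.

Lemma column_init z j : column (init M z) j = init_col (nth None (map Some z) j).
Proof.
congr (_, _); apply/ffunP => i; rewrite !ffunE /= nth_nil; case: eqP => _; last by rewrite nth_nil.
by elim: z j => [|c z IHz] [|j] //=; rewrite -IHz.
Qed.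

(** All blanks come after the letters, so deleting the blanks moves no letter. *)
Lemma nth_pmap_gapless (s : seq (option B)) :
  (forall k, nth None s k = None -> nth None s k.+1 = None) ->
  forall k, nth None (map Some (pmap id s)) k = nth None s k.
Proof.
elim: s => [|[b|] s IHs] gap k; first by rewrite nth_nil.
  by case: k => //= k; apply: IHs => i; apply: (gap i.+1).
have sN : forall i, nth None (None :: s) i = None by elim=> // i; apply: gap.
rewrite sN /= IHs => [|i _]; [exact: (sN k.+1) | exact: (sN i.+2)].
Qed.

(** Row 0 yields the certificate. By induction on time, the rows agree with the run on one column
    fewer at each step, which leaves column 0 at time [T], where acceptance is tested. *)
Theorem tableau_sound A' : csp_solution n_vars m tableau A' ->
  exists2 y : seq B, size y <= P &
    accepting (column (iter T (@step _ _ M) (init M (map inl x ++ map inr y))) 0).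
Proof.
move/csp_respects; set a := fun v => _ => resp.
have ltW : 0 < W by rewrite /W addn1.
have input j c : ohead (drop j x) = Some c -> j < W -> a j = init_col (Some (inl c)).
  move=> Ec ltj; apply/eqP/negPn/negP => bad.
  by have := resp _ (nogood_input Ec ltj bad); rewrite /= eqxx.
have cert j : size x <= j < size x + P -> a j \in init_col None :: cert_cols.
  by move=> ltj; apply/negPn/negP => bad; have := resp _ (nogood_cert ltj bad); rewrite /= eqxx.
have blank j : size x + P <= j < W -> a j = init_col None.
  move=> ltj; apply/eqP/negPn/negP => bad.
  by have := resp _ (nogood_blank ltj bad); rewrite /= eqxx.
have gap j b : j < W.-1 -> a j = init_col None -> a j.+1 != init_col (Some (inr b)).
  by move=> ltj Ej; have := resp _ (nogood_gap b ltj); rewrite /= Ej eqxx orbF.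
(* The letter guessed in cell [k] of the certificate, or [None] for a blank. *)
pose o k := [pick b | a (size x + k) == init_col (Some (inr b))].
have oP k : k < P -> a (size x + k) = init_col (omap inr (o k)).
  move=> ltk; rewrite /o; case: pickP => [b /eqP //|no].
  have := cert (size x + k); rewrite leq_addr ltn_add2l ltk inE => /(_ isT)/orP[/eqP //|].
  by case/mapP => b _ Eb; have := no b; rewrite Eb eqxx.
pose s := [seq o k | k <- iota 0 P].
have szs : size s = P by rewrite size_map size_iota.
have nth_s k : k < P -> nth None s k = o k.
  by move=> ltk; rewrite (nth_map 0) ?size_iota // nth_iota.
have gap_s k : nth None s k = None -> nth None s k.+1 = None.
  case: (ltnP k.+1 P) => ltk; last by rewrite (@nth_default _ _ s k.+1) ?szs.
  rewrite !nth_s ?(ltnW ltk) // => ok.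
  have Ek : a (size x + k) = init_col None by rewrite oP ?(ltnW ltk) // ok.
  have ltW' : size x + k < W.-1 by rewrite /W; lia.
  rewrite /o; case: pickP => // b Eb; have := gap _ b ltW' Ek.
  by rewrite -addnS Eb.
have nth_y := nth_pmap_gapless gap_s; set y := pmap id s in nth_y.
exists y; first by rewrite size_pmap (leq_trans (count_size _ _)) ?szs.
set z := map inl x ++ map inr y.
have row0 j : j < W -> a j = column (init M z) j.
  move=> ltj; rewrite column_init /z map_cat nth_cat !size_map -!map_comp.
  case: (ltnP j (size x)) => [ltx | lex].
    case Ex: x ltx => [|c0 x'] // ltx; rewrite -Ex in ltx *.
    by rewrite (nth_map c0) //; apply: input => //; rewrite (drop_nth c0).
  have -> : nth None [seq (Some \o inr) i | i <- y] (j - size x) = omap inr (nth None s (j - size x)).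
    rewrite -nth_y; elim: (y) (j - size x) => [|b y' IHy] [|i] //=; exact: IHy.
  case: (ltnP j (size x + P)) => [ltP | leP].
    have ltk : j - size x < P by lia.
    by rewrite nth_s // -oP // subnKC.
  rewrite nth_default ?szs; last by lia.
  by rewrite blank // leP.
have rows t : t <= T -> forall j, j + t < W ->
    a (t * W + j) = column (iter t (@step _ _ M) (init M z)) j.
  elim: t => [|t IHt] ltt j ltj; first by rewrite mul0n add0n row0 // -(addn0 j).
  have ltj' : j < W.-1 by lia.
  rewrite iterS column_step -!IHt ?(ltnW ltt) //; try lia.
  apply/eqP/negPn/negP => bad; rewrite addn0 in bad.
  by have := resp _ (nogood_step ltt ltj' bad); rewrite /= !eqxx.
rewrite -rows // ?addn0; last by rewrite /W; lia.
apply/negPn/negP => bad.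
by have := resp _ (nogood_accept bad); rewrite /= eqxx.
Qed.

Theorem tableau_complete (y : seq B) : size y <= P ->
  accepting (column (iter T (@step _ _ M) (init M (map inl x ++ map inr y))) 0) ->
  exists A', csp_solution n_vars m tableau A'.
Proof.
set z := _ ++ _ => szy acc.
pose a v := column (iter (v %/ W) (@step _ _ M) (init M z)) (v %% W).
have ltW : 0 < W by rewrite /W addn1.
have aE t j : j < W -> a (t * W + j) = column (iter t (@step _ _ M) (init M z)) j.
  by move=> ltj; rewrite /a divnMDl // divn_small // addn0 modnMDl modn_small.
have a0 t : a (t * W) = column (iter t (@step _ _ M) (init M z)) 0 by rewrite -(addn0 (t * W)) aE.
have aj j : j < W -> a j = init_col (nth None (map Some z) j).
  by move=> ltj; have := aE 0 j ltj; rewrite mul0n add0n => ->; rewrite column_init.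
exists (fun v => rk (a v)); apply: respects_csp => s bad; apply: contraT.
rewrite -all_predC; case: bad => {s}.
- move=> t j c0 cl c cr c' ltt ltj bad /=; rewrite !negbK andbT.
  case/and5P => /eqP E0 /eqP El /eqP Ec /eqP Er /eqP E'; move: bad.
  rewrite -E' -E0 -El -Ec -Er a0 !aE; try lia.
  by rewrite iterS column_step eqxx.
- move=> j b c Eb ltj bad /=; rewrite negbK andbT => /eqP E; move: bad; rewrite -E aj //.
  have ltx : j < size x by case: ltnP Eb => // le; rewrite drop_oversize.
  rewrite /z map_cat nth_cat !size_map ltx -map_comp (nth_map b) //.
  by move: Eb; rewrite (drop_nth b) // => -[->]; rewrite eqxx.
- move=> j c /andP[lex ltP] bad /=; rewrite negbK andbT => /eqP E; move: bad; rewrite -E aj; last first.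
    by rewrite /W; lia.
  rewrite /z map_cat nth_cat !size_map ltnNge lex /= -map_comp.
  case: (ltnP (j - size x) (size y)) => [lty | ley]; last first.
    by rewrite nth_default ?size_map // inE eqxx.
  case Ey: y lty => [|b y'] // lty; rewrite -Ey in lty *.
  rewrite (nth_map b) // in_cons => /negP[]; apply/orP; right; apply/mapP.
  by exists (nth b y (j - size x)); rewrite ?mem_enum.
- move=> j c /andP[leP ltj] bad /=; rewrite negbK andbT => /eqP E; move: bad; rewrite -E aj //.
  by rewrite nth_default ?eqxx // /z size_map size_cat !size_map; lia.
- move=> j b ltj /=; rewrite !negbK andbT => /andP[/eqP E1 /eqP E2].
  move: E1 E2; rewrite !aj; try lia.
  move=> E1 E2.
  have init_inj o o' : init_col o = init_col o' -> o = o'.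
    move/(congr1 (fun c : C => (c.2 ord0).2)); rewrite /= !ffunE eqxx /=.
    by case: o o' => [[u|u]|] [[v|v]|] //= [->].
  have lenj : size (map Some z) <= j.
    rewrite leqNgt; apply/negP => lt.
    have := init_inj _ _ E1; case Ez: z lt => [|c0 z'] // lt; rewrite -Ez in lt *.
    by rewrite (nth_map c0) // -(size_map Some).
  by have := init_inj _ _ E2; rewrite nth_default // (leq_trans lenj).
- by move=> c bad /=; rewrite negbK andbT a0 => /eqP E; move: bad; rewrite -E acc.
Qed.

End Tableau.

(** * Injectivity of the encodings *)

Definition nobit (r : seq symbol) : bool := if r is Bit _ :: _ then false else true.

(** The bits of an integer have no end marker, so a code can be split off only if no bit follows
    it. *)
Definition prefix_code (T : Type) (e : T -> seq symbol) := forall x y r r',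
  nobit r -> nobit r' -> e x ++ r = e y ++ r' -> x = y /\ r = r'.

(** Rules out a bit, which could prolong a preceding integer, and [RBracket], which would be taken
    for the end of a list. *)
Definition opening (T : Type) (e : T -> seq symbol) := forall x r,
  if e x ++ r is (Plus | Minus | LBracket) :: _ then true else false.

Lemma opening_int : opening enc_int.
Proof. by move=> z r; rewrite /enc_int; case: (0 <= z)%R. Qed.

Lemma opening_seq T (e : T -> seq symbol) : opening (enc_seq e).
Proof. by []. Qed.

Lemma prefix_code_int : prefix_code enc_int.
Proof.
move=> x y r r' nr nr'; rewrite /enc_int !nat_bitsE => -[Es Eb].
have {Eb} [Eb ->] : bits `|x| = bits `|y| /\ r = r'.
  elim: (bits `|x|) (bits `|y|) Eb => [|b s IHs] [|b' s'] /=.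
  - by [].
  - by move=> Er; rewrite Er in nr.
  - by move=> Er; rewrite -Er in nr'.
  - by case=> -> /IHs[->].
have {}Eb : `|x|%N = `|y|%N by rewrite -(bitsK `|x|) Eb bitsK.
by split=> //; move: Es Eb; case: x => m; case: y => n //= _; [move=> -> | case=> ->].
Qed.

Lemma prefix_code_seq T (e : T -> seq symbol) :
  prefix_code e -> opening e -> prefix_code (enc_seq e).
Proof.
move=> eP eO s t r r' _ _; rewrite /enc_seq /= => -[]; rewrite -!catA /=.
elim: s t => [|x s IHs] [|y t] /=.
- by case.
- by have := eO y (flatten (map e t) ++ RBracket :: r'); rewrite catA => + E; rewrite -E.
- by have := eO x (flatten (map e s) ++ RBracket :: r); rewrite catA => + E; rewrite E.
have nb u q : nobit (flatten (map e u) ++ RBracket :: q).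
  case: u => //= z u; have := eO z (flatten (map e u) ++ RBracket :: q).
  by rewrite catA; case: (_ ++ _) => // -[].
by rewrite -!catA => /(eP _ _ _ _ (nb _ _) (nb _ _))[-> /IHs[[->] ->]].
Qed.

Lemma prefix_code_map T U (f : T -> U) (e : U -> seq symbol) :
  injective f -> prefix_code e -> prefix_code (e \o f).
Proof. by move=> f_inj eP x y r r' nr nr' /(eP _ _ _ _ nr nr')[/f_inj]. Qed.

Lemma prefix_code_inj T (e : T -> seq symbol) x y : prefix_code e -> e x = e y -> x = y.
Proof. by move=> eP E; have [] := eP x y [::] [::] isT isT; rewrite ?cats0. Qed.

Lemma prefix_code_split T (e : T -> seq symbol) x y r r' : prefix_code e ->
  e x ++ r = e y ++ r' -> nobit r -> nobit r' -> x = y /\ r = r'.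
Proof. by move=> eP E nr nr'; apply: eP E. Qed.

Lemma prefix_code_domain : prefix_code enc_domain.
Proof. exact: prefix_code_seq prefix_code_int opening_int. Qed.

Lemma prefix_code_domains : prefix_code (enc_seq enc_domain).
Proof. exact: prefix_code_seq prefix_code_domain (@opening_seq _ _). Qed.

Lemma prefix_code_pdomain n : prefix_code (@enc_pdomain n).
Proof.
apply: prefix_code_map prefix_code_domain; apply: inj_map => i j /= [].
exact: val_inj.
Qed.

Lemma prefix_code_tuples h : prefix_code (enc_seq (@enc_tuple_domain h)).
Proof.
apply: prefix_code_seq => [|D r] //.
by apply: prefix_code_map prefix_code_domains; apply: val_inj.
Qed.

Lemma sort2_enc_inj : injective sort2_enc.
Proof.
case=> n U V [n' U' V']; rewrite /sort2_enc; cbn [s2_n s2_U s2_V] => E.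
have [EU EV] := prefix_code_split prefix_code_domains E isT isT.
have En : n = n' by rewrite -(size_tuple U) EU size_tuple.
subst n'; have {}EV := prefix_code_inj prefix_code_domains EV.
by rewrite (val_inj EU) (val_inj EV).
Qed.

Lemma sort3_enc_inj : injective sort3_enc.
Proof.
case=> n U V Q [n' U' V' Q']; rewrite /sort3_enc; cbn [s3_n s3_U s3_V s3_P] => E.
have [EU {}E] := prefix_code_split prefix_code_domains E isT isT.
have En : n = n' by rewrite -(size_tuple U) EU size_tuple.
subst n'; have [EV EQ] := prefix_code_split prefix_code_domains E isT isT.
have {}EQ := prefix_code_inj (prefix_code_seq (@prefix_code_pdomain n) (fun _ _ => isT)) EQ.
by rewrite (val_inj EU) (val_inj EV) (val_inj EQ).
Qed.

(** The fields are compared in the order of their dependencies: [h] and [keys] are written out,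
    whereas [n] is recovered as the length of the list for [U]. *)
Lemma keysorting_enc_inj : injective keysorting_enc.
Proof.
case=> n h k hk U V Q [n' h' k' hk' U' V' Q']; rewrite /keysorting_enc; cbn [ks_n ks_h ks_keys ks_U ks_V ks_P] => E.
have nbi z r : nobit (enc_int z ++ r) by have := opening_int z r; case: (_ ++ _) => // -[].
have [[Eh] {}E] := prefix_code_split prefix_code_int E (nbi _ _) (nbi _ _).
have [[Ek] {}E] := prefix_code_split prefix_code_int E isT isT.
subst h' k'; have [EU {}E] :=
  prefix_code_split (@prefix_code_tuples _) E isT isT.
have En : n = n' by rewrite -(size_tuple U) EU size_tuple.
subst n'; have [EV EQ] := prefix_code_split (@prefix_code_tuples _) E isT isT.
have {}EQ := prefix_code_inj (prefix_code_seq (@prefix_code_pdomain n) (fun _ _ => isT)) EQ.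
by rewrite (val_inj EU) (val_inj EV) (val_inj EQ) (bool_irrelevance hk hk').
Qed.

(** * Reductions between the three constraints *)

Definition tup T (d : T) n (s : seq T) : n.-tuple T := [tuple nth d s i | i < n].

Lemma tupE T (d : T) n s : size s = n -> tup d n s = s :> seq T.
Proof.
move=> <-; apply: (@eq_from_nth _ d) => [|i]; rewrite size_tuple // => lti.
by rewrite -[i]/(nat_of_ord (Ordinal lti)) -tnth_nth tnth_mktuple.
Qed.

Lemma tnth_tup T (d : T) n s (i : 'I_n) : tnth (tup d n s) i = nth d s i.
Proof. exact: tnth_mktuple. Qed.

Section PermSort.
Variable n : nat.
Implicit Types u v : n.-tuple int.

Lemma sort2_perm u v : sort2_holds u v ->
  exists p : n.-tuple 'I_n, uniq p /\ forall i, tnth u i = tnth v (tnth p i).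
Proof.
move=> Ev; have : perm_eq u v by rewrite Ev perm_sym perm_sort.
case/tuple_permP => s Es; exists [tuple s i | i < n]; split.
  by rewrite map_inj_uniq ?enum_uniq //; apply: perm_inj.
move=> i; rewrite tnth_mktuple.
by have /val_inj -> : u = [tuple tnth v (s i) | i < n] :> seq int by []; rewrite tnth_mktuple.
Qed.

Lemma perm_sort2 u v (p : n.-tuple 'I_n) : sorted <=%R v -> uniq p ->
  (forall i, tnth u i = tnth v (tnth p i)) -> sort2_holds u v.
Proof.
move=> sv up uv; have pE : perm_eq p (enum 'I_n).
  apply: uniq_perm; rewrite ?enum_uniq // => i; rewrite mem_enum inE.
  have sub : {subset p <= enum 'I_n} by move=> j _; rewrite mem_enum.
  by rewrite (uniq_min_size up sub) ?size_enum_ord ?size_tuple ?mem_enum.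
have Eu : u = map (tnth v) p :> seq int.
  apply: (@eq_from_nth _ 0%R) => [|i]; rewrite ?size_map !size_tuple // => lti.
  have := uv (Ordinal lti); rewrite !(tnth_nth 0%R) /= => ->.
  by rewrite (nth_map (Ordinal lti)) ?size_tuple // !(tnth_nth 0%R) (tnth_nth (Ordinal lti)).
have puv : perm_eq v u by rewrite -[tval v]map_tnth_enum Eu perm_map // perm_sym.
rewrite /sort2_holds -[LHS](sorted_sort le_trans sv).
by apply/perm_sortP => //; [exact: le_total | exact: le_trans | exact: le_anti].
Qed.

End PermSort.

(* keysorting, with stability required only if [st] holds. *)
Definition ks_support (st : bool) n h keys (U V : n.-tuple (h.-tuple domain))
    (Q : n.-tuple (seq 'I_n)) : Prop :=
  exists (u v : n.-tuple (h.-tuple int)) (p : n.-tuple 'I_n),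
    [/\ forall i, in_tuple_domain (tnth u i) (tnth U i),
        forall i, in_tuple_domain (tnth v i) (tnth V i),
        forall i, tnth p i \in tnth Q i
      & [/\ sorted (relpre (key keys) <=%O) v, uniq p,
            forall i, tnth u i = tnth v (tnth p i)
          & st -> forall i j : 'I_n, (i < j)%N ->
              key keys (tnth u i) = key keys (tnth u j) -> (tnth p i < tnth p j)%N]].

Lemma keysorting_support I :
  keysorting_has_support I <-> ks_support true (ks_keys I) (ks_U I) (ks_V I) (ks_P I).
Proof.
split=> -[u [v [p [Hu Hv Hp [srt up uv stab]]]]]; exists u, v, p; split=> //; split=> //.
exact: stab.
Qed.

Lemma sort3_full n (U V : n.-tuple domain) (Q : n.-tuple (seq 'I_n)) :
  (forall i j, j \in tnth Q i) ->
  sort3_has_support (Sort3Inst U V Q) <-> sort2_has_support (Sort2Inst U V).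
Proof.
move=> Qfull; split=> [[u [v [p [Hu Hv _ [uv _ _]]]]] | [u [v [Hu Hv uv]]]]; first by exists u, v.
by have [p [up Ep]] := sort2_perm uv; exists u, v, p; split=> // i; apply: Qfull.
Qed.

Definition singles T n (U : n.-tuple T) : n.-tuple (1.-tuple T) := map_tuple (fun D => [tuple D]) U.

Lemma tnth_singles T n (U : n.-tuple T) i k : tnth (tnth (singles U) i) k = tnth U i.
Proof. by rewrite tnth_map (ord1 k). Qed.

Lemma key1 (x y : 1.-tuple int) : (relpre (key 1) <=%O) x y = (thead x <= thead y)%R.
Proof.
case/tupleP: x => a x; case/tupleP: y => b y; rewrite /key /= !take0 !theadE.
by rewrite lexi_cons lexi0s implybT andbT.
Qed.

Lemma key1_inj (x y : 1.-tuple int) : key 1 x = key 1 y -> thead x = thead y.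
Proof.
by case/tupleP: x => a x; case/tupleP: y => b y; rewrite /key /= !theadE => -[].
Qed.

Lemma singles_thead n (u : n.-tuple (1.-tuple int)) : singles (map_tuple (@thead _ _) u) = u.
Proof.
apply: eq_from_tnth => i; rewrite !tnth_map; apply: eq_from_tnth => k.
by rewrite (ord1 k).
Qed.

Lemma singles_domain n (u : n.-tuple int) (U : n.-tuple domain) i :
  in_tuple_domain (tnth (singles u) i) (tnth (singles U) i) <-> tnth u i \in tnth U i.
Proof.
split=> [/(_ ord0) | uU k]; first by rewrite !tnth_singles.
by rewrite !tnth_singles.
Qed.

(** Lets a single checker, that of keysorting with optional stability, serve all three
    constraints. *)
Lemma sort3_ks n (U V : n.-tuple domain) (Q : n.-tuple (seq 'I_n)) :
  sort3_has_support (Sort3Inst U V Q) <-> ks_support false 1 (singles U) (singles V) Q.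
Proof.
have srtE (v : n.-tuple int) : sorted (relpre (key 1) <=%O) (singles v) = sorted <=%R v.
  by rewrite sorted_map; apply: eq_sorted => a b; rewrite /= -[LHS]/(relpre (key 1) <=%O _ _) key1.
split=> [[u [v [p [Hu Hv Hp [uv up Ep]]]]] | [u [v [p [Hu Hv Hp [srt up Ep _]]]]]].
  exists (singles u), (singles v), p; split=> //.
  - by move=> i; apply/singles_domain; apply: Hu.
  - by move=> i; apply/singles_domain; apply: Hv.
  split=> //; first by rewrite srtE uv sort_sorted //; apply: le_total.
  by move=> i; apply: eq_from_tnth => k; rewrite !tnth_singles.
rewrite -(singles_thead u) -(singles_thead v) in Hu Hv srt Ep.
exists (map_tuple (@thead _ _) u), (map_tuple (@thead _ _) v), p; split=> //.
- by move=> i; apply/singles_domain; apply: Hu.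
- by move=> i; apply/singles_domain; apply: Hv.
have uv i : tnth (map_tuple (@thead _ _) u) i = tnth (map_tuple (@thead _ _) v) (tnth p i).
  by rewrite -(tnth_singles _ i ord0) Ep tnth_singles.
by split=> //; apply: perm_sort2 up uv; rewrite -srtE.
Qed.

Lemma disjoint_singles n (U : n.-tuple domain) :
  disjoint_tuple_domains (singles U) <-> disjoint_domains U.
Proof.
split=> dU i j ne_ij x [xi xj]; last first.
  by apply: (dU i j ne_ij (tnth x ord0)); split; [have := xi ord0 | have := xj ord0];
    rewrite tnth_singles.
by apply: (dU i j ne_ij [tuple x]); split=> k; rewrite tnth_singles (ord1 k).
Qed.

(* On disjoint domains no two values are equal, so that stability is void. *)
Lemma ks_stable n (U V : n.-tuple domain) (Q : n.-tuple (seq 'I_n)) : disjoint_domains U ->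
  ks_support true 1 (singles U) (singles V) Q <-> ks_support false 1 (singles U) (singles V) Q.
Proof.
move=> dU; split=> -[u [v [p [Hu Hv Hp [srt up Ep stab]]]]]; exists u, v, p; split=> //; split=> //.
move=> _ i j lt_ij /key1_inj eq_ij; case: (dU i j _ (thead (tnth u i))).
  by apply: contraTneq lt_ij => ->; rewrite ltnn.
by split; [have := Hu i ord0 | rewrite eq_ij; have := Hu j ord0]; rewrite tnth_singles.
Qed.

(** * Hardness *)

Lemma ptime_enc_seq X Y {eX : enc X} {eY : enc Y} (e : X * Y -> seq symbol) (l : X -> seq Y) :
  ptime e -> ptime l -> ptime (fun x => enc_seq (fun y => e (x, y)) (l x)).
Proof. by move=> eP lP; rewrite /enc_seq; ptime. Qed.

Ltac ptime_more ::=
  lazymatch goal with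
  | |- ptime (fun x => enc_seq (@?f x) (@?l x)) =>
      apply (ptime_enc_seq (e := fun p => f p.1 p.2) (l := l))
  | |- ptime (fun x => enc_domain (@?f x)) =>
      apply (ptime_enc_seq (e := fun p => enc_int p.2) (l := f))
  | |- ptime (fun x => enc_int (@?f x)) => apply (ptime_enc_int (f := f))
  | |- ptime (fun x => Posz (@?f x)) => apply (ptime_Posz (f := f))
  end.

Lemma ptime_horner X {eX : enc X} (p : {poly nat}) (f : X -> nat) :
  ptime f -> ptime (fun x => p.[f x]%R).
Proof.
move=> fP; rewrite /horner; elim: (polyseq p) => [|a s IHs]; first exact: ptime_const.
apply: (ptime_eq (f := fun x => horner_rec s (f x) * f x + a)) => //.
by ptime.
Qed.

Lemma horner_mono (p : {poly nat}) m n : m <= n -> (p.[m]%R : nat) <= p.[n]%R.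
Proof.
move=> le_mn; rewrite /horner; elim: (polyseq p) => //= a s IHs.
by apply: leq_add => //; apply: leq_mul.
Qed.

Section PtimeReduction.
Context {X : Type} {eX : enc X}.

Lemma ptime_slots m (N : X -> nat) (G : X -> seq (seq nat)) :
  ptime N -> ptime G -> ptime (fun x => slots (N x) m (G x)).
Proof. by move=> NP GP; rewrite /slots /n_slots /n_zones; ptime. Qed.

Lemma ptime_sort_U m (N : X -> nat) (G : X -> seq (seq nat)) :
  ptime N -> ptime G -> ptime (fun x => sort_U (N x) m (G x)).
Proof.
move=> NP GP; have sP := ptime_slots m NP GP.
by rewrite /sort_U /zone_width /n_slots /n_zones; ptime.
Qed.

Lemma ptime_sort_V m (N : X -> nat) (G : X -> seq (seq nat)) :
  ptime N -> ptime G -> ptime (fun x => sort_V (N x) m (G x)).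
Proof.
move=> NP GP; have sP := ptime_slots m NP GP.
by rewrite /sort_V /zone_width /n_slots /n_zones; ptime.
Qed.

End PtimeReduction.

Lemma ptime_tableau (A B : finType) (M : machine (A + B)%type bool) (P T : seq A -> nat) :
  ptime P -> ptime T -> ptime (fun x => tableau M x (P x) (T x)).
Proof.
move=> PP TP; rewrite /tableau /width /bad_init; ptime.
(* The nogoods for an input cell depend on its letter only and form a finite table. *)
apply (ptime_fin (fun a => bad_cols [pred c | c != init_col M (Some (inl a))]) (g := snd)).
by ptime.
Qed.

(** * Instances whose values are natural numbers, and their codes *)

Section NatInstances.
Implicit Types U V : seq (seq nat).

Definition nat_support U V := exists u v : seq nat,
  [/\ all2 (fun a A => a \in A) u U, all2 (fun a A => a \in A) v V & v = sort leq u].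

Definition nat_disjoint U := forall i j a, i < size U -> j < size U ->
  a \in nth [::] U i -> a \in nth [::] U j -> i = j.

Definition nat_domains U (n : nat) : n.-tuple domain := tup [::] n (map (map Posz) U).

Definition full n : n.-tuple (seq 'I_n) := [tuple enum 'I_n | i < n].

Definition inst2 U V := Sort2Inst (nat_domains U (size U)) (nat_domains V (size U)).
Definition inst3 U V :=
  Sort3Inst (nat_domains U (size U)) (nat_domains V (size U)) (full (size U)).
Definition inst_ks U V := @KeysortingInst (size U) 1 1 isT
  (singles (nat_domains U (size U))) (singles (nat_domains V (size U))) (full (size U)).

Lemma nat_domainsE U n : size U = n -> nat_domains U n = map (map Posz) U :> seq domain.
Proof. by move=> szU; rewrite tupE ?size_map. Qed.

Lemma tnth_nat_domains U n (i : 'I_n) :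
  size U = n -> tnth (nat_domains U n) i = map Posz (nth [::] U i).
Proof. by move=> szU; rewrite tnth_tup (nth_map [::]) ?szU. Qed.

Lemma sort_Posz u : sort <=%R (map Posz u) = map Posz (sort leq u).
Proof. by rewrite sort_map. Qed.

Lemma inst2_support U V : size V = size U ->
  sort2_has_support (inst2 U V) <-> nat_support U V.
Proof.
move=> szV; split=> [[u [v [Hu Hv Evu]]] | [u [v [/all2_memP[szu uU] /all2_memP[szv vV] Ev]]]].
  have absK (w : (size U).-tuple int) W : size W = size U ->
      (forall i, tnth w i \in tnth (nat_domains W (size U)) i) ->
      w = map Posz (map absz w) :> seq int /\ all2 (fun a A => a \in A) (map absz w) W.
    move=> szW wW; have wE i : i < size U -> exists2 a, a \in nth [::] W i & nth 0%R w i = Posz a.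
      move=> lti; have := wW (Ordinal lti); rewrite tnth_nat_domains // (tnth_nth 0%R).
      by case/mapP => a; exists a.
    split.
      apply: (@eq_from_nth _ 0%R) => [|i]; rewrite -?map_comp ?size_map // size_tuple => lti.
      by rewrite (nth_map 0%R) ?size_tuple //=; have [a _ ->] := wE _ lti.
    apply/all2_memP; rewrite size_map size_tuple szW; split=> // i lti.
    by rewrite (nth_map 0%R) ?size_tuple //; have [a aW ->] := wE _ lti.
  have [Eu uU] := absK u U erefl Hu; have [Ev vV] := absK v V szV Hv.
  exists (map absz u), (map absz v); split=> //.
  have : map Posz (map absz v) = map Posz (sort leq (map absz u)) by rewrite -sort_Posz -Ev -Eu.
  by apply: inj_map => a b [].
have nth_Posz (w : seq nat) i : nth 0%R (map Posz w) i = Posz (nth 0 w i).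
  by elim: w i => [|a w IHw] [|i] //=; apply: IHw.
exists (tup 0%R (size U) (map Posz u)), (tup 0%R (size U) (map Posz v)); split.
- by move=> i; rewrite tnth_nat_domains // tnth_tup nth_Posz map_f // uU.
- by move=> i; rewrite tnth_nat_domains // tnth_tup nth_Posz map_f // vV // szV.
by rewrite /sort2_holds !tupE ?size_map ?szv // Ev sort_Posz.
Qed.

Lemma inst_disjoint U : nat_disjoint U -> disjoint_domains (nat_domains U (size U)).
Proof.
move=> dU i j ne_ij x; rewrite !tnth_nat_domains // => -[/mapP[a ai ->] /mapP[b bj [Eab]]].
rewrite -Eab in bj; case/eqP: ne_ij; apply: val_inj; exact: dU (ltn_ord i) (ltn_ord j) ai bj.
Qed.

Lemma mem_full n i j : j \in tnth (full n) i.
Proof. by rewrite tnth_mktuple mem_enum. Qed.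

Lemma inst3_support U V : size V = size U ->
  sort3_has_support (inst3 U V) <-> nat_support U V.
Proof.
move=> szV; apply: iff_trans (inst2_support szV); apply: sort3_full; exact: mem_full.
Qed.

Lemma inst_ks_support U V : size V = size U -> nat_disjoint U ->
  keysorting_has_support (inst_ks U V) <-> nat_support U V.
Proof.
move=> szV dU; apply: iff_trans (inst3_support szV); apply: iff_trans (keysorting_support _) _.
apply: iff_trans (ks_stable _ _ (inst_disjoint dU)) _.
exact: iff_sym (sort3_ks _ _ _).
Qed.

(** Codes computed from plain lists: the types of the fields of an instance depend on its size,
    whereas [ptime] is about functions between fixed types. *)
Definition enc_nats (D : seq nat) : seq symbol := enc_seq (fun a => enc_int (Posz a)) D.
Definition enc_singles (D : seq nat) : seq symbol := enc_seq enc_nats [:: D].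
Definition enc_full (n : nat) : seq symbol := enc_seq enc_nats (nseq n [seq j.+1 | j <- iota 0 n]).

Lemma enc_seq_map T T' (f : T -> T') (e : T' -> seq symbol) s :
  enc_seq e (map f s) = enc_seq (e \o f) s.
Proof. by rewrite /enc_seq -map_comp. Qed.

Lemma eq_enc_seq T (e e' : T -> seq symbol) : e =1 e' -> enc_seq e =1 enc_seq e'.
Proof. by move=> ee' s; rewrite /enc_seq (eq_map ee'). Qed.

Lemma enc_nat_domains U n : size U = n ->
  enc_seq enc_domain (nat_domains U n) = enc_seq enc_nats U.
Proof.
move=> szU; rewrite nat_domainsE // enc_seq_map; apply: eq_enc_seq => D.
by rewrite /= /enc_domain enc_seq_map.
Qed.

Lemma enc_nat_singles U n : size U = n ->
  enc_seq (@enc_tuple_domain 1) (singles (nat_domains U n)) = enc_seq enc_singles U.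
Proof.
move=> szU; rewrite /singles /= enc_seq_map nat_domainsE // enc_seq_map; apply: eq_enc_seq => D.
have E : enc_domain (map Posz D) = enc_nats D by rewrite /enc_domain enc_seq_map.
by rewrite -[LHS]/(LBracket :: (enc_domain (map Posz D) ++ [::]) ++ [:: RBracket]) E.
Qed.

Lemma enc_fullE n : enc_seq (@enc_pdomain n) (full n) = enc_full n.
Proof.
rewrite (_ : full n = nseq n (enum 'I_n) :> seq (seq 'I_n)); last first.
  apply: (@eq_from_nth _ [::]) => [|i]; rewrite size_tuple ?size_nseq // => lti.
  by rewrite nth_nseq lti -[i]/(nat_of_ord (Ordinal lti)) -tnth_nth tnth_mktuple.
rewrite /enc_full /enc_seq !map_nseq; congr (_ :: flatten (nseq _ _) ++ _).
rewrite /enc_pdomain /enc_domain -val_enum_ord -map_comp enc_seq_map /enc_nats enc_seq_map.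
exact: eq_enc_seq.
Qed.

Lemma inst2_enc U V : size V = size U ->
  sort2_enc (inst2 U V) = enc_seq enc_nats U ++ enc_seq enc_nats V.
Proof. by move=> szV; rewrite -(enc_nat_domains (erefl (size U))) -(enc_nat_domains szV). Qed.

Lemma inst3_enc U V : size V = size U ->
  sort3_enc (inst3 U V) = enc_seq enc_nats U ++ enc_seq enc_nats V ++ enc_full (size U).
Proof.
by move=> szV; rewrite -(enc_nat_domains (erefl (size U))) -(enc_nat_domains szV) -enc_fullE.
Qed.

Lemma inst_ks_enc U V : size V = size U ->
  keysorting_enc (inst_ks U V) = enc_int (Posz 1) ++ enc_int (Posz 1) ++
    enc_seq enc_singles U ++ enc_seq enc_singles V ++ enc_full (size U).
Proof.
by move=> szV; rewrite -(enc_nat_singles (erefl (size U))) -(enc_nat_singles szV) -enc_fullE.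
Qed.

End NatInstances.

(** [T] is the running time for the longest admissible certificate. Halted configurations are
    fixpoints, so runs on shorter ones can be prolonged to [T], and a tableau of one height covers
    all certificates. *)
Theorem in_NP_nat_support (A : finType) (L : language A) : in_NP L ->
  exists U V : seq A -> seq (seq nat), [/\ ptime U, ptime V,
    forall x, size (V x) = size (U x) /\ nat_disjoint (U x)
  & forall x, L x <-> nat_support (U x) (V x)].
Proof.
case=> B [K [p [[f [M [q Mf]] Kf] LK]]].
pose P (x : seq A) : nat := p.[size x]%R.
pose T (x : seq A) : nat := q.[size x + P x]%R.
pose N x := n_vars x (P x) (T x); pose G x := tableau M x (P x) (T x).
have PP : ptime P by apply: (ptime_horner p (f := fun x => size x)); ptime.
have TP : ptime T by apply: (ptime_horner q (f := fun x => size x + P x)); ptime.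
have NP : ptime N by rewrite /N /n_vars /width; ptime.
have GP : ptime G by exact: ptime_tableau.
have Gsm x := @tableau_small _ _ M x (P x) (T x).
exists (fun x => sort_U (N x) (n_cols M) (G x)), (fun x => sort_V (N x) (n_cols M) (G x)).
split; [exact: ptime_sort_U | exact: ptime_sort_V | | ].
  move=> x; rewrite size_U size_V; split=> // i j a; exact: sort_U_disjoint (Gsm x) i j a.
move=> x; apply: iff_trans (LK x) _.
have run (y : seq B) : size y <= P x ->
    K (map inl x ++ map inr y) <->
    accepting (column (iter (T x) (@step _ _ M) (init M (map inl x ++ map inr y))) 0).
  move=> ley; set z := _ ++ _; apply: iff_trans (Kf z) _.
  have [halt out] := Mf z; set t := (q.[_]%R : nat) in halt out.
  have le_t : t <= T x.
    by apply: horner_mono; rewrite /z size_cat !size_map leq_add2l.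
  have stop k c : halted c -> iter k (@step _ _ M) c = c.
    by move=> hc; elim: k => //= k ->; move: hc; rewrite /halted /step; case: table.
  rewrite -(subnK le_t) iterD stop // /accepting /column ffunE /=.
  move: out; rewrite /output; case: (iter _ _ _).2 => [_ [|[[[|b]|]|] s]] //= [<-].
  by case: b.
split=> [[y [ley Ky]] | [u [v [uU vV uv]]]].
  have [A' solA'] := tableau_complete ley (iffLR (run y ley) Ky).
  have [uU vV uv] := solution_support (Gsm x) solA'.
  by exists (sol_u (N x) (n_cols M) (G x) A'), (sort leq (sol_u (N x) (n_cols M) (G x) A')).
have [A' solA'] := support_solution (Gsm x) (And3 uU vV uv).
by have [y ley acc] := tableau_sound solA'; exists y; split=> //; apply/(run y ley).
Qed.

(** Injectivity of [enc] is what makes a word in the language tell about the intended instance,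
    since [problem] only asks for some instance with that code. *)
Lemma NP_hard_of_nat (I : Type) (enc : I -> seq symbol) (yes : I -> Prop)
    (inst : seq (seq nat) -> seq (seq nat) -> I) (e : seq (seq nat) * seq (seq nat) -> seq symbol) :
  injective enc -> ptime e ->
  (forall U V, size V = size U -> nat_disjoint U ->
    enc (inst U V) = e (U, V) /\ (yes (inst U V) <-> nat_support U V)) ->
  NP_hard (problem enc yes).
Proof.
move=> enc_inj eP instP A L /in_NP_nat_support[U [V [UP VP sz_dis LE]]].
exists (fun x => e (U x, V x)); first by apply: ptime_polytime; ptime.
move=> x; have [szV dU] := sz_dis x; have [<- yesE] := instP _ _ szV dU.
apply: iff_trans (LE x) _; apply: iff_trans (iff_sym yesE) _.
by split=> [y | [I' /enc_inj <-]] //; exists (inst (U x) (V x)).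
Qed.

Lemma ptime_enc_nats X {eX : enc X} (f : X -> seq nat) : ptime f -> ptime (fun x => enc_nats (f x)).
Proof. by move=> fP; rewrite /enc_nats; ptime. Qed.

Lemma ptime_enc_singles X {eX : enc X} (f : X -> seq nat) :
  ptime f -> ptime (fun x => enc_singles (f x)).
Proof. by move=> fP; rewrite /enc_singles; ptime; apply: ptime_enc_nats; ptime. Qed.

Lemma ptime_enc_full X {eX : enc X} (f : X -> nat) : ptime f -> ptime (fun x => enc_full (f x)).
Proof. by move=> fP; rewrite /enc_full; ptime; apply: ptime_enc_nats; ptime. Qed.

Theorem sort2_hard : NP_hard (problem sort2_enc sort2_has_support) /\
  NP_hard (problem sort2_enc (fun I => disjoint_domains (s2_U I) /\ sort2_has_support I)).
Proof.
pose e p := enc_seq enc_nats p.1 ++ enc_seq enc_nats p.2.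
have eP : ptime e by rewrite /e; ptime; apply: ptime_enc_nats; ptime.
split; apply: (NP_hard_of_nat (inst := inst2) sort2_enc_inj eP) => U V szV dU;
  (split; first exact: inst2_enc); first exact: inst2_support.
by apply: iff_trans (inst2_support szV); split=> [[]|] //; split=> //; exact: inst_disjoint.
Qed.

Theorem sort3_hard : NP_hard (problem sort3_enc sort3_has_support) /\
  NP_hard (problem sort3_enc (fun I => disjoint_domains (s3_U I) /\ sort3_has_support I)).
Proof.
pose e p := enc_seq enc_nats p.1 ++ enc_seq enc_nats p.2 ++ enc_full (size p.1).
have eP : ptime e.
  by rewrite /e; ptime; first [apply: ptime_enc_nats | apply: ptime_enc_full]; ptime.
split; apply: (NP_hard_of_nat (inst := inst3) sort3_enc_inj eP) => U V szV dU;
  (split; first exact: inst3_enc); first exact: inst3_support.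
by apply: iff_trans (inst3_support szV); split=> [[]|] //; split=> //; exact: inst_disjoint.
Qed.

Theorem keysorting_hard : NP_hard (problem keysorting_enc keysorting_has_support) /\
  NP_hard (problem keysorting_enc (fun I => disjoint_tuple_domains (ks_U I) /\
    keysorting_has_support I)).
Proof.
pose e p := enc_int (Posz 1) ++ enc_int (Posz 1) ++ enc_seq enc_singles p.1 ++
  enc_seq enc_singles p.2 ++ enc_full (size p.1).
have eP : ptime e.
  by rewrite /e; ptime; first [apply: ptime_enc_singles | apply: ptime_enc_full]; ptime.
split; apply: (NP_hard_of_nat (inst := inst_ks) keysorting_enc_inj eP) => U V szV dU;
  (split; first exact: inst_ks_enc); first exact: inst_ks_support.
apply: iff_trans (inst_ks_support szV dU); split=> [[]|] //; split=> //.
exact/disjoint_singles/inst_disjoint.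
Qed.

(** * Certificates *)

(** Two letters suffice for numbers, and each level of lists or pairs adds a separator. The
    certificates below stay within 15 letters. *)
Notation letter := 'I_32.

Section Split.
Variable D : finType.
Implicit Types (s : D) (y : seq D).

(** The separator ends a block, and nothing after the last separator makes no block; thus the empty
    word is the code of the empty list. *)
Definition split_at s y : seq (seq D) :=
  foldr (fun b acc => if b == s then [::] :: acc else (b :: head [::] acc) :: behead acc) [::] y.

Lemma split_at_cat s y r : s \notin y -> split_at s (y ++ s :: r) = y :: split_at s r.
Proof.
elim: y => [_ | b y IHy]; first by rewrite /= eqxx.
by rewrite in_cons negb_or eq_sym => /andP[/negPf ne_b /IHy]; rewrite /= ne_b => ->.
Qed.

Lemma split_at_last s y : s \notin y -> split_at s y = if nilp y then [::] else [:: y].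
Proof.
elim: y => // b y IHy; rewrite in_cons negb_or eq_sym => /andP[/negPf ne_b /IHy].
by rewrite /= ne_b => ->; case: y {IHy}.
Qed.

Lemma ptime_split_at X {eX : enc X} s (f : X -> seq D) :
  ptime f -> ptime (fun x => split_at s (f x)).
Proof.
move=> fP; pose g (q : X * D * seq (seq D)) :=
  if q.1.2 == s then [::] :: q.2 else (q.1.2 :: head [::] q.2) :: behead q.2.
apply: (ptime_foldr (g := g)); [by rewrite /g; ptime | by ptime | by [] | ].
exists (fun p => sz p.2 + 3).
  by apply: polyb_add (polyb_const _); apply: ptime_sz; ptime.
move=> x b c; rewrite /g /=; case: eqP => _; first by rewrite sz_cons sz_nil; lia.
by case: c => [|h c] /=; rewrite 2!sz_cons ?[sz (h :: c)]sz_cons ?sz_nil; lia.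
Qed.

End Split.

(* Elements of [T] can be read off words over the first [l] letters. Higher
   letters serve as separators. *)
Definition coded (l : nat) (T : Type) {eT : enc T} := exists2 d : seq letter -> T, ptime d &
  forall x : T, exists y, [/\ d y = x, size y <= sz x & all (fun a : letter => a < l) y].
Arguments coded l T {eT}.

Lemma coded_le l l' T {eT : enc T} : l <= l' -> coded l T -> coded l' T.
Proof.
move=> le_l [d dP cd]; exists d => // x; have [y [dy szy ly]] := cd x; exists y; split=> //.
by apply: sub_all ly => a /leq_trans->.
Qed.

Lemma notin_small l (y : seq letter) :
  l < 32 -> all (fun a : letter => a < l) y -> inord l \notin y.
Proof. by move=> ltl /allP ly; apply/negP => /ly; rewrite inordK // ltnn. Qed.

Lemma coded_nat : coded 2 nat.
Proof.
exists size; first by apply: (ptime_size (f := fun x => x)); ptime.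
move=> n; exists (nseq n (inord 0)); rewrite size_nseq sz_nat; split=> //; first by lia.
by apply/allP => a /nseqP[-> _]; rewrite inordK.
Qed.

Lemma coded_int : coded 2 int.
Proof.
exists (fun y => int_of_word [seq a == inord 1 | a <- y]).
  apply: ptime_int_of_word.
  apply: (ptime_map (f := fun p : seq letter * letter => p.2 == inord 1)); last by ptime.
  by apply (ptime_fin (fun a : letter => a == inord 1) (g := snd)); ptime.
move=> z; exists [seq inord (nat_of_bool b) | b <- int_word z]; split.
- rewrite -map_comp -[RHS]int_wordK; congr int_of_word; rewrite -[RHS]map_id.
  apply: eq_map => b /=; have ltb : (b : nat) < 32 by case: b.
  by rewrite -val_eqE /= !inordK //; case: b {ltb}.
- by rewrite size_map; have := sz_size (eX := enc_bool) (int_word z); apply: ltnW.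
by apply/allP => a /mapP[b _ ->]; rewrite inordK; case: b.
Qed.

Lemma coded_seq l T {eT : enc T} : l < 32 -> coded l T -> coded l.+1 (seq T).
Proof.
move=> ltl [d dP cd]; exists (fun y => [seq d z | z <- split_at (inord l) y]).
  by ptime; apply: ptime_split_at; ptime.
elim=> [|x s [ys [ds szs ls]]]; first by exists [::].
have [y [dy szy ly]] := cd x; exists (y ++ inord l :: ys); split.
- by rewrite split_at_cat ?(notin_small ltl) //= dy ds.
- by rewrite size_cat /= sz_cons addnS ltnS leq_add.
rewrite all_cat /= ls inordK // ltnSn !andbT.
by apply: sub_all ly => a /ltnW.
Qed.

Lemma coded_pair l T U {eT : enc T} {eU : enc U} :
  l < 32 -> coded l T -> coded l U -> coded l.+1 (T * U)%type.
Proof.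
move=> ltl [d dP cd] [d' dP' cd'].
exists (fun y => (d (nth [::] (split_at (inord l) y) 0), d' (nth [::] (split_at (inord l) y) 1))).
  have sP := ptime_split_at (inord l) (ptime_id (X := seq letter)).
  by ptime.
case=> x x'; have [y [dy szy ly]] := cd x; have [y' [dy' szy' ly']] := cd' x'.
exists (y ++ inord l :: y'); split.
- rewrite split_at_cat ?(notin_small ltl) //= dy split_at_last ?(notin_small ltl) //.
  (* An empty second word yields no block; the default value of [nth] then stands for it. *)
  by case: y' dy' {szy' ly'} => [|a y'] /= ->.
- by rewrite size_cat /= sz_pair addnS ltnS leq_add.
rewrite all_cat /= inordK // ltnSn /=.
by apply/andP; split; [apply: sub_all ly | apply: sub_all ly'] => a /ltnW.
Qed.

(** The verifier sorts the letters of its input by their origin and decodes the certificate. The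
    decoder is total and [R] is sound for every value, so malformed certificates are harmless. *)
Theorem in_NP_intro (A : finType) (L : language A) l T {eT : enc T} (R : seq A * T -> bool)
    (g : seq A -> nat) :
  coded l T -> ptime R -> polyb g -> (forall x c, R (x, c) -> L x) ->
  (forall x, L x -> exists2 c, R (x, c) & sz c <= g x) -> in_NP L.
Proof.
move=> [d dP cd] RP /polyb_horner[p gp] RL LR.
pose lft (z : seq (A + letter)) := flatten [seq (if a is inl b then [:: b] else [::]) | a <- z].
pose rgt (z : seq (A + letter)) := flatten [seq (if a is inr b then [:: b] else [::]) | a <- z].
have lftE x y : lft (map inl x ++ map inr y) = x.
  rewrite /lft map_cat flatten_cat -!map_comp (eq_map (g := fun a => [:: a])) // flatten_seq1.
  by rewrite -[RHS]cats0; congr (_ ++ _); elim: y.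
have rgtE x y : rgt (map inl x ++ map inr y) = y.
  rewrite /rgt map_cat flatten_cat -!map_comp.
  rewrite [X in _ ++ X](_ : _ = y); last first.
    by rewrite (eq_map (g := fun a => [:: a])) // flatten_seq1.
  by rewrite -[RHS]cat0s; congr (_ ++ _); elim: x.
have lftP : ptime lft.
  rewrite /lft; ptime.
  by apply (ptime_fin (fun a : A + letter => if a is inl b then [:: b] else [::]) (g := snd)); ptime.
have rgtP : ptime rgt.
  rewrite /rgt; ptime.
  by apply (ptime_fin (fun a : A + letter => if a is inr b then [:: b] else [::]) (g := snd)); ptime.
exists letter, (fun z => R (lft z, d (rgt z))), p; split.
  exists (fun z => R (lft z, d (rgt z))) => //.
  apply: ptime_polytime.
  apply: (ptime_eq (f := fun z => if R (lft z, d (rgt z)) then [:: true] else [:: false])).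
    by move=> z; case: (R _).
  by ptime; apply: (ptime_comp RP); ptime; apply: (ptime_comp dP).
move=> x; split=> [/LR[c Rc szc] | [y [_]]]; last by rewrite lftE => /RL.
have [y [dy szy _]] := cd c; exists y; rewrite lftE rgtE dy; split=> //.
exact: leq_trans szy (leq_trans szc (gp x)).
Qed.

(** * Checking a support *)

Definition lex_le (k : nat) (s t : seq int) : bool :=
  foldr (fun l c => (nth 0 s l <= nth 0 t l)%R && ((nth 0 t l <= nth 0 s l)%R ==> c)) true (iota 0 k).

Lemma lex_leE k (s t : seq int) : k <= size s -> k <= size t ->
  ((take k s : seqlexi int) <= (take k t : seqlexi int))%O = lex_le k s t.
Proof.
rewrite /lex_le; suff gen m : m + k <= size s -> m + k <= size t ->
    ((take k (drop m s) : seqlexi int) <= (take k (drop m t) : seqlexi int))%O =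
    foldr (fun l c => (nth 0 s l <= nth 0 t l)%R && ((nth 0 t l <= nth 0 s l)%R ==> c)) true
      (iota m k).
  by have := gen 0; rewrite !drop0.
elim: k m => [|k IHk] m; first by rewrite !take0.
rewrite addnS -addSn => lts ltt; rewrite (drop_nth 0%R) ?(leq_trans _ lts) ?ltnS ?leq_addr //.
rewrite [drop m t](drop_nth 0%R) ?(leq_trans _ ltt) ?ltnS ?leq_addr //=.
by rewrite lexi_cons IHk.
Qed.

Lemma all_iotaP n (P : pred nat) : reflect (forall i : 'I_n, P i) (all P (iota 0 n)).
Proof.
apply: (iffP allP) => [allPn i | allPn i]; first by apply: allPn; rewrite mem_iota /=.
by rewrite mem_iota /= add0n => lti; exact: (allPn (Ordinal lti)).
Qed.

Section Core.
Variables (n h keys : nat) (st dj : bool).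
Variables (U V : seq (seq (seq int))) (Q : seq (seq nat)) (u v : seq (seq int)) (p : seq nat).

(** Stated with indices and Boolean tests on plain lists, the form that the tactic [ptime] can
    decompose. *)
Definition in_domain (x : seq int) (D : seq (seq int)) : bool :=
  all (fun k => has (fun a => a == nth 0%R x k) (nth [::] D k)) (iota 0 h).

Definition disjoint_domain (D E : seq (seq int)) : bool :=
  has (fun k => all (fun a => ~~ has (fun b => b == a) (nth [::] E k)) (nth [::] D k)) (iota 0 h).

(* [st] demands stability, [dj] that the domains of [U] be pairwise disjoint. *)
Definition core : bool :=
  [&& all (fun i => in_domain (nth [::] u i) (nth [::] U i)) (iota 0 n),
      all (fun i => in_domain (nth [::] v i) (nth [::] V i)) (iota 0 n),
      all (fun i => (nth 0 p i < n) && has (fun j => j == nth 0 p i) (nth [::] Q i)) (iota 0 n),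
      all (fun i => (i.+1 < n) ==> lex_le keys (nth [::] v i) (nth [::] v i.+1)) (iota 0 n),
      all (fun i => all (fun j => (nth 0 p i == nth 0 p j) ==> (i == j)) (iota 0 n)) (iota 0 n),
      all (fun i => all (fun k =>
        nth 0%R (nth [::] u i) k == nth 0%R (nth [::] v (nth 0 p i)) k) (iota 0 h)) (iota 0 n),
      st ==> all (fun i => all (fun j => ((i < j) &&
        all (fun l => nth 0%R (nth [::] u i) l == nth 0%R (nth [::] u j) l) (iota 0 keys)) ==>
        (nth 0 p i < nth 0 p j)) (iota 0 n)) (iota 0 n)
    & dj ==> all (fun i => all (fun j =>
        (i == j) || disjoint_domain (nth [::] U i) (nth [::] U j)) (iota 0 n)) (iota 0 n)].

Variables (Us Vs : n.-tuple (h.-tuple domain)) (Qs : n.-tuple (seq 'I_n)).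
Variables (us vs : n.-tuple (h.-tuple int)) (ps : n.-tuple 'I_n).
Hypothesis le_keys : keys <= h.
Hypothesis UE : forall i, tnth Us i = nth [::] U i :> seq domain.
Hypothesis VE : forall i, tnth Vs i = nth [::] V i :> seq domain.
Hypothesis QE : forall i, map val (tnth Qs i) = nth [::] Q i.
Hypothesis uE : forall i, tnth us i = nth [::] u i :> seq int.
Hypothesis vE : forall i, tnth vs i = nth [::] v i :> seq int.
Hypothesis pE : forall i, tnth ps i = nth 0 p i :> nat.

Lemma in_domainP (x : h.-tuple int) (D : h.-tuple domain) :
  reflect (in_tuple_domain x D) (in_domain x D).
Proof.
apply: (iffP (all_iotaP _ _)) => [xD k | xD k].
  by have /hasP[a aD /eqP Ea] := xD k; rewrite (tnth_nth 0%R) (tnth_nth [::] D) -Ea.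
apply/hasP; exists (tnth x k); last by rewrite -tnth_nth.
by rewrite -(tnth_nth [::] D).
Qed.

(** If the domains meet in every component, choosing a common value in each gives a common tuple; so
    disjointness of products shows in one component and can be tested. *)
Lemma disjoint_domainP (D E : h.-tuple domain) x y :
  in_tuple_domain x D -> in_tuple_domain y E ->
  reflect (forall z, ~ (in_tuple_domain z D /\ in_tuple_domain z E)) (disjoint_domain D E).
Proof.
move=> xD yE; apply: (iffP hasP) => [[k] | noDE].
  rewrite mem_iota add0n => /andP[_ ltk] /allP nDE z [zD zE].
  have := zD (Ordinal ltk); rewrite (tnth_nth [::] D) /= => /nDE/hasP[].
  exists (tnth z (Ordinal ltk)) => //.
  by have := zE (Ordinal ltk); rewrite (tnth_nth [::] E).
pose meet k := [seq a <- tnth D k | a \in tnth E k].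
case: (pickP [pred k | meet k == [::]]) => [k /= /eqP mk|nomeet].
  exists (k : nat); first by rewrite mem_iota /=.
  apply/allP => a aD; apply/hasP => -[b bE /eqP Eb]; move: bE; rewrite Eb => aE.
  have : a \in meet k by rewrite mem_filter !(tnth_nth [::]) aE.
  by rewrite mk.
case: (noDE [tuple head 0%R (meet k) | k < h]).
have mz k : head 0%R (meet k) \in meet k.
  by have := nomeet k => /=; case: (meet k) => //= a s _; rewrite mem_head.
by split=> k; rewrite tnth_mktuple; have := mz k; rewrite mem_filter => /andP[].
Qed.

Lemma coreP : core <-> (dj -> disjoint_tuple_domains Us) /\
  [/\ forall i, in_tuple_domain (tnth us i) (tnth Us i),
      forall i, in_tuple_domain (tnth vs i) (tnth Vs i),
      forall i, tnth ps i \in tnth Qs i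
    & [/\ sorted (relpre (key keys) <=%O) vs, uniq ps,
          forall i, tnth us i = tnth vs (tnth ps i)
        & st -> forall i j : 'I_n, i < j ->
            key keys (tnth us i) = key keys (tnth us j) -> tnth ps i < tnth ps j]].
Proof.
have uuE i k : tnth (tnth us i) k = nth 0%R (nth [::] u i) k by rewrite (tnth_nth 0%R) uE.
have vvE i k : tnth (tnth vs i) k = nth 0%R (nth [::] v i) k by rewrite (tnth_nth 0%R) vE.
have c1 : reflect (forall i, in_tuple_domain (tnth us i) (tnth Us i))
    (all (fun i => in_domain (nth [::] u i) (nth [::] U i)) (iota 0 n)).
  apply: (iffP (all_iotaP _ _)) => uU i; last by rewrite -uE -UE; apply/in_domainP.
  by apply/in_domainP; rewrite uE UE.
have c2 : reflect (forall i, in_tuple_domain (tnth vs i) (tnth Vs i))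
    (all (fun i => in_domain (nth [::] v i) (nth [::] V i)) (iota 0 n)).
  apply: (iffP (all_iotaP _ _)) => vV i; last by rewrite -vE -VE; apply/in_domainP.
  by apply/in_domainP; rewrite vE VE.
have c3 : reflect (forall i, tnth ps i \in tnth Qs i)
    (all (fun i => (nth 0 p i < n) && has (fun j => j == nth 0 p i) (nth [::] Q i)) (iota 0 n)).
  apply: (iffP (all_iotaP _ _)) => pQ i.
    have /andP[_ /hasP[j]] := pQ i; rewrite -QE -pE => /mapP[j' j'Q ->] /eqP/val_inj <-.
    exact: j'Q.
  rewrite -pE ltn_ord -QE; apply/hasP; exists (nat_of_ord (tnth ps i)) => //.
  exact: map_f (pQ i).
have c4 : reflect (sorted (relpre (key keys) <=%O) vs)
    (all (fun i => (i.+1 < n) ==> lex_le keys (nth [::] v i) (nth [::] v i.+1)) (iota 0 n)).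
  have szv i : i < n -> keys <= size (nth [::] v i).
    by move=> lti; rewrite -[i]/(nat_of_ord (Ordinal lti)) -vE size_tuple.
  have vsE x0 i : i < n -> nth x0 vs i = nth [::] v i :> seq int.
    by move=> lti; rewrite -[i in LHS]/(nat_of_ord (Ordinal lti)) -tnth_nth vE.
  (* For [n > 0] an element of [vs] serves as the default that [sortedP] asks for. *)
  have [n0|n_gt0] := posnP n.
    have -> : iota 0 n = [::] by rewrite n0.
    have -> : vs = [::] :> seq _ by apply: size0nil; rewrite size_tuple.
    by constructor.
  pose x0 := tnth vs (Ordinal n_gt0).
  apply: (iffP (all_iotaP _ _)) => [lev|/(sortedP x0) lev i].
    apply/(sortedP x0) => i; rewrite size_tuple => lti; have lti' := ltnW lti.
    have /implyP/(_ lti) := lev (Ordinal lti').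
    by rewrite /= /key !vsE // lex_leE ?szv.
  apply/implyP => lti; have := lev i; rewrite size_tuple => /(_ lti).
  by rewrite /= /key !vsE // lex_leE ?szv.
have c5 : reflect (uniq ps)
    (all (fun i => all (fun j => (nth 0 p i == nth 0 p j) ==> (i == j)) (iota 0 n)) (iota 0 n)).
  apply: (iffP (all_iotaP _ _)) => [up|up i].
    rewrite -[tval ps]map_tnth_enum map_inj_uniq ?enum_uniq // => i j Eij.
    have /all_iotaP/(_ j) := up i; rewrite -!pE Eij eqxx /= => /eqP; exact: val_inj.
  apply/all_iotaP => j; apply/implyP; rewrite -!pE => /eqP/val_inj/(tuple_uniqP _ up) -> //.
have c6 : reflect (forall i, tnth us i = tnth vs (tnth ps i))
    (all (fun i => all (fun k =>
        nth 0%R (nth [::] u i) k == nth 0%R (nth [::] v (nth 0 p i)) k) (iota 0 h)) (iota 0 n)).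
  apply: (iffP (all_iotaP _ _)) => uv i.
    apply: eq_from_tnth => k; have /all_iotaP/(_ k) := uv i.
    by rewrite uuE vvE -pE => /eqP.
  by apply/all_iotaP => k; rewrite -pE -uuE -vvE uv.
have keyE i j : (key keys (tnth us i) == key keys (tnth us j)) =
    all (fun l => nth 0%R (nth [::] u i) l == nth 0%R (nth [::] u j) l) (iota 0 keys).
  have szu i' : keys <= size (tnth us i') by rewrite size_tuple.
  apply/eqP/all_iotaP => [E l | E].
    have nk (i' : 'I_n) : nth 0%R (nth [::] u i') l = nth 0%R (key keys (tnth us i')) l.
      by rewrite /key nth_take // uE.
    by rewrite !nk E.
  rewrite /key; apply: (@eq_from_nth _ 0%R); rewrite !size_takel // => l ltl.
  by rewrite !nth_take // !uE; apply/eqP/(E (Ordinal ltl)).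
have c7 : reflect (st -> forall i j : 'I_n, i < j ->
      key keys (tnth us i) = key keys (tnth us j) -> tnth ps i < tnth ps j)
    (st ==> all (fun i => all (fun j => ((i < j) &&
        all (fun l => nth 0%R (nth [::] u i) l == nth 0%R (nth [::] u j) l) (iota 0 keys)) ==>
        (nth 0 p i < nth 0 p j)) (iota 0 n)) (iota 0 n)).
  apply: (iffP implyP) => stab /stab{}stab.
    move=> i j lt_ij /eqP Ek; have /all_iotaP/(_ j) := all_iotaP _ _ stab i.
    by rewrite lt_ij -keyE Ek !pE.
  apply/all_iotaP => i; apply/all_iotaP => j; apply/implyP => /andP[lt_ij].
  by rewrite -keyE -!pE => /eqP; apply: stab.
have c8 : (forall i, in_tuple_domain (tnth us i) (tnth Us i)) ->
   reflect (dj -> disjoint_tuple_domains Us)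
    (dj ==> all (fun i => all (fun j =>
        (i == j) || disjoint_domain (nth [::] U i) (nth [::] U j)) (iota 0 n)) (iota 0 n)).
  move=> uU; apply: (iffP implyP) => dU /dU{}dU.
    move=> i j ne_ij; have /all_iotaP/(_ j) := all_iotaP _ _ dU i.
    by rewrite -!UE val_eqE (negPf ne_ij) => /(disjoint_domainP (uU i) (uU j)).
  apply/all_iotaP => i; apply/all_iotaP => j; rewrite -!UE val_eqE; case: eqVneq => //= ne_ij.
  exact/(disjoint_domainP (uU i) (uU j))/dU.
split; last by case=> dU [uU /c2 vV /c3 pQ [/c4 sv /c5 up /c6 uv /c7 stab]];
  rewrite /core vV pQ sv up uv stab (introT c1 uU) (introT (c8 uU) dU).
case/and5P=> /c1 uU /c2 vV /c3 pQ /c4 sv /and4P[/c5 up /c6 uv /c7 stab /(c8 uU) dU].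
by split.
Qed.

End Core.

Section PtimeLexLe.
Context {X : Type} {eX : enc X}.

Lemma ptime_lex_le (k : X -> nat) (s t : X -> seq int) :
  ptime k -> ptime s -> ptime t -> ptime (fun x => lex_le (k x) (s x) (t x)).
Proof.
move=> kP sP tP; pose g (q : X * nat * bool) :=
  (nth 0 (s q.1.1) q.1.2 <= nth 0 (t q.1.1) q.1.2)%R &&
  ((nth 0 (t q.1.1) q.1.2 <= nth 0 (s q.1.1) q.1.2)%R ==> q.2).
have gP : ptime g by rewrite /g; ptime; apply: ptime_lez; ptime.
by apply: (ptime_foldr_small (n := 3) (g := g)); [exact: sz_bool | | ptime | ptime].
Qed.

End PtimeLexLe.

Section PtimeCore.
Context {X : Type} {eX : enc X}.

Lemma ptime_core st dj (n h keys : X -> nat) (U V : X -> seq (seq (seq int)))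
    (Q : X -> seq (seq nat)) (u v : X -> seq (seq int)) (p : X -> seq nat) :
  ptime n -> ptime h -> ptime keys -> ptime U -> ptime V -> ptime Q -> ptime u -> ptime v ->
  ptime p ->
  ptime (fun x => core (n x) (h x) (keys x) st dj (U x) (V x) (Q x) (u x) (v x) (p x)).
Proof.
move=> nP hP kP UP VP QP uP vP pP; rewrite /core /in_domain /disjoint_domain.
by ptime; apply: ptime_lex_le; ptime.
Qed.

End PtimeCore.

Definition rectangular (T : Type) (n h : nat) (s : seq (seq T)) : bool :=
  (size s == n) && all (fun x => size x == h) s.

Definition small n (Q : seq (seq nat)) : bool := (size Q == n) && all (all (fun j => j < n)) Q.

Lemma rectangularP (T : eqType) n h (s : seq (seq T)) :
  reflect (exists t : n.-tuple (h.-tuple T), map val t = s) (rectangular n h s).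
Proof.
apply: (iffP andP) => [[/eqP szs /allP szx] | [t <-]]; last first.
  rewrite size_map size_tuple eqxx; split=> //.
  by apply/allP => x /mapP[y _ ->]; rewrite size_tuple.
have szn (i : 'I_n) : size (nth [::] s i) == h.
  by apply: szx; rewrite mem_nth // szs.
exists [tuple Tuple (szn i) | i < n].
apply: (@eq_from_nth _ [::]) => [|i]; rewrite size_map size_tuple ?szs // => lti.
by rewrite -[i]/(nat_of_ord (Ordinal lti)) (nth_map (Tuple (szn (Ordinal lti)))) ?size_tuple //
  -tnth_nth tnth_mktuple.
Qed.

Lemma smallP n Q :
  reflect (exists Qs : n.-tuple (seq 'I_n), map (map val) Qs = Q) (small n Q).
Proof.
apply: (iffP andP) => [[/eqP szQ /allP ltQ] | [t <-]]; last first.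
  rewrite size_map size_tuple eqxx; split=> //; apply/allP => D /mapP[y _ ->].
  by apply/allP => j /mapP[j' _ ->]; exact: (ltn_ord j').
exists [tuple pmap insub (nth [::] Q i) | i < n].
apply: (@eq_from_nth _ [::]) => [|i]; rewrite size_map size_tuple ?szQ // => lti.
rewrite -[i]/(nat_of_ord (Ordinal lti)) (nth_map [::]) ?size_tuple // -tnth_nth tnth_mktuple.
have /ltQ : nth [::] Q i \in Q by rewrite mem_nth ?szQ.
rewrite pmap_filter; last by move=> j; rewrite /= insubK.
by move=> ltD; apply/all_filterP; apply: sub_all ltD => j ltj; rewrite /= insubT.
Qed.

Lemma map_tnth T T' (d : T') (f : T -> T') n (t : n.-tuple T) s (i : 'I_n) :
  map f t = s -> f (tnth t i) = nth d s i.
Proof. by move<-; rewrite (nth_map (tnth t i)) ?size_tuple // -tnth_nth. Qed.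

Lemma sz_le_nth X Y {eX : enc X} {eY : enc Y} (x0 : X) (y0 : Y) s t : size s = size t ->
  (forall i, i < size s -> sz (nth x0 s i) <= sz (nth y0 t i)) -> sz s <= sz t.
Proof.
elim: s t => [|x s IHs] [|y t] //= [szs] le_st; rewrite !sz_cons ltnS leq_add //.
  exact: (le_st 0).
by apply: IHs => // i lti; apply: (le_st i.+1).
Qed.

Lemma sz_le_size (X : eqType) {eX : enc X} (s : seq X) m :
  (forall x, x \in s -> sz x <= m) -> sz s <= size s * m.+1 + 1.
Proof.
elim: s => // x s IHs le_m; rewrite sz_cons /=; have := le_m x (mem_head _ _).
have : sz s <= size s * m.+1 + 1 by apply: IHs => y ys; apply: le_m; rewrite in_cons ys orbT.
by rewrite mulSn; set a := size s * _; move: (sz x) (sz s) => b c; lia.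
Qed.

Section CoreSupport.
Variables (n h keys : nat) (st dj : bool).
Variables (U V : seq (seq domain)) (Q : seq (seq nat)).
Variables (Us Vs : n.-tuple (h.-tuple domain)) (Qs : n.-tuple (seq 'I_n)).
Hypotheses (le_keys : keys <= h).
Hypotheses (UE : map val Us = U) (VE : map val Vs = V) (QE : map (map val) Qs = Q).

Lemma core_sound u v p : rectangular n h u -> rectangular n h v -> core n h keys st dj U V Q u v p ->
  (dj -> disjoint_tuple_domains Us) /\ ks_support st keys Us Vs Qs.
Proof.
move=> /rectangularP[us uE] /rectangularP[vs vE] coreP'.
have ltp (i : 'I_n) : nth 0 p i < n.
  by case/and3P: coreP' => _ _ /andP[/all_iotaP/(_ i)/andP[]].
pose ps : n.-tuple 'I_n := [tuple Ordinal (ltp i) | i < n].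
have pE i : tnth ps i = nth 0 p i :> nat by rewrite tnth_mktuple.
have := coreP st dj le_keys (fun i => map_tnth [::] i UE) (fun i => map_tnth [::] i VE)
  (fun i => map_tnth [::] i QE) (fun i => map_tnth [::] i uE) (fun i => map_tnth [::] i vE) pE.
by case=> /(_ coreP')[dU sup] _; split=> //; exists us, vs, ps.
Qed.

(** Sizes: every chosen value is listed in its domain, so [u] and [v] are no larger than [U] and
    [V], and [p] consists of [n] unary numbers below [n]. *)
Lemma core_complete : (dj -> disjoint_tuple_domains Us) -> ks_support st keys Us Vs Qs ->
  exists u v p, [/\ rectangular n h u, rectangular n h v, core n h keys st dj U V Q u v p
    & [/\ sz u <= sz U, sz v <= sz V & sz p <= n * n.*2.+2 + 1]].
Proof.
move=> dU [us [vs [ps sup]]].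
exists (map val us), (map val vs), (map val ps); split.
- by apply/rectangularP; exists us.
- by apply/rectangularP; exists vs.
- have pE i : tnth ps i = nth 0 (map val ps) i :> nat by rewrite -(map_tnth 0 i erefl).
  apply/(coreP st dj le_keys (fun i => map_tnth [::] i UE) (fun i => map_tnth [::] i VE)
    (fun i => map_tnth [::] i QE) (fun i => map_tnth [::] i erefl)
    (fun i => map_tnth [::] i erefl) pE).
  by split.
have [uU vV _ _] := sup.
have le_sz (w : n.-tuple (h.-tuple int)) (W : n.-tuple (h.-tuple domain)) S :
    map val W = S -> (forall i, in_tuple_domain (tnth w i) (tnth W i)) -> sz (map val w) <= sz S.
  move=> WS wW; apply: (sz_le_nth (x0 := [::]) (y0 := [::])).
    by rewrite -WS !size_map !size_tuple.
  rewrite size_map size_tuple => i lti.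
  rewrite -[i]/(nat_of_ord (Ordinal lti)) -(map_tnth [::] _ erefl) -(map_tnth [::] _ WS).
  apply: (sz_le_nth (x0 := 0%R) (y0 := [::])); first by rewrite !size_tuple.
  rewrite size_tuple => k ltk; have := wW (Ordinal lti) (Ordinal ltk).
  by rewrite (tnth_nth 0%R) (tnth_nth [::]) => /sz_mem/ltnW.
split; [exact: le_sz UE uU | exact: le_sz VE vV | ].
rewrite -[X in X * _](size_tuple ps) -(size_map val ps); apply: sz_le_size => j /mapP[j' _ ->].
by rewrite sz_nat; have := ltn_ord j'; rewrite /=; lia.
Qed.

End CoreSupport.

(** Bounds trees by lengths of codes. Each level of lists raises the factor by one, from 5 for an
    integer to 8 for lists of lists of domains. *)
Lemma size_enc_seq T {eT : enc T} (P : pred T) (e : T -> seq symbol) c (s : seq T) :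
  (forall x, 0 < size (e x)) -> (forall x, P x -> sz x <= c * size (e x)) -> all P s ->
  sz s <= c.+1 * size (enc_seq e s).
Proof.
move=> e_gt0 le_e; rewrite /enc_seq /= size_cat /= addn1.
elim: s => [|x s IHs]; first by rewrite sz_nil.
case/andP=> /le_e{}le_e /IHs; rewrite sz_cons /= size_cat; set F := size (flatten _).
rewrite (_ : (size (e x) + F).+2 = size (e x) + F.+2); last by lia.
by rewrite mulnDr [c.+1 * size (e x)]mulSn; have := e_gt0 x; lia.
Qed.

Lemma size_enc_int z : sz z <= 5 * size (enc_int z).
Proof.
rewrite /enc_int nat_bitsE /= size_map -[sz z]/(sz (int_word z)) sz_cons.
have : sz (bits `|z|) <= size (bits `|z|) * 4 + 1.
  by apply: sz_le_size => b _; apply: sz_bool.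
by have := sz_bool (0 <= z)%R; lia.
Qed.

Lemma size_enc_domain (D : domain) : sz D <= 6 * size (enc_domain D).
Proof. by apply: (size_enc_seq (P := predT)); rewrite ?all_predT // => z _; apply: size_enc_int. Qed.

Lemma size_enc_domains (s : seq domain) : sz s <= 7 * size (enc_seq enc_domain s).
Proof. by apply: (size_enc_seq (P := predT)); rewrite ?all_predT // => D _; apply: size_enc_domain. Qed.

Lemma size_enc_domainss (s : seq (seq domain)) :
  sz s <= 8 * size (enc_seq (enc_seq enc_domain) s).
Proof. by apply: (size_enc_seq (P := predT)); rewrite ?all_predT // => D _; apply: size_enc_domains. Qed.

Lemma size_le_enc_seq T (e : T -> seq symbol) (s : seq T) :
  (forall x, 0 < size (e x)) -> size s <= size (enc_seq e s).
Proof.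
move=> e_gt0; rewrite /enc_seq /= size_cat /=; elim: s => //= x s IHs.
by rewrite size_cat; have := e_gt0 x; lia.
Qed.

Definition enc_positions (D : seq nat) : seq symbol := enc_domain [seq Posz j.+1 | j <- D].

(** Positions are binary in the code but unary in the tree, so the factor grows with [N]; this is
    one reason why [cert_bound] is quadratic. *)
Lemma size_enc_positions N (Q : seq (seq nat)) : all (all (fun j => j < N)) Q ->
  sz Q <= N.*2.+3 * size (enc_seq enc_positions Q).
Proof.
apply: size_enc_seq => // D ltD; rewrite /enc_positions /enc_domain enc_seq_map.
apply: size_enc_seq ltD => // j ltj; rewrite sz_nat.
apply: leq_trans (_ : N.*2.+1 * 1 <= _); first by lia.
by rewrite leq_mul2l.
Qed.

Lemma enc_pdomains n (Qs : n.-tuple (seq 'I_n)) :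
  enc_seq (@enc_pdomain n) Qs = enc_seq enc_positions (map (map val) Qs).
Proof.
by rewrite enc_seq_map; apply: eq_enc_seq => D; rewrite /= /enc_pdomain /enc_positions -map_comp.
Qed.

Definition cert_bound (w : seq symbol) : nat := 100 * (sz w * sz w) + 100 * sz w + 100.

Lemma cert_bound_poly : polyb cert_bound.
Proof. by rewrite /cert_bound; polyb. Qed.

Definition singl (T : Type) (s : seq T) : seq (seq T) := [seq [:: D] | D <- s].

Definition check_sort (dj : bool) (U V : seq domain) (Q : seq (seq nat))
    (u v : seq (seq int)) (p : seq nat) : bool :=
  [&& size V == size U, small (size U) Q, rectangular (size U) 1 u, rectangular (size U) 1 v
    & core (size U) 1 1 false dj (singl U) (singl V) Q u v p].

Lemma val_singles n (U : n.-tuple domain) : map val (singles U) = singl U.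
Proof. by rewrite /singles /= -map_comp. Qed.

Lemma check_sort_sound dj U V Q u v p : check_sort dj U V Q u v p ->
  exists Us Vs (Qs : (size U).-tuple (seq 'I_(size U))),
    [/\ tval Us = U, tval Vs = V, map (map val) Qs = Q, dj -> disjoint_domains Us
      & sort3_has_support (Sort3Inst Us Vs Qs)].
Proof.
case/and5P=> /eqP szV /smallP[Qs QE] uS vS; set n := size U in Qs QE uS vS * => coreP'.
pose Us := tup [::] n U; pose Vs := tup [::] n V.
have UE : tval Us = U by rewrite /Us tupE.
have VE : tval Vs = V by rewrite /Vs tupE.
have UE1 : map val (singles Us) = singl U by rewrite val_singles UE.
have VE1 : map val (singles Vs) = singl V by rewrite val_singles VE.
exists Us, Vs, Qs; have [dU sup] := core_sound (leqnn 1) UE1 VE1 QE uS vS coreP'.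
by split=> // [/dU/disjoint_singles | ]; last by apply/sort3_ks.
Qed.

Lemma check_sort_complete (dj : bool) n (U V : n.-tuple domain) (Q : n.-tuple (seq 'I_n)) :
  (dj -> disjoint_domains U) -> sort3_has_support (Sort3Inst U V Q) ->
  exists u v p, check_sort dj U V (map (map val) Q) u v p /\
    [/\ sz u <= sz (singl U), sz v <= sz (singl V) & sz p <= n * n.*2.+2 + 1].
Proof.
move=> dU /sort3_ks sup.
have dU1 : dj -> disjoint_tuple_domains (singles U) by move=> /dU/disjoint_singles.
have [u [v [p [uS vS coreP' szs]]]] := core_complete (leqnn 1) (val_singles U)
  (val_singles V) (erefl (map (map val) Q)) dU1 sup.
exists u, v, p; split=> //; rewrite /check_sort !size_tuple eqxx uS vS coreP' !andbT /=.
by apply/smallP; exists Q.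
Qed.

Lemma sz_singl (s : seq domain) : sz (singl s) <= 3 * sz s.
Proof.
by elim: s => // D s IHs; rewrite /= !sz_cons sz_nil; lia.
Qed.

Lemma in_NP_ext (A : finType) (L L' : language A) : (forall x, L x <-> L' x) -> in_NP L -> in_NP L'.
Proof.
move=> LL' [B [V [p [VP LV]]]]; exists B, V, p; split=> // x.
exact: iff_trans (iff_sym (LL' x)) (LV x).
Qed.

Section PtimeChecks.
Context {X : Type} {eX : enc X}.

Lemma ptime_rectangular T {eT : enc T} (n h : X -> nat) (s : X -> seq (seq T)) :
  ptime n -> ptime h -> ptime s -> ptime (fun x => rectangular (n x) (h x) (s x)).
Proof. by move=> nP hP sP; rewrite /rectangular; ptime. Qed.

Lemma ptime_small (n : X -> nat) (Q : X -> seq (seq nat)) :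
  ptime n -> ptime Q -> ptime (fun x => small (n x) (Q x)).
Proof. by move=> nP QP; rewrite /small; ptime. Qed.

Lemma ptime_enc_positions (Q : X -> seq nat) : ptime Q -> ptime (fun x => enc_positions (Q x)).
Proof. by move=> QP; rewrite /enc_positions; ptime. Qed.

End PtimeChecks.

Lemma ptime_check_sort dj X {eX : enc X} (U V : X -> seq domain) (Q : X -> seq (seq nat))
    (u v : X -> seq (seq int)) (p : X -> seq nat) :
  ptime U -> ptime V -> ptime Q -> ptime u -> ptime v -> ptime p ->
  ptime (fun x => check_sort dj (U x) (V x) (Q x) (u x) (v x) (p x)).
Proof.
move=> UP VP QP uP vP pP; rewrite /check_sort /singl; ptime.
- by apply: ptime_small; ptime.
- by apply: ptime_rectangular; ptime.
- by apply: ptime_rectangular; ptime.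
by apply: ptime_core; ptime.
Qed.

Lemma coded_sort_cert :
  coded 10 (seq domain * seq domain * seq (seq nat) * seq (seq int) * seq (seq int) * seq nat)%type.
Proof.
have cd : coded 4 (seq domain) by do 2!apply: coded_seq => //; apply: coded_int.
have cn : coded 3 (seq nat) by apply: coded_seq => //; apply: coded_nat.
do 5!(apply: coded_pair => //; last by apply: coded_le cd || apply: coded_le cn ||
  (apply: (@coded_le 4) => //; apply: coded_seq)).
by apply: coded_le cd.
Qed.

(** * Membership in NP *)

Lemma cert_bound_le (w : seq symbol) n : n <= 100 * (size w * size w) + 100 * size w + 100 ->
  n <= cert_bound w.
Proof.
have le_w : size w <= sz w := ltnW (sz_size w).
move/leq_trans; apply; rewrite /cert_bound leq_add2r leq_add // leq_mul2l /= ?leq_mul //.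
Qed.

Lemma size_enc_nat_domain (s : seq domain) : size s <= size (enc_seq enc_domain s).
Proof. exact: size_le_enc_seq. Qed.

(** Here [a], [b], [c] are the sizes of [u], [v], [p], then [d], [e], [q] those of [U], [V], [Q],
    and [f], [g] those of [singl U], [singl V]; [A], [B], [C] are the lengths of the three codes.
    The products are generalized to make the goal linear. *)
Lemma sort_cert_arith a b c d e f g q n A B C :
  a <= f -> b <= g -> c <= n * n.*2.+2 + 1 -> n <= A -> q <= n.*2.+3 * C + 1 ->
  f <= 3 * d -> g <= 3 * e -> d <= 7 * A -> e <= 7 * B -> forall S, S = A + (B + C) ->
  (((((d + e).+1 + q).+1 + a).+1 + b).+1 + c).+1 <= 100 * (S * S) + 100 * S + 100.
Proof.
move=> leaf lebg lec len leq lef leg led lee S ES.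
have c1 : n * n.*2.+2 <= S * S.*2.+2 by apply: leq_mul; lia.
have q1 : n.*2.+3 * C <= S.*2.+3 * S by apply: leq_mul; lia.
have SS : S.*2.+3 * S = 2 * (S * S) + 3 * S by rewrite -mul2n; nia.
have SS' : S * S.*2.+2 = 2 * (S * S) + 2 * S by rewrite -mul2n; nia.
rewrite SS in q1; rewrite SS' in c1.
move: c1 q1 lec leq; move: (S * S) (n * _) (_ * C) => x y z c1 q1 lec leq.
lia.
Qed.

(** The certificate is the instance together with a support; the first conjunct of [check] verifies
    that the instance is the one encoded by [w]. *)
Theorem sort3_NP (dj : bool) : in_NP (problem sort3_enc
  (fun I => (dj -> disjoint_domains (s3_U I)) /\ sort3_has_support I)).
Proof.
pose check w (U V : seq domain) Q u v p :=
  (w == enc_seq enc_domain U ++ enc_seq enc_domain V ++ enc_seq enc_positions Q) &&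
  check_sort dj U V Q u v p.
pose R q := check q.1 q.2.1.1.1.1.1 q.2.1.1.1.1.2 q.2.1.1.1.2 q.2.1.1.2 q.2.1.2 q.2.2.
apply: (in_NP_intro (R := R) coded_sort_cert _ cert_bound_poly).
- rewrite /R /check; ptime; first by apply: ptime_enc_positions; ptime.
  by apply: ptime_check_sort; ptime.
- move=> w [[[[[U V] Q] u] v] p]; rewrite -[R _]/(check w U V Q u v p).
  case/andP=> /eqP-> /check_sort_sound[Us [Vs [Qs [UE VE QE dU sup]]]].
  exists (Sort3Inst Us Vs Qs) => //.
  by rewrite /sort3_enc enc_pdomains -[in LHS]UE -[in LHS]VE -[in LHS]QE.
move=> w [[n U V Q] -> [dU sup]].
have [u [v [p [chk [szu szv szp]]]]] := check_sort_complete dU sup.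
have Ew : sort3_enc (Sort3Inst U V Q) = enc_seq enc_domain U ++ enc_seq enc_domain V ++
    enc_seq enc_positions (map (map val) Q) by rewrite /sort3_enc enc_pdomains.
exists (tval U, tval V, map (map val) Q, u, v, p); first by apply/andP; rewrite Ew eqxx.
apply: cert_bound_le; rewrite !sz_pair.
have Qn : all (all (fun j => j < n)) (map (map val) Q).
  by have /andP[_] : small n (map (map val) Q) by apply/smallP; exists Q.
have le_n : n <= size (enc_seq enc_domain U).
  by rewrite -[X in X <= _](size_tuple U) size_enc_nat_domain.
rewrite Ew !size_cat.
exact: (sort_cert_arith szu szv szp le_n (leq_trans (size_enc_positions Qn) (leq_addr 1 _)) (sz_singl U) (sz_singl V)
  (size_enc_domains U) (size_enc_domains V) erefl).
Qed.

Lemma val_full n : map (map val) (full n) = nseq n (iota 0 n).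
Proof.
rewrite (_ : full n = nseq n (enum 'I_n) :> seq (seq 'I_n)) ?map_nseq ?val_enum_ord //.
apply: (@eq_from_nth _ [::]) => [|i]; rewrite size_tuple ?size_nseq // => lti.
by rewrite nth_nseq lti -[i]/(nat_of_ord (Ordinal lti)) -tnth_nth tnth_mktuple.
Qed.

(** The check is that of sort(U,V,P) with unrestricted domains for [P], which the verifier generates
    from [size U]. *)
Theorem sort2_NP (dj : bool) : in_NP (problem sort2_enc
  (fun I => (dj -> disjoint_domains (s2_U I)) /\ sort2_has_support I)).
Proof.
pose check w (U V : seq domain) u v p :=
  (w == enc_seq enc_domain U ++ enc_seq enc_domain V) &&
  check_sort dj U V (nseq (size U) (iota 0 (size U))) u v p.
pose R (q : seq symbol * (seq domain * seq domain * seq (seq nat) * seq (seq int) *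
  seq (seq int) * seq nat)) := check q.1 q.2.1.1.1.1.1 q.2.1.1.1.1.2 q.2.1.1.2 q.2.1.2 q.2.2.
apply: (in_NP_intro (R := R) coded_sort_cert _ cert_bound_poly).
- by rewrite /R /check; ptime; apply: ptime_check_sort; ptime.
- move=> w [[[[[U V] Q] u] v] p]; rewrite -[R _]/(check w U V u v p).
  case/andP=> /eqP-> /check_sort_sound[Us [Vs [Qs [UE VE QE dU sup]]]].
  exists (Sort2Inst Us Vs); first by rewrite /sort2_enc -[in LHS]UE -[in LHS]VE.
  split=> //; suff full_Qs i j : j \in tnth Qs i by apply/(sort3_full Us Vs full_Qs).
  by rewrite -(mem_map val_inj) (map_tnth [::] i QE) nth_nseq ltn_ord mem_iota /=.
move=> w [[n U V] -> [dU /(@sort3_full _ U V (full n) (@mem_full n)) sup]].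
have [u [v [p [chk [szu szv szp]]]]] := check_sort_complete dU sup.
have Ew : sort2_enc (Sort2Inst U V) = enc_seq enc_domain U ++ enc_seq enc_domain V by [].
exists (tval U, tval V, [::], u, v, p).
  by apply/andP; rewrite Ew eqxx size_tuple -val_full.
apply: cert_bound_le; rewrite !sz_pair.
have le_n : n <= size (enc_seq enc_domain U).
  by rewrite -[X in X <= _](size_tuple U) size_enc_nat_domain.
rewrite Ew size_cat -[size (enc_seq _ V)]addn0.
by apply: (sort_cert_arith szu szv szp le_n _ (sz_singl U) (sz_singl V)
  (size_enc_domains U) (size_enc_domains V) erefl); rewrite sz_nil muln0.
Qed.

Lemma coded_keysorting_cert : coded 15 (int * int * nat * nat * seq (seq domain) *
  seq (seq domain) * seq (seq nat) * seq (seq int) * seq (seq int) * seq nat)%type.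
Proof.
have cd : coded 5 (seq (seq domain)) by do 3!apply: coded_seq => //; apply: coded_int.
have cw : coded 4 (seq (seq int)) by do 2!apply: coded_seq => //; apply: coded_int.
have cq : coded 4 (seq (seq nat)) by do 2!apply: coded_seq => //; apply: coded_nat.
have cn : coded 3 (seq nat) by apply: coded_seq => //; apply: coded_nat.
have prod l l' T U (eT : enc T) (eU : enc U) :
    coded l T -> coded l' U -> l' <= l -> l < 32 -> coded l.+1 (T * U)%type.
  by move=> cT cU le_l ltl; apply: coded_pair => //; apply: coded_le cU.
have c5 := coded_le (isT : 2 <= 6) coded_int.
have c8 := prod _ _ _ _ _ _ (prod _ _ _ _ _ _ (prod _ _ _ _ _ _ c5 c5 isT isT) coded_nat isT isT)
  coded_nat isT isT.
have c11 := prod _ _ _ _ _ _ (prod _ _ _ _ _ _ (prod _ _ _ _ _ _ c8 cd isT isT) cd isT isT)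
  cq isT isT.
exact: prod (prod _ _ _ _ _ _ (prod _ _ _ _ _ _ c11 cw isT isT) cw isT isT) cn isT isT.
Qed.

(* For [n = 0] the arity [h] and the number of keys may be exponential in the
   length of the input, so that their unary values are only checked otherwise. *)
Definition check_keysorting (dj : bool) (w : seq symbol) (zh zk : int) (h k : nat)
    (U V : seq (seq domain)) (Q : seq (seq nat)) (u v : seq (seq int)) (p : seq nat) : bool :=
  [&& w == enc_int zh ++ enc_int zk ++ enc_seq (enc_seq enc_domain) U ++
        enc_seq (enc_seq enc_domain) V ++ enc_seq enc_positions Q,
      ~~ (zk <= 0)%R, (zk <= zh)%R, (size U == 0) || ((zh == Posz h) && (zk == Posz k)),
      rectangular (size U) h U, rectangular (size U) h V, small (size U) Q, rectangular (size U) h u,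
      rectangular (size U) h v & core (size U) h k true dj U V Q u v p].

Lemma rectangular0 T h h' (s : seq (seq T)) : rectangular 0 h s = rectangular 0 h' s.
Proof. by case: s. Qed.

Lemma enc_tuples h n (U : n.-tuple (h.-tuple domain)) :
  enc_seq (@enc_tuple_domain h) U = enc_seq (enc_seq enc_domain) (map val U).
Proof. by rewrite enc_seq_map. Qed.

Lemma check_keysorting_sound dj w zh zk h k U V Q u v p :
  check_keysorting dj w zh zk h k U V Q u v p ->
  problem keysorting_enc
    (fun I => (dj -> disjoint_tuple_domains (ks_U I)) /\ keysorting_has_support I) w.
Proof.
case/and5P=> /eqP-> zk_gt0 le_zkh hk /and5P[US VS QS uS /andP[vS cP]].
have [H EH] : exists H : nat, zh = H by exists `|zh|%N; lia.
have [K EK] : exists K : nat, zk = K by exists `|zk|%N; lia.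
subst zh zk.
have keysP : 0 < K <= H by lia.
have {hk US VS uS vS cP} [US [VS [uS [vS cP]]]] : rectangular (size U) H U /\ rectangular (size U) H V /\
    rectangular (size U) H u /\ rectangular (size U) H v /\ core (size U) H K true dj U V Q u v p.
  (* Without variables all lists are empty, and the checks hold for any arity and number of keys. *)
  case/orP: hk => [/eqP n0 | /andP[/eqP[->] /eqP[->]]] //; move: US VS uS vS cP; rewrite n0.
  by rewrite !(rectangular0 h H).
have /rectangularP[Us UE] := US; have /rectangularP[Vs VE] := VS; have /smallP[Qs QE] := QS.
have le_KH : K <= H by case/andP: keysP.
have [dU sup] := core_sound le_KH UE VE QE uS vS cP.
exists (@KeysortingInst (size U) H K keysP Us Vs Qs).
  by rewrite /keysorting_enc !enc_tuples enc_pdomains -[in LHS]UE -[in LHS]VE -[in LHS]QE.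
by split=> //; apply/keysorting_support.
Qed.

Lemma keysorting_cert_arith a b c d e f g q n A B C D E h k : a <= d -> b <= e ->
  c <= n * n.*2.+2 + 1 -> n <= A -> q <= n.*2.+3 * C -> d <= 8 * A -> e <= 8 * B ->
  f <= 5 * D -> g <= 5 * E -> h <= d.*2.+1 -> k <= h ->
  forall S, S = D + (E + (A + (B + C))) ->
  (((((((((f + g).+1 + h).+1 + k).+1 + d).+1 + e).+1 + q).+1 + a).+1 + b).+1 + c).+1
    <= 100 * (S * S) + 100 * S + 100.
Proof.
move=> lead lebe lec len leq led lee lef leg leh lek S ES.
have c1 : n * n.*2.+2 <= S * S.*2.+2 by apply: leq_mul; lia.
have q1 : n.*2.+3 * C <= S.*2.+3 * S by apply: leq_mul; lia.
have SS : S.*2.+3 * S = 2 * (S * S) + 3 * S by rewrite -mul2n; nia.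
have SS' : S * S.*2.+2 = 2 * (S * S) + 2 * S by rewrite -mul2n; nia.
rewrite SS in q1; rewrite SS' in c1.
move: c1 q1 lec leq; move: (S * S) (n * _) (_ * C) => x y z c1 q1 lec leq.
lia.
Qed.

Lemma check_keysorting_complete (dj : bool) I :
  (dj -> disjoint_tuple_domains (ks_U I)) -> keysorting_has_support I ->
  exists zh zk h k U V Q u v p, check_keysorting dj (keysorting_enc I) zh zk h k U V Q u v p /\
    sz (zh, zk, h, k, U, V, Q, u, v, p) <=
      100 * (size (keysorting_enc I) * size (keysorting_enc I)) + 100 * size (keysorting_enc I) + 100.
Proof.
move: I => [n h k keysP Us Vs Qs] dU /keysorting_support; cbn [ks_n ks_h ks_keys ks_U ks_V ks_P] in *.
move=> sup; have [k_gt0 le_kh] := andP keysP.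
pose U := map val Us; pose V := map val Vs; pose Q := map (map val) Qs.
have [u [v [p [uS vS cP [szu szv szp]]]]] :=
  core_complete le_kh (erefl U) (erefl V) (erefl Q) dU sup.
have szU : size U = n by rewrite size_map size_tuple.
have US : rectangular n h U by apply/rectangularP; exists Us.
have VS : rectangular n h V by apply/rectangularP; exists Vs.
have QS : small n Q by apply/smallP; exists Qs.
pose h' := if n == 0 then 0 else h; pose k' := if n == 0 then 0 else k.
have Ew : keysorting_enc (KeysortingInst keysP Us Vs Qs) = enc_int (Posz h) ++ enc_int (Posz k) ++
    enc_seq (enc_seq enc_domain) U ++ enc_seq (enc_seq enc_domain) V ++ enc_seq enc_positions Q.
  by rewrite /keysorting_enc !enc_tuples enc_pdomains.
exists (Posz h), (Posz k), h', k', U, V, Q, u, v, p; split.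
  rewrite /check_keysorting Ew eqxx szU QS /= -ltNge lez_nat ltz_nat k_gt0 le_kh /= /h' /k'.
  case: eqP => [n0 | _] /=; last by rewrite !eqxx US VS uS vS cP.
  by move: US VS uS vS cP; rewrite n0 !(rectangular0 h 0) => -> -> -> ->.
have Qn : all (all (fun j => j < n)) Q by case/andP: QS.
have le_n : n <= size (enc_seq (enc_seq enc_domain) U).
  by rewrite -[X in X <= _]szU size_le_enc_seq.
(* For [n > 0] the arity is the length of the first tuple of domains, so its unary form is small. *)
have le_h : sz h' <= (sz U).*2.+1.
  rewrite sz_nat ltnS leq_double /h'; case: eqP => // /eqP; rewrite -lt0n => n_gt0.
  have /andP[_ /allP hU] := US; have U0 : nth [::] U 0 \in U by rewrite mem_nth ?szU.
  rewrite -(eqP (hU _ U0)); apply: leq_trans (ltnW (sz_size _)) (ltnW (sz_mem U0)).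
have le_k : sz k' <= sz h'.
  by rewrite !sz_nat ltnS leq_double /k' /h'; case: eqP.
rewrite !sz_pair Ew !size_cat.
exact: (keysorting_cert_arith szu szv szp le_n (size_enc_positions Qn) (size_enc_domainss U)
  (size_enc_domainss V) (size_enc_int h) (size_enc_int k) le_h le_k erefl).
Qed.

Theorem keysorting_NP (dj : bool) : in_NP (problem keysorting_enc
  (fun I => (dj -> disjoint_tuple_domains (ks_U I)) /\ keysorting_has_support I)).
Proof.
pose R (q : seq symbol * (int * int * nat * nat * seq (seq domain) * seq (seq domain) *
  seq (seq nat) * seq (seq int) * seq (seq int) * seq nat)) :=
  check_keysorting dj q.1 q.2.1.1.1.1.1.1.1.1.1 q.2.1.1.1.1.1.1.1.1.2 q.2.1.1.1.1.1.1.1.2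
    q.2.1.1.1.1.1.1.2 q.2.1.1.1.1.1.2 q.2.1.1.1.1.2 q.2.1.1.1.2 q.2.1.1.2 q.2.1.2 q.2.2.
apply: (in_NP_intro (R := R) coded_keysorting_cert _ cert_bound_poly).
- rewrite /R /check_keysorting; ptime; try by first
    [ apply: ptime_enc_positions; ptime | apply: ptime_lez; ptime | apply: ptime_rectangular; ptime
    | apply: ptime_small; ptime | apply: ptime_core; ptime ].
- by move=> w [[[[[[[[[zh zk] h] k] U] V] Q] u] v] p] /check_keysorting_sound.
move=> w [I -> [dU sup]].
have [zh [zk [h [k [U [V [Q [u [v [p [chk le_sz]]]]]]]]]]] := check_keysorting_complete dU sup.
by exists (zh, zk, h, k, U, V, Q, u, v, p) => //; apply: cert_bound_le.
Qed.

Lemma problem_flag (I : Type) (enc : I -> seq symbol) (dis yes : I -> Prop) :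
  (forall dj : bool, in_NP (problem enc (fun x => (dj -> dis x) /\ yes x))) ->
  in_NP (problem enc yes) /\ in_NP (problem enc (fun x => dis x /\ yes x)).
Proof.
move=> NPdj; split; [apply: in_NP_ext (NPdj false) | apply: in_NP_ext (NPdj true)] => w;
  split=> -[x Ew]; [case=> _ yx | move=> yx | case=> /(_ isT) dx yx | case=> dx yx];
  by exists x.
Qed.

Theorem theorem1 :
  [/\ (* sort(U,V) *)
      NP_complete (problem sort2_enc sort2_has_support) /\
      NP_complete (problem sort2_enc (fun I =>
        disjoint_domains (s2_U I) /\ sort2_has_support I)),
      (* sort(U,V,P) *)
      NP_complete (problem sort3_enc sort3_has_support) /\
      NP_complete (problem sort3_enc (fun I =>
        disjoint_domains (s3_U I) /\ sort3_has_support I))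
    & (* keysorting(U,V,Keys,P) *)
      NP_complete (problem keysorting_enc keysorting_has_support) /\
      NP_complete (problem keysorting_enc (fun I =>
        disjoint_tuple_domains (ks_U I) /\ keysorting_has_support I))].
Proof.
have [s2 s2d] := problem_flag sort2_NP; have [s3 s3d] := problem_flag sort3_NP.
have [ks ksd] := problem_flag keysorting_NP.
have [h2 h2d] := sort2_hard; have [h3 h3d] := sort3_hard; have [hk hkd] := keysorting_hard.
by [].
Qed.
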